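(* Let $\lambda>0$ and $\ell>0$. (i) If $0<\lambda\ell^2\le\hat\lambda$, then $\gamma_{\rm larc}^{\lambda,\ell,1}$ is the unique minimizer of $\mathcal{E}_\lambda$ among nontrivial (i.e. not the line segment) penalized pinned elasticae, up to reflection across the $x$-axis and reparametrization. (ii) If $\lambda\ell^2>\hat\lambda$, then $\gamma_{\rm loop}^{\lambda,\ell,1}$ is the unique minimizer of $\mathcal{E}_\lambda$ among nontrivial penalized pinned elasticae, up to reflection across the $x$-axis and reparametrization.
   Context: Elliptic functions: for $q\in[0,1)$, $x\in\mathbb{R}$, $\mathrm{F}(x,q)=\int_0^x(1-q^2\sin^2\theta)^{-1/2}\,d\theta$, $\mathrm{E}(x,q)=\int_0^x(1-q^2\sin^2\theta)^{1/2}\,d\theta$, $\mathrm{K}(q)=\mathrm{F}(\pi/2,q)$, $\mathrm{E}(q)=\mathrm{E}(\pi/2,q)$; $\mathrm{am}(\cdot,q)$ is the inverse of $x\mapsto\mathrm{F}(x,q)$, $\mathrm{cn}(x,q)=\cos\mathrm{am}(x,q)$. The function $q\mapsto2\mathrm{E}(q)-\mathrm{K}(q)$ is strictly decreasing on $[0,1)$ with unique zero $q_*\in(0,1)$. On $[1/\sqrt2,1)$ let $f(q)=(4q^4-5q^2+1)\mathrm{K}(q)+(-8q^4+8q^2-1)\mathrm{E}(q)$ and $g(q)=8(2\mathrm{E}(q)-\mathrm{K}(q))^2(2q^2-1)$. $f$ has a unique zero $\hat q\in[1/\sqrt2,1)$ (in $(1/\sqrt2,q_* )$); $\hat\lambda:=g(\hat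 q)\approx0.70107$. $g(1/\sqrt2)=0$, $g$ is strictly increasing on $[1/\sqrt2,\hat q]$, strictly decreasing on $[\hat q,q_*]$ with $g(q_* )=0$, strictly increasing on $[q_*,1)$ with $g\to\infty$ at $1$. For $c\in(0,\hat\lambda]$ let $q_2(c)$ be the solution of $g(q)=c$ in $[\hat q,q_* )$; for every $c>0$ let $q_3(c)$ be the unique solution of $g(q)=c$ in $(q_*,1)$. Setting: $A_\ell=\{\gamma\in W^{2,2}(0,1;\mathbb{R}^2): |\gamma'|\neq0$ on $[0,1]$, $\gamma(0)=(0,0),\ \gamma(1)=(\ell,0)\}$; $\mathcal{E}_\lambda[\gamma]=\int_\gamma k^2\,ds+\lambda L[\gamma]$ with $k$ signed curvature, $s$ arclength, $L$ length. A penalized pinned elastica is $\gamma\in A_\ell$ with $\frac{d}{d\varepsilon}\mathcal{E}_\lambda[\gamma+\varepsilon\eta]|_{\varepsilon=0}=0$ for all $\eta\in W^{2,2}(0,1;\mathbb{R}^2)\cap W^{1,2}_0(0,1;\mathbb{R}^2)$. Curves (arclength parametrized on $[0,2\mathrm{K}(q)/\alpha]$): for $\lambda\ell^2\le\hat\lambda$, $\gamma_{\rm larc}^{\lambda,\ell,1}(s)=\frac1\alpha\big(2\mathrm{E}(\mathrm{am}(\alpha s-\mathrm{K}(q),q),q)+2\mathrm{E}(q)-\alpha s,\ 2q\,\mathrm{cn}(\alpha s-\mathrm{K}(q),q)\big)$ with $q=q_2(\lambda\ell^2)$, $\alpha=\frac{2}{\ell}(2\mathrm{E}(q)-\mathrm{K}(q))$;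 $\gamma_{\rm loop}^{\lambda,\ell,1}(s)=\frac1\alpha\big(-2\mathrm{E}(\mathrm{am}(\alpha s-\mathrm{K}(q),q),q)-2\mathrm{E}(q)+\alpha s,\ 2q\,\mathrm{cn}(\alpha s-\mathrm{K}(q),q)\big)$ with $q=q_3(\lambda\ell^2)$, $\alpha=\frac{2}{\ell}(\mathrm{K}(q)-2\mathrm{E}(q))$. *)

(* Defs.v *)
From HB Require Import structures.
From mathcomp Require Import all_boot all_order all_algebra.
From mathcomp Require Import all_classical all_reals all_analysis.
From Stdlib Require Import ClassicalEpsilon.
Set Implicit Arguments. Unset Strict Implicit. Unset Printing Implicit Defensive.
Import Order.TTheory GRing.Theory Num.Theory.
Import numFieldNormedType.Exports.
Local Open Scope classical_set_scope.
Local Open Scope ring_scope.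

Section Defs.
Variable R : realType.
Local Notation mu := (@lebesgue_measure R).

Definition Rint (a b : R) (f : R -> R) : R := \int[mu]_(x in `[a, b]) f x.

Definition oint (a b : R) (f : R -> R) : R :=
  if a <= b then Rint a b f else - Rint b a f.

Definition ellF (x q : R) : R :=
  oint 0 x (fun th => 1 / Num.sqrt (1 - q ^+ 2 * (sin th) ^+ 2)).
Definition ellE (x q : R) : R :=
  oint 0 x (fun th => Num.sqrt (1 - q ^+ 2 * (sin th) ^+ 2)).
Definition ellK (q : R) : R := ellF (pi / 2) q.
Definition ellEc (q : R) : R := ellE (pi / 2) q.
Definition am (u q : R) : R := xget 0 [set x | ellF x q = u].
Definition cn (u q : R) : R := cos (am u q).

Definition qstar : R := xget 0 [set q | 0 < q < 1 /\ 2 * ellEc q - ellK q = 0].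
Definition fq (q : R) : R :=
  (4 * q ^+ 4 - 5 * q ^+ 2 + 1) * ellK q + (- 8 * q ^+ 4 + 8 * q ^+ 2 - 1) * ellEc q.
Definition gq (q : R) : R :=
  8 * (2 * ellEc q - ellK q) ^+ 2 * (2 * q ^+ 2 - 1).
Definition qhat : R := xget 0 [set q | 1 / Num.sqrt 2 <= q < 1 /\ fq q = 0].
Definition lamhat : R := gq qhat.
Definition q2 (c : R) : R := xget 0 [set q | qhat <= q < qstar /\ gq q = c].
Definition q3 (c : R) : R := xget 0 [set q | qstar < q < 1 /\ gq q = c].

Definition curve := R -> R * R.

(* W^{2,2}(0,1) for a scalar function u : a witness w = (b, h) with
   h in L^2(0,1) and u(t) = u(0) + b t + \int_0^t \int_0^s h  on [0,1].
   Then u' = b + \int_0^t h (on [0,1]) and u'' = h (a.e.). *)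
Definition W22wit (u : R -> R) (w : R * (R -> R)) : Prop :=
  measurable_fun (`[0, 1] : set R) w.2 /\
  mu.-integrable (`[0, 1] : set R) (fun x => ((w.2 x) ^+ 2)%:E) /\
  forall t, 0 <= t <= 1 -> u t = u 0 + w.1 * t + Rint 0 t (fun s => Rint 0 s w.2).
Definition W22 (u : R -> R) : Prop := exists w, W22wit u w.
Definition wit (u : R -> R) : R * (R -> R) :=
  epsilon (inhabits (0, fun _ => 0)) (W22wit u).
Definition d1 (u : R -> R) (t : R) : R := (wit u).1 + Rint 0 t (wit u).2.
Definition d2 (u : R -> R) (t : R) : R := (wit u).2 t.

Definition cx (g : curve) : R -> R := fun t => (g t).1.
Definition cy (g : curve) : R -> R := fun t => (g t).2.

Definition W22c (g : curve) : Prop := W22 (cx g) /\ W22 (cy g).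
Definition speed (g : curve) (t : R) : R :=
  Num.sqrt (d1 (cx g) t ^+ 2 + d1 (cy g) t ^+ 2).
Definition curv (g : curve) (t : R) : R :=
  (d1 (cx g) t * d2 (cy g) t - d1 (cy g) t * d2 (cx g) t) / speed g t ^+ 3.

Definition admissible (l : R) (g : curve) : Prop :=
  W22c g /\ (forall t, 0 <= t <= 1 -> speed g t != 0) /\
  g 0 = (0, 0) /\ g 1 = (l, 0).

Definition Elam (lam : R) (g : curve) : R :=
  Rint 0 1 (fun t => curv g t ^+ 2 * speed g t) + lam * Rint 0 1 (speed g).

Definition cvar (g eta : curve) (e : R) : curve :=
  fun t => ((g t).1 + e * (eta t).1, (g t).2 + e * (eta t).2).

Definition test_fun (eta : curve) : Prop :=
  W22c eta /\ eta 0 = (0, 0) /\ eta 1 = (0, 0).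

Definition pp_elastica (lam l : R) (g : curve) : Prop :=
  admissible l g /\
  forall eta, test_fun eta -> is_derive (0 : R) (1 : R) (fun e => Elam lam (cvar g eta e)) 0.

(* trivial = the line segment: the (regular) curve stays on the x-axis *)
Definition is_segment (g : curve) : Prop := forall t, 0 <= t <= 1 -> (g t).2 = 0.

Definition equiv_refl_reparam (g sigma : curve) (L : R) : Prop :=
  exists (s : R) (phi : R -> R),
    (s = 1 \/ s = -1) /\ phi 0 = 0 /\ phi 1 = L /\
    {within `[0, 1], continuous phi} /\
    (forall x y, 0 <= x -> x < y -> y <= 1 -> phi x < phi y) /\
    forall t, 0 <= t <= 1 -> g t = ((sigma (phi t)).1, s * (sigma (phi t)).2).

(* ---------- the explicit curves (arclength, on [0, 2K(q)/alpha]) ---------- *)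
Definition larc_q (lam l : R) : R := q2 (lam * l ^+ 2).
Definition larc_alpha (lam l : R) : R :=
  2 / l * (2 * ellEc (larc_q lam l) - ellK (larc_q lam l)).
Definition larc (lam l : R) : curve := fun s =>
  let q := larc_q lam l in let a := larc_alpha lam l in
  ((2 * ellE (am (a * s - ellK q) q) q + 2 * ellEc q - a * s) / a,
   (2 * q * cn (a * s - ellK q) q) / a).
Definition larc_len (lam l : R) : R := 2 * ellK (larc_q lam l) / larc_alpha lam l.

Definition loop_q (lam l : R) : R := q3 (lam * l ^+ 2).
Definition loop_alpha (lam l : R) : R :=
  2 / l * (ellK (loop_q lam l) - 2 * ellEc (loop_q lam l)).
Definition loop (lam l : R) : curve := fun s =>
  let q := loop_q lam l in let a := loop_alpha lam l in
  ((- 2 * ellE (am (a * s - ellK q) q) q - 2 * ellEc q + a * s) / a,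
   (2 * q * cn (a * s - ellK q) q) / a).
Definition loop_len (lam l : R) : R := 2 * ellK (loop_q lam l) / loop_alpha lam l.

Definition unitrep (sigma : curve) (L : R) : curve := fun t => sigma (L * t).

Definition unique_min_nontrivial (lam l : R) (sigma : curve) (L : R) : Prop :=
  let g0 := unitrep sigma L in
  [/\ pp_elastica lam l g0, ~ is_segment g0,
      (forall g, pp_elastica lam l g -> ~ is_segment g -> Elam lam g0 <= Elam lam g)
    & (forall g, pp_elastica lam l g -> ~ is_segment g -> Elam lam g = Elam lam g0 ->
         equiv_refl_reparam g sigma L)].

End Defs.

(* Main.v *)
(** Taking the first variation of [int k^2 ds + lam L] and applying the du Bois-Reymond lemma
    yields a conserved force, directed along the x-axis because the ends are hinged: for some
    constant [F], a critical curve satisfies [2 k = - F y] and [F x' = (k^2 - lam) |g'|].  Hence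
    [y], as a function of arclength, solves Duffing's equation, and uniqueness for this equation
    identifies every nontrivial critical curve with [n >= 1] half-periods of a wavelike elastica
    of some modulus [q > 1/sqrt 2].  With [W = 2 q^2 - 1], [u = (2 E - K) sqrt W] and
    [h = (2 E - K) / sqrt W + 2 K sqrt W], the condition on the end point reads
    [n |u(q)| = sqrt(lam / 2) l / 2], and the energy is [4 sqrt(lam / 2) n h(q)].  Since
    [h' = - u' / W] with [W] increasing, comparing [h] with an affine function of [u] decides
    between the solutions. *)
Require Import Defs.
From Stdlib Require ClassicalEpsilon.
From HB Require Import structures.
From mathcomp Require Import all_boot all_order all_algebra.
From mathcomp Require Import all_classical all_reals all_analysis.
From mathcomp Require Import measurable_realfun.
From mathcomp Require Import ring lra.
Set Implicit Arguments. Unset Strict Implicit. Unset Printing Implicit Defensive.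
Import Order.TTheory GRing.Theory Num.Theory.
Import numFieldNormedType.Exports.
Local Open Scope classical_set_scope.
Local Open Scope ring_scope.
(* Repeated so that [Rint] is the integral and not the predicate of [archimedean]. *)
Require Import Defs.

(** The force is the constant that goes with invariance under translations. Second derivatives of
    admissible curves exist only almost everywhere, so the equations are handled through absolutely
    continuous functions, in the given parameter and with the speed as a weight. As the curve starts
    on the x-axis, the conservation laws fix its initial tangent up to the sign of its slope: this
    is the reflection in the statement. Since [lam] fixes [al * sqrt W], the scale drops out and
    minimality becomes a scalar inequality between values of [h]. At fixed [lam], the identity
    [h' = - u' / W] expresses that the energy changes with [l] at the rate [- F]. Two obstacles
    shape the comparison. First, [u] rises up to [qhat] and falls afterwards, so two moduli may give
    arcs with the same ends. Second, several half-periods must be weighed against one. The bound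
    [h > |u| / W] serves for the second, except when several arcs compete with one loop; there the
    quantitative estimates [E <= (1 - q^2 / 2) K] and [qstar^2 >= 3 / 4] are needed as well. *)

Section IntervalIntegral.
Variable R : realType.
Implicit Types (a b c x t : R) (f g : R -> R).
Local Notation mu := (@lebesgue_measure R).

Definition intb a b f : Prop := mu.-integrable (`[a, b] : set R) (EFin \o f).

Lemma intb_meas a b f : intb a b f -> measurable_fun (`[a, b] : set R) f.
Proof. by move=> /(measurable_int mu) /measurable_EFinP. Qed.

Lemma eq_intb a b f g : (forall x, a <= x <= b -> f x = g x) -> intb a b f -> intb a b g.
Proof.
move=> fg; apply: eq_integrable => // x; rewrite inE/= in_itv/= => xab.
by rewrite /comp fg.
Qed.

Lemma eq_Rint a b f g : (forall x, a <= x <= b -> f x = g x) -> Rint a b f = Rint a b g.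
Proof. by move=> fg; apply: eq_Rintegral => x; rewrite inE/= in_itv/= => /fg. Qed.

Lemma intb_sub a b c d f : a <= c -> d <= b -> intb a b f -> intb c d f.
Proof.
move=> ac db; apply: integrableS => // x/=; rewrite !in_itv/= => /andP[cx xd].
by rewrite (le_trans ac cx) (le_trans xd db).
Qed.

Lemma intbD a b f g : intb a b f -> intb a b g -> intb a b (fun x => f x + g x).
Proof. rewrite /intb => fi gi.
have K := integrableD _ fi gi; by apply: (eq_integrable _ _ _ _ (K _)). Qed.

Lemma intbN a b f : intb a b f -> intb a b (fun x => - f x).
Proof. rewrite /intb => fi.
have K := integrableN fi; by apply: (eq_integrable _ _ _ _ K). Qed.

Lemma intbB a b f g : intb a b f -> intb a b g -> intb a b (fun x => f x - g x).
Proof. by move=> fi gi; apply: intbD => //; exact: intbN. Qed.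

Lemma intbZ a b (k : R) f : intb a b f -> intb a b (fun x => k * f x).
Proof.
rewrite /intb => fi.
have K := integrableZl _ k fi; by apply: (eq_integrable _ _ _ _ (K _)).
Qed.

Lemma RintD a b f g : intb a b f -> intb a b g ->
  Rint a b (fun x => f x + g x) = Rint a b f + Rint a b g.
Proof. by move=> fi gi; rewrite /Rint RintegralD. Qed.

Lemma RintB a b f g : intb a b f -> intb a b g ->
  Rint a b (fun x => f x - g x) = Rint a b f - Rint a b g.
Proof. by move=> fi gi; rewrite /Rint RintegralB. Qed.

Lemma RintZ a b (k : R) f : intb a b f ->
  Rint a b (fun x => k * f x) = k * Rint a b f.
Proof. by move=> fi; rewrite /Rint RintegralZl. Qed.

Lemma RintN a b f : intb a b f -> Rint a b (fun x => - f x) = - Rint a b f.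
Proof.
move=> fi; rewrite -mulN1r -RintZ//; apply: eq_Rint => x _; by rewrite mulN1r.
Qed.

Lemma Rint_point a f : Rint a a f = 0.
Proof. by rewrite /Rint set_itv1 Rintegral_set1. Qed.

Lemma Rint_split a b c f : a <= b -> b <= c -> intb a c f ->
  Rint a c f = Rint a b f + Rint b c f.
Proof.
move=> ab bc fi; have := @Rintegral_itvB R f (BLeft a) (BRight c) b fi.
rewrite !bnd_simp => /(_ ab bc).
rewrite (@Rintegral_itv_obnd_cbnd R b (BRight c)); last first.
  apply: integrableS fi => // x/=; rewrite !in_itv/= => /andP[bx ->].
  by rewrite andbT (le_trans ab)// ltW.
by rewrite /Rint => <-; rewrite addrC subrK.
Qed.

Lemma le_Rint a b f g : intb a b f -> intb a b g ->
  (forall x, a <= x <= b -> f x <= g x) -> Rint a b f <= Rint a b g.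
Proof.
move=> fi gi fg; apply: le_Rintegral => // x/=; rewrite in_itv/=; exact: fg.
Qed.

Lemma Rint_ge0 a b f : (forall x, a <= x <= b -> 0 <= f x) -> 0 <= Rint a b f.
Proof. by move=> f0; apply: Rintegral_ge0 => x/=; rewrite in_itv/=; exact: f0. Qed.

Lemma cont_meas a b f : continuous f -> measurable_fun (`[a, b] : set R) f.
Proof. by move=> cf; apply: measurable_funTS; exact: continuous_measurable_fun. Qed.

Lemma intb_cont a b f : continuous f -> intb a b f.
Proof.
move=> cf; apply: continuous_compact_integrable; first exact: segment_compact.
exact: continuous_subspaceT.
Qed.

Lemma cont_bound a b f : continuous f -> exists M : R, 0 < M /\ forall x, a <= x <= b -> `|f x| <= M.
Proof.
move=> cf; have [ab|ba] := leP a b; last first.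
  by exists 1; split => // x /andP[ax xb]; have := le_lt_trans (le_trans ax xb) ba; rewrite ltxx.
have cn : {within `[a, b], continuous (fun x => `|f x|)}.
  apply: continuous_subspaceT => x; apply: continuous_comp; first exact: cf.
  exact: norm_continuous.
have [c _ cmax] := EVT_max ab cn.
exists (`|f c| + 1); split; first by rewrite ltr_wpDl.
by move=> x xab; rewrite (le_trans (cmax x _)) ?lerDl// in_itv/=.
Qed.

Lemma intbM_cont a b f g : continuous f -> intb a b g -> intb a b (fun x => f x * g x).
Proof.
move=> cf gi; have [M [M0 fM]] := cont_bound a b cf.
have : mu.-integrable (`[a, b] : set R) ((EFin \o f) \* (EFin \o g))%E.
  apply: integrableMr => //; first exact: cont_meas.
  by exists M; split; [exact: num_real|move=> N MN x/=; rewrite in_itv/= => xab; exact: le_trans (fM x xab) (ltW MN)].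
by apply: eq_integrable.
Qed.

Lemma intb_le a b f g : measurable_fun (`[a, b] : set R) f ->
  (forall x, a <= x <= b -> `|f x| <= g x) -> intb a b g -> intb a b f.
Proof.
move=> mf fg gi; apply: le_integrable gi => //; first exact/measurable_EFinP.
move=> x/=; rewrite in_itv/= => xab; rewrite lee_fin (le_trans (fg x xab))//.
exact: ler_norm.
Qed.

Lemma Rint_cst a b (k : R) : a <= b -> Rint a b (fun=> k) = k * (b - a).
Proof.
move=> ab; rewrite /Rint Rintegral_cst//= lebesgue_measure_itv/= lte_fin.
case: ltgtP ab => //= [-> _]; by rewrite subrr mulr0.
Qed.

Lemma is_derive_oint f (x : R) : continuous f ->
  is_derive x (1 : R) (fun x => oint 0 x f) (f x).
Proof.
move=> cf.
(* A base point to the left of both [0] and [x] turns the signed integral, near [x], into a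
   difference of two ordinary integrals, whatever the sign of [x]. *)
pose a : R := - `|x| - 1.
have := ler_norm (- x); rewrite normrN => xa; have x0 := normr_ge0 x.
have a0 : a < 0 by rewrite /a; lra.
have ax : a < x by rewrite /a; lra.
have E (y : R) : a <= y -> oint 0 y f = Rint a y f - Rint a 0 f.
  move=> ay; rewrite /oint; case: leP => y0.
    rewrite (@Rint_split a 0 y f)//; [lra|lra|exact: intb_cont].
  rewrite (@Rint_split a y 0 f)//; [lra|lra|exact: intb_cont].
have [dF F'] := @continuous_FTC1_closed R f a x (x + 1) ltac:(lra)
  (intb_cont a (x+1) cf) ax (cf x).
have H : is_derive x (1 : R) (fun y => Rint a y f - Rint a 0 f) (f x).
  rewrite -[f x]subr0; apply: is_deriveB.
  by rewrite -F' derive1E; apply: derivableP.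
apply: (near_eq_is_derive _ H).
near=> y; apply: esym; apply: E; apply: ltW; near: y; exact: lt_nbhsr.
Unshelve. all: by end_near. Qed.

Lemma FTC2 a b F f : a <= b -> continuous f ->
  (forall x, is_derive x (1 : R) F (f x)) -> Rint a b f = F b - F a.
Proof.
rewrite le_eqVlt => /predU1P[<- _ _|ab cf dF]; first by rewrite Rint_point subrr.
have dFx x : derivable F x 1 by have := dF x; case.
have cF : continuous F by move=> x; apply/differentiable_continuous/derivable1_diffP.
have := @continuous_FTC2 R f F a b ab (continuous_subspaceT cf).
rewrite /Rint /Rintegral => ->//.
- split; [by move=> x _; exact: dFx|apply: cvg_at_right_filter; exact: cF|apply: cvg_at_left_filter; exact: cF].
- by move=> x _; rewrite derive1E; have := dF x => ?; rewrite derive_val.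
Qed.

End IntervalIntegral.

(** * Absolutely continuous functions on [0,1]: product rule, uniqueness of the derivative,
    Gronwall *)

Section AbsolutelyContinuous.
Variable R : realType.
Implicit Types (a b c x t : R) (f g F G : R -> R).
Local Notation mu := (@lebesgue_measure R).

(** The retraction of the line onto [0,1]. Composing with it extends data given on [0,1] to
    functions continuous on the whole line, which avoids continuity within a subspace. *)
Definition clamp t : R := Num.max 0 (Num.min t 1).

Lemma clamp_in t : 0 <= clamp t <= 1.
Proof.
rewrite /clamp le_max lexx/= ge_max ler01/=.
by rewrite ge_min lexx orbT.
Qed.

Lemma clampE t : 0 <= t <= 1 -> clamp t = t.
Proof. by move=> /andP[t0 t1]; rewrite /clamp min_l// max_r. Qed.

Lemma clamp_cont : continuous clamp.
Proof.
move=> x; apply: (@continuous_max _ _ (fun=> 0) (fun t => Num.min t 1)); first exact: cvg_cst.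
by apply: (@continuous_min _ _ (fun t => t) (fun=> 1)); [exact: cvg_id|exact: cvg_cst].
Qed.

Lemma prim_cont f : intb 0 1 f -> continuous (fun t => Rint 0 (clamp t) f).
Proof.
move=> fi x.
have /subspace_continuousP/(_ (clamp x)) := parameterized_integral_continuous (@ler01 R) fi.
have cx := clamp_in x.
rewrite /= in_itv/= cx => /(_ isT) H.
apply: cvg_trans H => U/= H.
have {}H : \forall z \near clamp x, (`[0, 1]%classic : set R) z -> U (Rint 0 z f) by [].
have := clamp_cont H; rewrite !nbhs_simpl/=.
by apply: filterS => y /=; apply; rewrite /= in_itv/=; exact: clamp_in.
Qed.

(** The integral formula serves as the definition, so [f] is a derivative of [F] in the almost
    everywhere sense. Continuity is asked on the whole line for convenience; outside [0,1] [F] is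
    otherwise free. *)
Definition ac F f : Prop := [/\ continuous F, intb 0 1 f &
  forall t, 0 <= t <= 1 -> F t = F 0 + Rint 0 t f].

Lemma ac_prim c f : intb 0 1 f -> ac (fun t => c + Rint 0 (clamp t) f) f.
Proof.
move=> fi; split=> //; first by move=> x; apply: cvgD; [exact: cvg_cst|exact: prim_cont].
by move=> t t01; rewrite !clampE ?lexx ?ler01// Rint_point addr0.
Qed.

Lemma intb_sub01 f t : 0 <= t <= 1 -> intb 0 1 f -> intb 0 t f.
Proof. by move=> /andP[t0 t1]; apply: intb_sub. Qed.

Lemma acD F f G g : ac F f -> ac G g -> ac (fun t => F t + G t) (fun t => f t + g t).
Proof.
move=> [cF fi Ff] [cG gi Gg]; split; [by move=> x; apply: cvgD; [exact: cF|exact: cG]|exact: intbD|].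
move=> t t01; rewrite RintD ?(Ff t t01) ?(Gg t t01); [lra|exact: intb_sub01|exact: intb_sub01].
Qed.

Lemma acZ (k : R) F f : ac F f -> ac (fun t => k * F t) (fun t => k * f t).
Proof.
move=> [cF fi Ff]; split; [by move=> x; apply: cvgM; [exact: cvg_cst|exact: cF]|exact: intbZ|].
move=> t t01; rewrite RintZ ?(Ff t t01); [by rewrite mulrDr|exact: intb_sub01].
Qed.

Lemma acN F f : ac F f -> ac (fun t => - F t) (fun t => - f t).
Proof.
move=> [cF fi Ff]; split; [by move=> x; apply: cvgN; exact: cF|exact: intbN|].
move=> t t01; rewrite RintN ?(Ff t t01); [by rewrite opprD|exact: intb_sub01].
Qed.

Lemma acB F f G g : ac F f -> ac G g -> ac (fun t => F t - G t) (fun t => f t - g t).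
Proof. by move=> Ff Gg; apply: acD => //; exact: acN. Qed.

Lemma ac_cst c : ac (fun=> c) (fun=> 0).
Proof.
split; [by move=> x; exact: cvg_cst|by apply: intb_cont => x; exact: cvg_cst|].
by move=> t /andP[t0 t1]; rewrite Rint_cst// mul0r addr0.
Qed.

Lemma C1_ac F f : continuous f -> (forall x, is_derive x (1 : R) F (f x)) -> ac F f.
Proof.
move=> cf dF; split; last 2 first.
- exact: intb_cont.
- by move=> t /andP[t0 t1]; rewrite (FTC2 t0 cf dF) addrC subrK.
move=> x; apply/differentiable_continuous/derivable1_diffP.
by have := dF x; case.
Qed.

Lemma ac_eq F f G : (forall t, 0 <= t <= 1 -> F t = G t) -> continuous G -> ac F f -> ac G f.
Proof.
move=> FG cG [cF fi Ff]; split=> // t t01; rewrite -(FG t t01) -(FG 0) ?lexx ?ler01//; exact: Ff.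
Qed.

Lemma measurable_patch a b f : intb a b f -> measurable_fun [set: R] (f \_ `[a, b]).
Proof.
by move=> fi; apply/(measurable_restrictT _ _).1 => //; exact: intb_meas.
Qed.

Lemma integrable_patch a b f : intb a b f -> mu.-integrable setT (EFin \o (f \_ (`[a, b] : set R))).
Proof. move=> fi; rewrite -restrict_EFin. apply: (integrable_mkcond _ _).1 => //. Qed.

Lemma int_patch a b f : intb a b f ->
  (\int[mu]_x ((f \_ (`[a, b] : set R)) x)%:E)%E = (Rint a b f)%:E.
Proof.
move=> fi; rewrite /Rint Rintegral_mkcond /Rintegral fineK//.
exact: integrable_fin_num (integrable_patch fi).
Qed.

(** Fubini on the triangle [y <= x], both functions being extended by zero. It supplies the
    cancellation behind the product rule [acM]. *)
Lemma Rint_swap f g t : intb 0 t f -> intb 0 t g -> 0 <= t ->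
  Rint 0 t (fun x => f x * Rint 0 x g) = Rint 0 t (fun y => g y * Rint y t f).
Proof.
move=> fi gi t0.
pose f1 := f \_ (`[0, t] : set R).
pose g1 := g \_ (`[0, t] : set R).
have mf1 : measurable_fun setT f1 by exact: measurable_patch.
have mg1 : measurable_fun setT g1 by exact: measurable_patch.
pose A : set (R * R) := [set z | z.2 <= z.1].
have mA : measurable A.
  have : measurable_fun setT (fun z : R * R => z.2 <= z.1).
    by apply: measurable_fun_ler; [exact: measurable_snd|exact: measurable_fst].
  move=> /(_ measurableT [set true] I); rewrite setTI.
  by congr (measurable _); apply/seteqP; split => z.
pose H (z : R * R) : R := f1 z.1 * g1 z.2 * \1_A z.
have mH : measurable_fun setT H.
  apply: measurable_funM; last exact: measurable_indic.
  by apply: measurable_funM; apply: measurableT_comp.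
have A1 x y : \1_A (x, y) = ((y <= x)%R)%:R :> R.
  by rewrite indicE; congr (_%:R); congr nat_of_bool; apply/idP/idP; rewrite inE.
have F1 (x : R) : (\int[mu]_y (H (x, y))%:E)%E =
    (((fun x => f x * Rint 0 x g) \_ (`[0, t] : set R)) x)%:E.
  rewrite patchE; case: ifPn => [|xn]; last first.
    by under eq_integral do rewrite /H /= /f1 patchE (negbTE xn) !mul0r; rewrite integral0.
  rewrite inE/= in_itv/= => /andP[x0 xt].
  have gx : intb 0 x g by apply: intb_sub gi.
  under eq_integral => y _.
    have -> : H (x, y) = f x * (g \_ (`[0, x] : set R)) y.
      rewrite /H A1/= /f1 /g1 !patchE !mem_setE !in_itv/= x0 xt/=.
      have [yx|yx] := leP y x; last by rewrite andbF mulr0 mulr0.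
      by rewrite (le_trans yx xt) andbT mulr1.
    rewrite EFinM; over.
  by rewrite integralZl//; [rewrite int_patch|exact: (integrable_patch gx)].
have F2 (y : R) : (\int[mu]_x (H (x, y))%:E)%E =
    (((fun y => g y * Rint y t f) \_ (`[0, t] : set R)) y)%:E.
  rewrite patchE; case: ifPn => [|yn]; last first.
    by under eq_integral do rewrite /H /= /g1 patchE (negbTE yn) mulr0 !mul0r; rewrite integral0.
  rewrite inE/= in_itv/= => /andP[y0 yt].
  have fy : intb y t f by apply: intb_sub fi.
  under eq_integral => x _.
    have -> : H (x, y) = g y * (f \_ (`[y, t] : set R)) x.
      rewrite /H A1/= /f1 /g1 !patchE !mem_setE !in_itv/= y0 yt/=.
      have [yx|yx] := leP y x; last by rewrite /= mulr0 mulr0.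
      by rewrite (le_trans y0 yx) mulr1 mulrC.
    rewrite EFinM; over.
  by rewrite integralZl//; [rewrite int_patch|exact: (integrable_patch fy)].
(* Tonelli: the modulus of [H] is at most [|f1 x| |g1 y|], whose iterated integral is a product of
   two finite integrals. *)
have iH : (mu \x mu)%E.-integrable setT (EFin \o H).
  have [_ nf] := integrableP _ _ _ (integrable_patch fi).
  have := integrable_patch gi => /integrable_norm /integrable_fin_num gfin.
  apply/integrable12ltyP; first exact/measurable_EFinP.
  apply: (@le_lt_trans _ _ (\int[mu]_x (`|(f1 x)%:E| * \int[mu]_y `|(g1 y)%:E|))%E).
    apply: ge0_le_integral => //=.
    - by move=> x _; apply: integral_ge0.
    - apply: (@measurable_fun_fubini_tonelli_F _ _ _ _ _ mu (fun z => (`|H z|)%:E)) => //.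
      by apply/measurable_EFinP; apply: measurableT_comp.
    - apply: emeasurable_funM => //; apply/measurable_EFinP; exact: measurableT_comp.
    - move=> x _; rewrite -ge0_integralZl//; last first.
        by apply/measurable_EFinP; exact: measurableT_comp.
      apply: ge0_le_integral => //=.
      + by apply/measurable_EFinP; do 2 apply: measurableT_comp => //.
      + apply: emeasurable_funM => //; apply/measurable_EFinP; exact: measurableT_comp.
      + move=> y _; rewrite -EFinM lee_fin /H !normrM A1/= ler_piMr ?mulr_ge0//.
        by case: (y <= x); rewrite ?normr1 ?normr0.
  under eq_integral do rewrite muleC.
  rewrite ge0_integralZl//=; [|by apply/measurable_EFinP; exact: measurableT_comp|exact: integral_ge0].
  by apply: lte_mul_pinfty => //; [exact: integral_ge0|exact: gfin].
have := Fubini iH.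
under eq_integral do rewrite F1.
under [X in _ = X -> _]eq_integral do rewrite F2.
move=> E; rewrite /Rint Rintegral_mkcond [RHS]Rintegral_mkcond /Rintegral.
by rewrite E.
Qed.

(** Expand [G] from the left end, [G x = G 0 + int_0^x g], but [F] from the right end,
    [F x = F t - int_x^t f]: the two double integrals are then those of [Rint_swap] and cancel. *)
Lemma acM F f G g : ac F f -> ac G g ->
  ac (fun t => F t * G t) (fun t => f t * G t + F t * g t).
Proof.
move=> [cF fi Ff] [cG gi Gg].
have i1 : intb 0 1 (fun t => f t * G t).
  by apply: eq_intb (intbM_cont cG fi) => x _; rewrite mulrC.
have i2 : intb 0 1 (fun t => F t * g t) by apply: intbM_cont.
split; [by move=> x; apply: cvgM; [exact: cF|exact: cG]|exact: intbD|].
move=> t t01; have /andP[t0 t1] := t01.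
have ft := intb_sub01 t01 fi; have gt := intb_sub01 t01 gi.
have i1t := intb_sub01 t01 i1; have i2t := intb_sub01 t01 i2.
rewrite RintD//.
have T01 x : 0 <= x <= t -> 0 <= x <= 1 by move=> /andP[-> xt]; rewrite (le_trans xt).
have -> : Rint 0 t (fun t => f t * G t) = G 0 * Rint 0 t f + Rint 0 t (fun x => f x * Rint 0 x g).
  have iG0 : intb 0 t (fun x => G 0 * f x) by exact: intbZ.
  rewrite -RintZ// -RintD//.
    by apply: eq_Rint => x /T01 x01; rewrite (Gg x x01); ring.
  apply: eq_intb (intbB i1t iG0) => x /T01 x01; rewrite (Gg x x01); ring.
rewrite Rint_swap//.
have -> : Rint 0 t (fun t => F t * g t) = F t * Rint 0 t g - Rint 0 t (fun y => g y * Rint y t f).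
  have iFt : intb 0 t (fun x => F t * g x) by exact: intbZ.
  have E x : 0 <= x <= t -> F t * g x - g x * Rint x t f = F x * g x.
    move=> xt; have x01 := T01 x xt; have /andP[x0 xlt] := xt.
    by rewrite (Ff t t01) (Ff x x01) (Rint_split x0 xlt ft); ring.
  rewrite -RintZ// -RintB//.
    by apply: eq_Rint => x xt; rewrite E.
  apply: eq_intb (intbB iFt i2t) => x /E <-; ring.
rewrite (Ff t t01) (Gg t t01); ring.
Qed.

Lemma aeS (P Q : R -> Prop) : (forall x, P x -> Q x) ->
  {ae mu, forall x, P x} -> {ae mu, forall x, Q x}.
Proof. by move=> PQ; apply: (@filterS _ _ (ae_filter_ringOfSetsType mu)). Qed.

Lemma aeS2 (P Q S : R -> Prop) : (forall x, P x -> Q x -> S x) ->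
  {ae mu, forall x, P x} -> {ae mu, forall x, Q x} -> {ae mu, forall x, S x}.
Proof. by move=> PQ; apply: (@filterS2 _ _ (ae_filter_ringOfSetsType mu)). Qed.

Definition ae01 (P : R -> Prop) : Prop := {ae mu, forall x, 0 <= x <= 1 -> P x}.

Lemma ae01_imp (P Q : R -> Prop) : (forall x, 0 <= x <= 1 -> P x -> Q x) -> ae01 P -> ae01 Q.
Proof.
by move=> PQ; apply: aeS => x Px x01; apply: PQ => //; exact: Px.
Qed.

Lemma ae01_and (P Q : R -> Prop) : ae01 P -> ae01 Q -> ae01 (fun x => P x /\ Q x).
Proof. by apply: aeS2 => x Px Qx x01; split; [exact: Px|exact: Qx]. Qed.

Lemma ae01_Rint f g t : 0 <= t <= 1 ->
  measurable_fun (`[0, 1] : set R) f -> measurable_fun (`[0, 1] : set R) g ->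
  ae01 (fun x => f x = g x) -> Rint 0 t f = Rint 0 t g.
Proof.
move=> /andP[t0 t1] mf mg fg.
have sub : (`[0, t] : set R) `<=` `[0, 1].
  by move=> x/=; rewrite !in_itv/= => /andP[-> xt]; rewrite (le_trans xt).
rewrite /Rint /Rintegral; congr fine; apply: ae_eq_integral => //.
- by apply/measurable_EFinP; apply: measurable_funS mf.
- by apply/measurable_EFinP; apply: measurable_funS mg.
- apply: aeS fg => x fgx /=; rewrite in_itv/= => /andP[x0 xt].
  by rewrite fgx// x0 (le_trans xt).
Qed.

Lemma ae01_intb f g : measurable_fun (`[0, 1] : set R) g ->
  ae01 (fun x => f x = g x) -> intb 0 1 f -> intb 0 1 g.
Proof.
move=> mg fg fi; have mf := intb_meas fi.
move/integrableP: fi => [_ fi]; apply/integrableP; split; first exact/measurable_EFinP.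
apply: le_lt_trans fi; rewrite le_eqVlt; apply/orP; left; apply/eqP.
apply: ae_eq_integral => //.
- by apply/measurable_EFinP; exact: measurableT_comp.
- by apply/measurable_EFinP; exact: measurableT_comp.
- apply: aeS fg => x fgx /=; rewrite in_itv/= => fx; by rewrite /= (fgx fx).
Qed.

Lemma ae01_oo (P : R -> Prop) : ae01 (fun x => 0 < x < 1 -> P x) -> ae01 P.
Proof.
move=> H.
have N0 : {ae mu, forall x : R, x != 0}.
  exists [set 0]; split; [exact: measurable_set1|exact: lebesgue_measure_set1|].
  by move=> x /= /negP; rewrite negbK => /eqP.
have N1 : {ae mu, forall x : R, x != 1}.
  exists [set 1]; split; [exact: measurable_set1|exact: lebesgue_measure_set1|].
  by move=> x /= /negP; rewrite negbK => /eqP.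
have N01 : {ae mu, forall x : R, x != 0 /\ x != 1} by apply: aeS2 N0 N1.
apply: (aeS2 _ N01 H) => x [x0 x1] Px x01; apply: (Px x01).
by rewrite !lt_neqAle eq_sym x0 x1.
Qed.

(** Lebesgue differentiation: at almost every interior point [f] is the derivative of its primitive,
    which vanishes nearby. *)
Lemma Rint0_ae0 f : intb 0 1 f -> (forall t, 0 <= t <= 1 -> Rint 0 t f = 0) ->
  ae01 (fun x => f x = 0).
Proof.
move=> fi f0; apply: ae01_oo.
pose f1 := f \_ (`[0, 1] : set R).
have l1 : locally_integrable [set: R] f1 by apply: integrable_locally.
have i1 y : mu.-integrable [set` Interval (BLeft 0) (BRight y)] (EFin \o f1).
  by apply: integrableS (integrable_patch fi).
have := FTC1 i1 l1; apply: aeS => x /= Hx _ /andP[x0 x1].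
have [] := Hx x0.
have f1x : f1 x = f x by rewrite /f1 patchE mem_setE in_itv/= !ltW.
rewrite f1x => _ <-; rewrite derive1E.
have : is_derive x (1 : R) (fun x => (\int[mu]_(t in [set` Interval (BLeft 0) (BRight x)]) f1 t)%R) 0.
  apply: near_eq_is_derive (is_derive_cst 0 x 1).
  near=> y.
  have y01 : 0 <= y <= 1.
    by apply/andP; split; apply: ltW; near: y; [exact: lt_nbhsr|exact: lt_nbhsl].
  rewrite -[LHS](f0 y y01); apply: eq_Rintegral => z; rewrite inE/= in_itv/= => /andP[z0 zy].
  by rewrite /f1 patchE mem_setE in_itv/= z0 (le_trans zy)//; case/andP: y01.
by move=> H; rewrite derive_val.
Unshelve. all: by end_near. Qed.

Lemma ac_unique F f g : ac F f -> ac F g -> ae01 (fun x => f x = g x).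
Proof.
move=> [_ fi Ff] [_ gi Fg].
have : ae01 (fun x => f x - g x = 0).
  apply: Rint0_ae0; first exact: intbB.
  move=> t t01; rewrite RintB.
    by have := Ff t t01; rewrite (Fg t t01) => /addrI ->; rewrite subrr.
  - exact: intb_sub01.
  - exact: intb_sub01.
by apply: ae01_imp => x _ /subr0_eq.
Qed.

Lemma ac_ae F f g : measurable_fun (`[0, 1] : set R) g -> ae01 (fun x => f x = g x) -> ac F f -> ac F g.
Proof.
move=> mg fg [cF fi Ff]; split=> //; first exact: ae01_intb fg fi.
by move=> t t01; rewrite (Ff t t01); congr (_ + _); apply: ae01_Rint => //; exact: intb_meas.
Qed.

Lemma ac_0 F f : ac F f -> F 0 = 0 -> forall t, 0 <= t <= 1 -> F t = Rint 0 t f.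
Proof. by move=> [_ _ Ff] F0 t t01; rewrite (Ff t t01) F0 add0r. Qed.

(** [expR (- C * t) * Z t] starts at zero and has nonpositive derivative, so it is nonpositive,
    while [Z] is nonnegative. *)
Lemma gronwall Z z (C : R) : ac Z z -> Z 0 = 0 -> (forall t, 0 <= t <= 1 -> 0 <= Z t) ->
  (forall t, 0 <= t <= 1 -> z t <= C * Z t) -> forall t, 0 <= t <= 1 -> Z t = 0.
Proof.
move=> aZ Z0 Zge0 zC.
have dE x : is_derive x (1 : R) (fun t : R => expR (- C * t)) (- C * expR (- C * x)).
  apply: is_derive_eq.
  by rewrite /GRing.scale/= !(mulr0, mul0r, add0r, addr0, mulr1) mulrC.
have cE : continuous (fun t : R => expR (- C * t)).
  by move=> x; apply/differentiable_continuous/derivable1_diffP; case: (dE x).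
have aE := C1_ac (_ : continuous (fun x : R => - C * expR (- C * x))) dE.
have {}aE : ac (fun t : R => expR (- C * t)) (fun x => - C * expR (- C * x)).
  by apply: aE => x; apply: cvgM; [exact: cvg_cst|exact: cE].
have aP := acM aE aZ.
move=> t t01; have /andP[t0 t1] := t01.
have P0 : expR (- C * 0) * Z 0 = 0 by rewrite Z0 mulr0.
have := ac_0 aP P0 t01; have [_ iP _] := aP => Et.
have : Rint 0 t (fun t => - C * expR (- C * t) * Z t + expR (- C * t) * z t) <= Rint 0 t (fun=> 0).
  apply: le_Rint; [exact: intb_sub01 iP|by apply: intb_cont => x; exact: cvg_cst|].
  move=> x /andP[x0 xt]; have x01 : 0 <= x <= 1 by rewrite x0 (le_trans xt).
  have := ler_wpM2l (expR_ge0 (- C * x)) (zC x x01).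
  by lra.
rewrite -Et Rint_cst// mul0r => H; apply/eqP; rewrite eq_le Zge0// andbT.
by move: H; rewrite pmulr_rle0// expR_gt0.
Qed.

End AbsolutelyContinuous.

(** * Rules for pointwise derivatives and for continuity *)

Section RealDerivatives.
Variable R : realType.
Implicit Types (f g : R -> R) (x a b : R).

Lemma der_eq f x a b : is_derive x (1 : R) f a -> a = b -> is_derive x (1 : R) f b.
Proof. by move=> H <-. Qed.

Lemma der_ext f g x a : (forall y, f y = g y) -> is_derive x (1 : R) f a -> is_derive x (1 : R) g a.
Proof. by move=> /funext ->. Qed.

Lemma derD f g x a b : is_derive x (1 : R) f a -> is_derive x (1 : R) g b ->
  is_derive x (1 : R) (fun y => f y + g y) (a + b).
Proof. by move=> fa gb; exact: is_deriveD. Qed.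

Lemma derB f g x a b : is_derive x (1 : R) f a -> is_derive x (1 : R) g b ->
  is_derive x (1 : R) (fun y => f y - g y) (a - b).
Proof. by move=> fa gb; exact: is_deriveB. Qed.

Lemma derN f x a : is_derive x (1 : R) f a -> is_derive x (1 : R) (fun y => - f y) (- a).
Proof. by move=> fa; exact: is_deriveN. Qed.

Lemma derM f g x a b : is_derive x (1 : R) f a -> is_derive x (1 : R) g b ->
  is_derive x (1 : R) (fun y => f y * g y) (a * g x + f x * b).
Proof.
move=> fa gb; apply: (der_eq (is_deriveM fa gb)).
by rewrite /GRing.scale/= addrC mulrC.
Qed.

Lemma der_cst (k : R) x : is_derive x (1 : R) (fun=> k) 0.
Proof. exact: is_derive_cst. Qed.

Lemma der_id x : is_derive x (1 : R) (fun y => y) 1.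
Proof. exact: is_derive_id. Qed.

Lemma derZ (k : R) f x a : is_derive x (1 : R) f a -> is_derive x (1 : R) (fun y => k * f y) (k * a).
Proof.
move=> fa; apply: (der_eq (derM (der_cst k x) fa)); ring.
Qed.

Lemma der_comp f g x a b : is_derive (g x) (1 : R) f a -> is_derive x (1 : R) g b ->
  is_derive x (1 : R) (fun y => f (g y)) (a * b).
Proof. by move=> fa gb; exact: (@is_derive1_comp R f g x a b fa gb). Qed.

Lemma der_inv f x a : f x != 0 -> is_derive x (1 : R) f a ->
  is_derive x (1 : R) (fun y => (f y)^-1) (- a / f x ^+ 2).
Proof.
move=> f0 fa; apply: (der_eq (is_deriveV f0 fa)).
by rewrite /GRing.scale/= mulrC mulrN mulNr.
Qed.

Lemma der_sqrt f x a : 0 < f x -> is_derive x (1 : R) f a ->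
  is_derive x (1 : R) (fun y => Num.sqrt (f y)) (a / (2 * Num.sqrt (f x))).
Proof.
move=> f0 fa; apply: (der_eq (@der_comp Num.sqrt f _ _ _ (is_derive1_sqrt f0) fa)).
by rewrite mulrC.
Qed.

Lemma der_cont f f' : (forall x, is_derive x (1 : R) f (f' x)) -> continuous f.
Proof.
move=> df x; apply/differentiable_continuous/derivable1_diffP.
by have := df x; case.
Qed.

Lemma cont_cst (k : R) : continuous (fun _ : R => k).
Proof. by move=> x; exact: cvg_cst. Qed.

Lemma cont_id : continuous (fun x : R => x).
Proof. by move=> x; exact: cvg_id. Qed.

Lemma contD f g : continuous f -> continuous g -> continuous (fun x => f x + g x).
Proof. by move=> cf cg x; apply: cvgD; [exact: cf|exact: cg]. Qed.

Lemma contB f g : continuous f -> continuous g -> continuous (fun x => f x - g x).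
Proof. by move=> cf cg x; apply: cvgB; [exact: cf|exact: cg]. Qed.

Lemma contN f : continuous f -> continuous (fun x => - f x).
Proof. by move=> cf x; apply: cvgN; exact: cf. Qed.

Lemma contM f g : continuous f -> continuous g -> continuous (fun x => f x * g x).
Proof. by move=> cf cg x; apply: cvgM; [exact: cf|exact: cg]. Qed.

Lemma cont_comp f g : continuous f -> continuous g -> continuous (fun x => f (g x)).
Proof. by move=> cf cg x; apply: (@continuous_comp _ _ _ g f); [exact: cg|exact: cf]. Qed.

End RealDerivatives.

(** * The space W^{2,2}(0,1) and its chosen derivatives *)

Section Witness.
Variable R : realType.
Implicit Types (u p h f g : R -> R).
Local Notation mu := (@lebesgue_measure R).

Definition L2 h : Prop := measurable_fun (`[0, 1] : set R) h /\ intb 0 1 (fun x => h x ^+ 2).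

Lemma cst_intb (k : R) : intb 0 1 (fun=> k).
Proof. by apply: intb_cont => x; exact: cvg_cst. Qed.

Lemma L2_intb h : L2 h -> intb 0 1 h.
Proof.
move=> [mh h2]; apply: (@intb_le _ 0 1 h (fun x => 1 + h x ^+ 2)) => //.
  move=> x _; rewrite -[h x ^+ 2]real_normK ?num_real//.
  have := sqr_ge0 (`|h x| - 1); rewrite sqrrB; have := normr_ge0 (h x); nra.
by apply: intbD => //; exact: cst_intb.
Qed.

Lemma L2_mul f g : L2 f -> L2 g -> intb 0 1 (fun x => f x * g x).
Proof.
move=> [mf f2] [mg g2]; apply: (@intb_le _ 0 1 _ (fun x => f x ^+ 2 + g x ^+ 2)).
- exact: measurable_funM.
- move=> x _; rewrite normrM -[f x ^+ 2]real_normK ?num_real// -[g x ^+ 2]real_normK ?num_real//.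
  have := sqr_ge0 (`|f x| - `|g x|); have := normr_ge0 (f x); have := normr_ge0 (g x); nra.
- exact: intbD.
Qed.

Lemma L2D f g : L2 f -> L2 g -> L2 (fun x => f x + g x).
Proof.
move=> [mf f2] [mg g2]; split; first exact: measurable_funD.
have := intbD (intbD f2 (intbZ 2 (L2_mul (conj mf f2) (conj mg g2)))) g2.
by apply: eq_intb => x _; ring.
Qed.

Lemma L2M_cont f g : continuous f -> L2 g -> L2 (fun x => f x * g x).
Proof.
move=> cf [mg g2]; split.
  by apply: measurable_funM => //; exact: cont_meas.
have cf2 : continuous (fun x => f x ^+ 2).
  by move=> x; rewrite /continuous_at; under eq_fun do rewrite expr2; apply: cvgM; exact: cf.
by have := intbM_cont cf2 g2; apply: eq_intb => x _; rewrite exprMn.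
Qed.

Lemma L2Z (k : R) f : L2 f -> L2 (fun x => k * f x).
Proof. by apply: (@L2M_cont (fun=> k)) => x; exact: cvg_cst. Qed.

Lemma L2_cont f : continuous f -> L2 f.
Proof.
move=> cf; split; first exact: cont_meas.
by apply: intb_cont => x; rewrite /continuous_at; under eq_fun do rewrite expr2; apply: cvgM; exact: cf.
Qed.

Lemma witP u : W22 u -> W22wit u (wit u).
Proof. by move=> H; apply: ClassicalEpsilon.epsilon_spec. Qed.

Lemma d2_L2 u : W22 u -> L2 (d2 u).
Proof. by move=> /witP [mh [h2 _]]; split. Qed.

Definition dc u : R -> R := fun t => d1 u (clamp t).

Lemma dcE u t : 0 <= t <= 1 -> dc u t = d1 u t.
Proof. by move=> t01; rewrite /dc clampE. Qed.

Lemma dc_ac u : W22 u -> ac (dc u) (d2 u).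
Proof. by move=> Wu; apply: ac_prim; apply: L2_intb; exact: d2_L2. Qed.

Lemma dc_cont u : W22 u -> continuous (dc u).
Proof. by move=> /dc_ac []. Qed.

Lemma W22_int u t : W22 u -> 0 <= t <= 1 -> u t = u 0 + Rint 0 t (dc u).
Proof.
move=> Wu t01; have [_ [_ /(_ t t01) ->]] := witP Wu; rewrite -addrA; congr (_ + _).
have /andP[t0 t1] := t01.
have i2 : intb 0 1 (wit u).2 by have := d2_L2 Wu => /L2_intb.
have -> : Rint 0 t (fun s => Rint 0 s (wit u).2) = Rint 0 t (fun s => Rint 0 (clamp s) (wit u).2).
  apply: eq_Rint => x /andP[x0 xt]; rewrite clampE// x0 (le_trans xt)//.
rewrite -[X in X * t + _ = _]/(wit u).1.
have -> : (wit u).1 * t = Rint 0 t (fun=> (wit u).1) by rewrite Rint_cst// subr0.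
rewrite -RintD//.
  by apply: intb_cont => x; exact: cvg_cst.
exact/intb_cont/prim_cont.
Qed.

Lemma ae01_cont0 f : continuous f -> ae01 (fun x => f x = 0) -> forall t, 0 <= t <= 1 -> f t = 0.
Proof.
move=> cf f0.
have H x : 0 < x < 1 -> f x = 0.
  move=> /andP[x0 x1]; have Dx := is_derive_oint x cf.
  have : is_derive x (1 : R) (fun x => oint 0 x f) 0.
    apply: near_eq_is_derive (is_derive_cst 0 x 1).
    near=> y.
    have y01 : 0 <= y <= 1.
      by apply/andP; split; apply: ltW; near: y; [exact: lt_nbhsr|exact: lt_nbhsl].
    rewrite /oint; case/andP: (y01) => -> _.
    rewrite (@ae01_Rint _ f (fun=> 0) y)//.
    - by rewrite Rint_cst ?mul0r//; case/andP: y01.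
    - exact: cont_meas.
  by move=> H; have := @derive_val _ _ _ _ _ _ _ Dx; rewrite (@derive_val _ _ _ _ _ _ _ H).
move=> t t01; apply/eqP; apply/negPn/negP => ft.
have : \forall y \near t, f y != 0.
  have ct : f y @[y --> t] --> f t by exact: cf.
  exact: (cvgr_neq0 _ ct ft).
case=> e /= e0 He.
have /andP[t0 t1] := t01.
(* A shift by [d] towards the middle of [0,1] stays within [e] of [t] and lands in the open
   interval, so that the endpoints are covered too. *)
pose d := Num.min e 1 / 4.
have [d0 de d1] : [/\ 0 < d, d < e & d < 1 / 2].
  by rewrite /d; case: (leP e 1) => ?; split; lra.
pose y := if t < 1 / 2 then t + d else t - d.
have yt : `|t - y| < e.
  rewrite /y; case: ifP => _.
    by rewrite opprD addrA subrr add0r normrN gtr0_norm.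
  by rewrite opprB addrC subrK gtr0_norm.
have y01 : 0 < y < 1.
  by rewrite /y; case: (ltP t (1/2)) => ?; apply/andP; split; lra.
by have := He y yt; rewrite (H y y01) eqxx.
Unshelve. all: by end_near. Qed.

(** [d1] and [d2] come from a witness picked by [epsilon]. Continuous functions with the same
    primitive agree, so any representation of [u] determines [d1] on [0,1] and [d2] almost
    everywhere. *)
Lemma W22_spec u p h : ac p h -> L2 h ->
  (forall t, 0 <= t <= 1 -> u t = u 0 + Rint 0 t p) ->
  [/\ W22 u, forall t, 0 <= t <= 1 -> d1 u t = p t & ae01 (fun t => d2 u t = h t)].
Proof.
move=> aph [mh h2] up; have [cp ih ph] := aph.
have Wu : W22 u.
  exists (p 0, h); split=> //; split=> // t t01; have /andP[t0 t1] := t01.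
  rewrite (up t t01) -addrA; congr (_ + _).
  have -> : (p 0, h).1 * t = Rint 0 t (fun=> p 0) by rewrite Rint_cst// subr0.
  have -> : Rint 0 t (fun s => Rint 0 s (p 0, h).2) = Rint 0 t (fun s => p s - p 0).
    apply: eq_Rint => x /andP[x0 xt]; rewrite (ph x) ?x0 ?(le_trans xt)//; first by rewrite addrC addKr.
  have i0 : intb 0 t (fun=> p 0) by apply: intb_cont => x; exact: cvg_cst.
  rewrite -RintD//; last by apply: intbB => //; exact: intb_cont.
  by apply: eq_Rint => x _; ring.
have cd := dc_cont Wu.
have E : ae01 (fun x => dc u x - p x = 0).
  apply: Rint0_ae0; first by apply: intbB; exact: intb_cont.
  move=> t t01; rewrite RintB; [|exact: intb_cont|exact: intb_cont].
  have := W22_int Wu t01; rewrite (up t t01) => /addrI ->; exact: subrr.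
have E1 t : 0 <= t <= 1 -> dc u t = p t.
  move=> t01; apply/eqP; rewrite -subr_eq0; apply/eqP; move: t t01.
  by apply: ae01_cont0 => // x; apply: cvgB; [exact: cd|exact: cp].
split=> //; first by move=> t t01; rewrite -dcE// E1.
by apply: (@ac_unique _ p) => //; exact: ac_eq (dc_ac Wu).
Qed.

End Witness.

(** * Differentiation under the integral sign *)

Section IntegralDerivative.
Variable R : realType.
Implicit Types (f : R -> R -> R) (G : R -> R).
Local Notation mu := (@lebesgue_measure R).

Lemma derive_Rint f (f' : R -> R -> R) (a b c d e0 : R) G :
  c < e0 < d ->
  (forall e, c < e < d -> intb a b (f e)) ->
  (forall e x, c < e < d -> a <= x <= b -> is_derive e (1 : R) (f ^~ x) (f' e x)) ->
  intb a b G ->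
  (forall e x, c < e < d -> a <= x <= b -> `|f' e x| <= G x) ->
  is_derive e0 (1 : R) (fun e => Rint a b (f e)) (Rint a b (f' e0)).
Proof.
move=> e0cd fi df Gi fG.
pose G1 x := if (a <= x <= b) then G x else 0.
have E0 : (`]c, d[%classic : set R) e0 by rewrite /= in_itv.
have mD : measurable (`[a, b] : set R) by exact: measurable_itv.
have H1 : forall e : R, (`]c, d[%classic : set R) e -> mu.-integrable (`[a, b] : set R) (EFin \o f e).
  by move=> e; rewrite /= in_itv/= => /fi.
have H2 : forall e x : R, (`]c, d[%classic : set R) e -> (`[a, b]%classic : set R) x -> derivable (f ^~ x) e 1.
  by move=> e x; rewrite /= !in_itv/= => ecd xab; case: (df e x ecd xab).
have H3 : forall x, 0 <= G1 x.
  move=> x; rewrite /G1; case: ifP => // xab.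
  exact: le_trans (normr_ge0 _) (fG e0 x e0cd xab).
have H4 : mu.-integrable (`[a, b] : set R) (EFin \o G1).
  by apply: eq_intb Gi => x xab; rewrite /G1 xab.
have H6 : forall e x : R, c < e < d -> a <= x <= b -> partial1of2 f e x = f' e x.
  move=> e x ecd xab; rewrite /partial1of2 derive1E.
  by have := df e x ecd xab => ?; rewrite derive_val.
have H5 : forall e x : R, (`]c, d[%classic : set R) e -> (`[a, b]%classic : set R) x -> `|partial1of2 f e x| <= G1 x.
  move=> e x; rewrite /= !in_itv/= => ecd xab.
  by rewrite H6// /G1 xab fG.
have D := @derivable_under_integral R _ _ mu f _ mD _ _ _ E0 H1 H2 G1 H3 H4 H5.
have V := @differentiation_under_integral R _ _ mu f _ mD _ _ _ E0 H1 H2 G1 H3 H4 H5.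
have -> : Rint a b (f' e0) = 'D_1 (fun e => Rint a b (f e)) e0.
  rewrite -derive1E V /Rint; apply: eq_Rintegral => x; rewrite inE/= in_itv/= => xab.
  by rewrite H6.
exact: derivableP.
Qed.

End IntegralDerivative.

(** * First variation of the energy density *)

Section FirstVariation.
Variable R : realType.
Implicit Types (g eta : curve R) (lam : R).

(* [N^2 / v^5 + lam v] is the energy density [k^2 v + lam v] with [k = N / v^3]. *)
Definition nume (p1 p2 h1 h2 : R) : R := p1 * h2 - p2 * h1.
Definition spd (p1 p2 : R) : R := Num.sqrt (p1 ^+ 2 + p2 ^+ 2).
Definition dens (lam p1 p2 h1 h2 : R) : R :=
  nume p1 p2 h1 h2 ^+ 2 / spd p1 p2 ^+ 5 + lam * spd p1 p2.
(** The directional derivative of [dens] along [(w1, w2, k1, k2)]. The powers 5 and 7 come from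
    [v^-5], whose derivative is [-5 v^-7 (p1 w1 + p2 w2)]. *)
Definition ddens (lam p1 p2 h1 h2 w1 w2 k1 k2 : R) : R :=
  2 * nume p1 p2 h1 h2 * (w1 * h2 + p1 * k2 - w2 * h1 - p2 * k1) / spd p1 p2 ^+ 5
  - 5 * nume p1 p2 h1 h2 ^+ 2 * (p1 * w1 + p2 * w2) / spd p1 p2 ^+ 7
  + lam * (p1 * w1 + p2 * w2) / spd p1 p2.

Lemma densE lam p1 p2 h1 h2 :
  dens lam p1 p2 h1 h2 =
  (nume p1 p2 h1 h2 / spd p1 p2 ^+ 3) ^+ 2 * spd p1 p2 + lam * spd p1 p2.
Proof.
rewrite /dens; congr (_ + _).
have [->|v0] := eqVneq (spd p1 p2) 0; first by rewrite !(expr0n, mulr0, invr0).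
by field.
Qed.

Lemma is_derive_dens lam p1 p2 h1 h2 w1 w2 k1 k2 (e : R) :
  0 < (p1 + e * w1) ^+ 2 + (p2 + e * w2) ^+ 2 ->
  is_derive e (1 : R)
    (fun e => dens lam (p1 + e * w1) (p2 + e * w2) (h1 + e * k1) (h2 + e * k2))
    (ddens lam (p1 + e * w1) (p2 + e * w2) (h1 + e * k1) (h2 + e * k2) w1 w2 k1 k2).
Proof.
move=> V0.
have lin (a b : R) : is_derive e (1 : R) (fun e => a + e * b) b.
  by apply: (der_eq (derD (der_cst a e) (derM (der_id e) (der_cst b e)))); ring.
have dN : is_derive e (1 : R)
    (fun e => nume (p1 + e * w1) (p2 + e * w2) (h1 + e * k1) (h2 + e * k2))
    (w1 * (h2 + e * k2) + (p1 + e * w1) * k2 - w2 * (h1 + e * k1) - (p2 + e * w2) * k1).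
  by apply: (der_eq (derB (derM (lin p1 w1) (lin h2 k2)) (derM (lin p2 w2) (lin h1 k1)))); ring.
have dv : is_derive e (1 : R) (fun e => spd (p1 + e * w1) (p2 + e * w2))
    (((p1 + e * w1) * w1 + (p2 + e * w2) * w2) / spd (p1 + e * w1) (p2 + e * w2)).
  have dV : is_derive e (1 : R) (fun e => (p1 + e * w1) ^+ 2 + (p2 + e * w2) ^+ 2)
    (2 * ((p1 + e * w1) * w1 + (p2 + e * w2) * w2)).
    by apply: (der_eq (derD (derM (lin p1 w1) (lin p1 w1)) (derM (lin p2 w2) (lin p2 w2)))); ring.
  have s0 : Num.sqrt ((p1 + e * w1) ^+ 2 + (p2 + e * w2) ^+ 2) != 0.
    by rewrite gt_eqF// sqrtr_gt0.
  by apply: (der_eq (@der_sqrt _ (fun e => (p1 + e * w1) ^+ 2 + (p2 + e * w2) ^+ 2) _ _ V0 dV)); rewrite /spd; field.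
have v0 : spd (p1 + e * w1) (p2 + e * w2) != 0 by rewrite gt_eqF// sqrtr_gt0.
have dv5 : is_derive e (1 : R) (fun e => spd (p1 + e * w1) (p2 + e * w2) ^+ 5)
   (5 * spd (p1 + e * w1) (p2 + e * w2) ^+ 3 * ((p1 + e * w1) * w1 + (p2 + e * w2) * w2)).
  have := derM dv (derM (derM dv dv) (derM dv dv)).
  move: (p1 + e * w1) (p2 + e * w2) v0 => q1 q2 v0 H.
  have -> : (fun e => spd (p1 + e * w1) (p2 + e * w2) ^+ 5) = (fun y =>
       spd (p1 + y * w1) (p2 + y * w2) *
       (spd (p1 + y * w1) (p2 + y * w2) * spd (p1 + y * w1) (p2 + y * w2) *
        (spd (p1 + y * w1) (p2 + y * w2) * spd (p1 + y * w1) (p2 + y * w2)))).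
    by apply/funext => y; ring.
  by apply: (der_eq H); field.
have v50 : spd (p1 + e * w1) (p2 + e * w2) ^+ 5 != 0 by rewrite expf_neq0.
have di := @der_inv _ (fun e => spd (p1 + e * w1) (p2 + e * w2) ^+ 5) _ _ v50 dv5.
apply: der_ext (der_eq (derD (derM (derM dN dN) di) (derZ lam dv)) _).
  by move=> y; rewrite /dens expr2.
by rewrite /ddens; field.
Qed.

Lemma cont_sqr (f : R -> R) : continuous f -> continuous (fun x => f x ^+ 2).
Proof. by move=> cf x; rewrite /continuous_at; under eq_fun do rewrite expr2; apply: cvgM; exact: cf. Qed.

Lemma cont_spd (q1 q2 : R -> R) : continuous q1 -> continuous q2 ->
  continuous (fun t => spd (q1 t) (q2 t)).
Proof.
move=> c1 c2 t; apply: (@continuous_comp _ _ _ (fun t => q1 t ^+ 2 + q2 t ^+ 2) Num.sqrt).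
  by apply: cvgD; [exact: (cont_sqr c1)|exact: (cont_sqr c2)].
exact: sqrt_continuous.
Qed.

Lemma cont_inv (f : R -> R) : (forall t, f t != 0) -> continuous f -> continuous (fun t => (f t)^-1).
Proof. by move=> f0 cf t; apply: cvgV; [exact: f0|exact: cf]. Qed.

Lemma cont_exp (f : R -> R) n : continuous f -> continuous (fun t => f t ^+ n).
Proof.
move=> cf; elim: n => [|n IH].
  by under eq_fun do rewrite expr0; exact: cont_cst.
have -> : (fun t => f t ^+ n.+1) = (fun t => f t * f t ^+ n) by apply/funext => t; rewrite exprS.
exact: contM.
Qed.

Lemma L2_nume (q1 q2 f1 f2 : R -> R) : continuous q1 -> continuous q2 -> L2 f1 -> L2 f2 ->
  L2 (fun t => nume (q1 t) (q2 t) (f1 t) (f2 t)).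
Proof.
move=> c1 c2 L1 L2'; have := L2D (L2M_cont c1 L2') (L2Z (-1) (L2M_cont c2 L1)).
by congr L2; apply/funext => t; rewrite /nume mulN1r.
Qed.

Lemma cont_clamp (f : R -> R) : continuous f -> continuous (fun t => f (clamp t)).
Proof.
move=> cf t; apply: (@continuous_comp _ _ _ (@clamp R) f); [exact: clamp_cont|exact: cf].
Qed.

Lemma intb_dens lam (q1 q2 f1 f2 : R -> R) : continuous q1 -> continuous q2 -> L2 f1 -> L2 f2 ->
  (forall t, 0 <= t <= 1 -> 0 < q1 t ^+ 2 + q2 t ^+ 2) ->
  intb 0 1 (fun t => dens lam (q1 t) (q2 t) (f1 t) (f2 t)).
Proof.
move=> c1 c2 Lf1 Lf2 V0.
have cs := cont_spd (cont_clamp c1) (cont_clamp c2).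
have s0 t : spd (q1 (clamp t)) (q2 (clamp t)) ^+ 5 != 0.
  by rewrite expf_neq0// gt_eqF// sqrtr_gt0 V0// clamp_in.
have LN := L2_nume c1 c2 Lf1 Lf2.
have := intbD (intbM_cont (cont_inv s0 (@cont_exp _ 5 cs)) (L2_mul LN LN)) (intbZ lam (intb_cont 0 1 cs)).
by apply: eq_intb => t t01; rewrite clampE// /dens expr2 mulrC.
Qed.

Lemma intb_ddens lam (q1 q2 f1 f2 w1 w2 k1 k2 : R -> R) :
  continuous q1 -> continuous q2 -> continuous w1 -> continuous w2 ->
  L2 f1 -> L2 f2 -> L2 k1 -> L2 k2 ->
  (forall t, 0 <= t <= 1 -> 0 < q1 t ^+ 2 + q2 t ^+ 2) ->
  intb 0 1 (fun t => ddens lam (q1 t) (q2 t) (f1 t) (f2 t) (w1 t) (w2 t) (k1 t) (k2 t)).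
Proof.
move=> c1 c2 cw1 cw2 Lf1 Lf2 Lk1 Lk2 V0.
have cs := cont_spd (cont_clamp c1) (cont_clamp c2).
have s0 t n : spd (q1 (clamp t)) (q2 (clamp t)) ^+ n != 0.
  by rewrite expf_neq0// gt_eqF// sqrtr_gt0 V0// clamp_in.
have ci n : continuous (fun t => (spd (q1 (clamp t)) (q2 (clamp t)) ^+ n)^-1).
  by apply: cont_inv; [move=> t; exact: s0|exact: cont_exp].
have LN := L2_nume c1 c2 Lf1 Lf2.
have LM : L2 (fun t => nume (w1 t) (w2 t) (f1 t) (f2 t) + nume (q1 t) (q2 t) (k1 t) (k2 t)).
  by apply: L2D; exact: L2_nume.
have cp : continuous (fun t => q1 t * w1 t + q2 t * w2 t) by apply: contD; exact: contM.
have I1 := intbZ 2 (intbM_cont (ci 5) (L2_mul LN LM)).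
have I2 := intbZ 5 (intbM_cont (ci 7) (intbM_cont cp (L2_mul LN LN))).
have I3 := intbZ lam (intb_cont 0 1 (contM cp (ci 1))).
apply: eq_intb (intbD (intbB I1 I2) I3) => t t01; rewrite clampE// /ddens /nume expr1.
by have := s0 t 1; rewrite clampE// expr1 => v0; field.
Qed.

(** The curvature terms are quadratic in the second derivatives, hence a bound by [H ^+ 2],
    integrable when [H] is in L2; the length term contains none, and there [1 <= H] is used. The
    coefficients 16 and 40 multiply up from the bounds [2 M H], [4 M H] and [2 M^2] of the
    numerators. *)
Lemma ddens_bound lam p1 p2 h1 h2 w1 w2 k1 k2 (M H r : R) :
  0 <= lam -> 0 < r -> 1 <= H -> 0 <= M -> r <= spd p1 p2 ->
  `|p1| <= M -> `|p2| <= M -> `|w1| <= M -> `|w2| <= M ->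
  `|h1| <= H -> `|h2| <= H -> `|k1| <= H -> `|k2| <= H ->
  `|ddens lam p1 p2 h1 h2 w1 w2 k1 k2| <=
    (16 * M ^+ 2 / r ^+ 5 + 40 * M ^+ 4 / r ^+ 7 + 2 * lam * M ^+ 2 / r) * H ^+ 2.
Proof.
move=> lam0 r0 H1 M0 rv p1M p2M w1M w2M h1H h2H k1H k2H.
have H0 : 0 <= H by lra.
have v0 : 0 < spd p1 p2 by lra.
have mul2 (a b A B : R) : `|a| <= A -> `|b| <= B -> `|a * b| <= A * B.
  by move=> aA bB; rewrite normrM ler_pM.
have N : `|nume p1 p2 h1 h2| <= 2 * M * H.
  rewrite /nume (le_trans (ler_normB _ _))//.
  by have := mul2 _ _ _ _ p1M h2H; have := mul2 _ _ _ _ p2M h1H; lra.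
have N' : `|w1 * h2 + p1 * k2 - w2 * h1 - p2 * k1| <= 4 * M * H.
  rewrite (le_trans (ler_normB _ _))// (le_trans (lerD (ler_normB _ _) (lexx _)))//.
  rewrite (le_trans (lerD (lerD (ler_normD _ _) (lexx _)) (lexx _)))//.
  have := mul2 _ _ _ _ w1M h2H; have := mul2 _ _ _ _ w2M h1H.
  by have := mul2 _ _ _ _ p1M k2H; have := mul2 _ _ _ _ p2M k1H; lra.
have P : `|p1 * w1 + p2 * w2| <= 2 * M ^+ 2.
  rewrite (le_trans (ler_normD _ _))//.
  by have := mul2 _ _ _ _ p1M w1M; have := mul2 _ _ _ _ p2M w2M; rewrite expr2; lra.
have inv n (a A : R) : `|a| <= A -> `|a / spd p1 p2 ^+ n| <= A / r ^+ n.
  move=> aA; apply: mul2 => //; rewrite normfV ger0_norm ?exprn_ge0 ?(ltW v0)//.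
  rewrite lef_pV2 ?posrE ?exprn_gt0//.
  by apply: lerXn2r => //; rewrite nnegrE ltW.
have MH0 : 0 <= 2 * M * H by rewrite !mulr_ge0.
have T1 := inv 5 _ _ (mul2 _ _ _ _ (mul2 2 _ 2 _ (_ : `|2| <= 2) N) N').
have T2 := inv 7 _ _ (mul2 _ _ _ _ (mul2 5 _ 5 _ (_ : `|5| <= 5) (mul2 _ _ _ _ N N)) P).
have T3 := inv 1 _ _ (mul2 lam _ lam _ (_ : `|lam| <= lam) P).
rewrite ger0_norm// in T1; rewrite ger0_norm// in T2; rewrite ger0_norm// in T3.
move: (T1 (lexx _)) (T2 (lexx _)) (T3 (lexx _)) => {}T1 {}T2 {}T3.
rewrite !expr1 in T3.
rewrite /ddens.
rewrite (le_trans (ler_normD _ _))// (le_trans (lerD (ler_normB _ _) (lexx _)))//.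
rewrite (le_trans (lerD (lerD T1 T2) T3))//.
have -> : (16 * M ^+ 2 / r ^+ 5 + 40 * M ^+ 4 / r ^+ 7 + 2 * lam * M ^+ 2 / r) * H ^+ 2 =
  2 * (2 * M * H) * (4 * M * H) / r ^+ 5 + 5 * (2 * M * H * (2 * M * H)) * (2 * M ^+ 2) / r ^+ 7 +
  lam * (2 * M ^+ 2) / r * H ^+ 2 by field; rewrite gt_eqF.
rewrite lerD2l ler_peMr ?exprn_ege1//.
apply: divr_ge0; last exact: ltW.
by rewrite mulr_ge0// mulr_ge0// exprn_ge0.
Qed.

Lemma perturbed_speed (p1 p2 w1 w2 : R -> R) :
  continuous p1 -> continuous p2 -> continuous w1 -> continuous w2 ->
  (forall t, 0 <= t <= 1 -> 0 < p1 t ^+ 2 + p2 t ^+ 2) ->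
  exists d m : R, [/\ 0 < d, d <= 1, 0 < m & forall e t : R, - d < e < d -> 0 <= t <= 1 ->
    m <= (p1 t + e * w1 t) ^+ 2 + (p2 t + e * w2 t) ^+ 2].
Proof.
move=> cp1 cp2 cw1 cw2 V0.
have [M1 [M10 bp1]] := cont_bound 0 1 cp1.
have [M2 [M20 bp2]] := cont_bound 0 1 cp2.
have [M3 [M30 bw1]] := cont_bound 0 1 cw1.
have [M4 [M40 bw2]] := cont_bound 0 1 cw2.
pose M := M1 + M2 + M3 + M4.
have M0 : 0 < M by rewrite /M; lra.
have {}bp1 t : 0 <= t <= 1 -> `|p1 t| <= M by move=> /bp1 ?; rewrite /M; lra.
have {}bp2 t : 0 <= t <= 1 -> `|p2 t| <= M by move=> /bp2 ?; rewrite /M; lra.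
have {}bw1 t : 0 <= t <= 1 -> `|w1 t| <= M by move=> /bw1 ?; rewrite /M; lra.
have {}bw2 t : 0 <= t <= 1 -> `|w2 t| <= M by move=> /bw2 ?; rewrite /M; lra.
have cV : continuous (fun t => p1 t ^+ 2 + p2 t ^+ 2).
  by move=> t; apply: cvgD; [exact: (cont_sqr cp1)|exact: (cont_sqr cp2)].
have [c0 c001 Vmin] := EVT_min (@ler01 R) (continuous_subspaceT cV).
pose m := p1 c0 ^+ 2 + p2 c0 ^+ 2.
have m0 : 0 < m by apply: V0; move: c001; rewrite in_itv.
have {}Vmin t : 0 <= t <= 1 -> m <= p1 t ^+ 2 + p2 t ^+ 2 by move=> t01; apply: Vmin; rewrite in_itv.
(* The cross term [2 e (p1 w1 + p2 w2)] is at most [4 d M^2] in modulus, so this [d] costs at most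
   half of the minimum [m]. *)
pose d := Num.min 1 (m / (8 * M ^+ 2)).
have MM : 0 < 8 * M ^+ 2 by rewrite mulr_gt0// exprn_gt0.
have d0 : 0 < d by rewrite /d lt_min ltr01 divr_gt0.
have d1 : d <= 1 by rewrite /d ge_min lexx.
have dm : d * (8 * M ^+ 2) <= m.
  by rewrite -ler_pdivlMr// /d ge_min lexx orbT.
have ed e : - d < e < d -> `|e| <= d by move=> /andP[e1 e2]; rewrite ler_norml !ltW.
exists d, (m / 2); split; [exact: d0|exact: d1|by rewrite divr_gt0|].
move=> e t /ed ed' t01; have := Vmin t t01.
have pw : `|p1 t * w1 t + p2 t * w2 t| <= 2 * M ^+ 2.
  rewrite (le_trans (ler_normD _ _))// !normrM.
  have := ler_pM (normr_ge0 _) (normr_ge0 _) (bp1 t t01) (bw1 t t01).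
  have := ler_pM (normr_ge0 _) (normr_ge0 _) (bp2 t t01) (bw2 t t01).
  by rewrite expr2; lra.
have : `|e * (p1 t * w1 t + p2 t * w2 t)| <= d * (2 * M ^+ 2) by rewrite normrM ler_pM.
rewrite ler_norml => /andP[+ _].
have := sqr_ge0 (e * w1 t); have := sqr_ge0 (e * w2 t); lra.
Qed.

(* The derivative is dominated by a multiple of [(1+|h1|+|h2|+|k1|+|k2|)^2] while [|e|] keeps
   the perturbed speed bounded away from zero. *)
Lemma is_derive_energy (p1 p2 w1 w2 h1 h2 k1 k2 : R -> R) lam : 0 <= lam ->
  continuous p1 -> continuous p2 -> continuous w1 -> continuous w2 ->
  L2 h1 -> L2 h2 -> L2 k1 -> L2 k2 ->
  (forall t, 0 <= t <= 1 -> 0 < p1 t ^+ 2 + p2 t ^+ 2) ->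
  is_derive (0 : R) (1 : R)
    (fun e => Rint 0 1 (fun t => dens lam (p1 t + e * w1 t) (p2 t + e * w2 t)
                                          (h1 t + e * k1 t) (h2 t + e * k2 t)))
    (Rint 0 1 (fun t => ddens lam (p1 t) (p2 t) (h1 t) (h2 t) (w1 t) (w2 t) (k1 t) (k2 t))).
Proof.
move=> lam0 cp1 cp2 cw1 cw2 Lh1 Lh2 Lk1 Lk2 V0.
have [M1 [M10 bp1]] := cont_bound 0 1 cp1.
have [M2 [M20 bp2]] := cont_bound 0 1 cp2.
have [M3 [M30 bw1]] := cont_bound 0 1 cw1.
have [M4 [M40 bw2]] := cont_bound 0 1 cw2.
pose M := M1 + M2 + M3 + M4.
have M0 : 0 < M by rewrite /M; lra.
have {}bp1 t : 0 <= t <= 1 -> `|p1 t| <= M by move=> /bp1 ?; rewrite /M; lra.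
have {}bp2 t : 0 <= t <= 1 -> `|p2 t| <= M by move=> /bp2 ?; rewrite /M; lra.
have {}bw1 t : 0 <= t <= 1 -> `|w1 t| <= M by move=> /bw1 ?; rewrite /M; lra.
have {}bw2 t : 0 <= t <= 1 -> `|w2 t| <= M by move=> /bw2 ?; rewrite /M; lra.
have [d [m [d0 d1 m0 Vlow]]] := perturbed_speed cp1 cp2 cw1 cw2 V0.
have ed e : - d < e < d -> `|e| <= d by move=> /andP[e1 e2]; rewrite ler_norml !ltW.
pose r := Num.sqrt m.
have r0 : 0 < r by rewrite sqrtr_gt0.
pose H t := 1 + `|h1 t| + `|h2 t| + `|k1 t| + `|k2 t|.
have LH : L2 H.
  have Ln (f : R -> R) : L2 f -> L2 (fun t => `|f t|).
    move=> [mf f2]; split; first exact: measurableT_comp.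
    by apply: eq_intb f2 => x _; rewrite real_normK// num_real.
  have L1 : L2 (fun=> 1 : R) by apply: L2_cont => x; exact: cvg_cst.
  by do 4 (apply: L2D; last exact: Ln).
have iH2 : intb 0 1 (fun t => H t ^+ 2) by case: LH.
pose Mb := 2 * M.
pose K := (16 * Mb ^+ 2 / r ^+ 5 + 40 * Mb ^+ 4 / r ^+ 7 + 2 * lam * Mb ^+ 2 / r).
have E0 (f : R -> R -> R) (F : R -> R) : (forall t, f 0 t = F t) ->
   Rint 0 1 (f 0) = Rint 0 1 F by move=> fF; apply: eq_Rint => t _.
rewrite -(E0 (fun e t => ddens lam (p1 t + e * w1 t) (p2 t + e * w2 t)
  (h1 t + e * k1 t) (h2 t + e * k2 t) (w1 t) (w2 t) (k1 t) (k2 t))); last first.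
  by move=> t; rewrite !mul0r !addr0.
have linM e t (a b : R -> R) (A : R) : - d < e < d -> `|a t| <= A -> `|b t| <= A -> `|a t + e * b t| <= 2 * A.
  move=> /ed ed' aA bA; rewrite (le_trans (ler_normD _ _))// normrM.
  have : `|e| * `|b t| <= 1 * A by rewrite ler_pM// (le_trans ed').
  lra.
apply: (@derive_Rint R (fun e t => dens lam (p1 t + e * w1 t) (p2 t + e * w2 t)
                                          (h1 t + e * k1 t) (h2 t + e * k2 t))
  (fun e t => ddens lam (p1 t + e * w1 t) (p2 t + e * w2 t)
  (h1 t + e * k1 t) (h2 t + e * k2 t) (w1 t) (w2 t) (k1 t) (k2 t)) 0 1 (- d) d 0 (fun t => K * (2 * H t) ^+ 2)).
- by rewrite oppr_lt0 d0.
- move=> e ede.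
  apply: intb_dens.
  - by move=> t; apply: cvgD; [exact: cp1|apply: cvgM; [exact: cvg_cst|exact: cw1]].
  - by move=> t; apply: cvgD; [exact: cp2|apply: cvgM; [exact: cvg_cst|exact: cw2]].
  - by apply: L2D => //; exact: L2Z.
  - by apply: L2D => //; exact: L2Z.
  - by move=> t t01; exact: lt_le_trans (Vlow e t ede t01).
- move=> e t ede t01; apply: is_derive_dens.
  by apply: lt_le_trans (Vlow e t ede t01).
- by have := intbZ (K * 4) iH2; apply: eq_intb => x _; ring.
- move=> e t ede t01.
  have nh1 := normr_ge0 (h1 t); have nh2 := normr_ge0 (h2 t).
  have nk1 := normr_ge0 (k1 t); have nk2 := normr_ge0 (k2 t).
  have HB (a b : R -> R) : `|a t| <= H t -> `|b t| <= H t -> `|a t + e * b t| <= 2 * H t.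
    exact: linM.
  have [n1 n2 n3 n4] : [/\ `|h1 t| <= H t, `|h2 t| <= H t, `|k1 t| <= H t & `|k2 t| <= H t].
    by rewrite /H; clear -nh1 nh2 nk1 nk2; split; lra.
  apply: ddens_bound => //.
  + by rewrite /H; lra.
  + by rewrite /Mb; lra.
  + by rewrite /r /spd ler_wsqrtr// Vlow.
  + by apply: linM => //; [exact: bp1|exact: bw1].
  + by apply: linM => //; [exact: bp2|exact: bw2].
  + by rewrite (le_trans (bw1 t t01))// /Mb; lra.
  + by rewrite (le_trans (bw2 t t01))// /Mb; lra.
  + exact: HB.
  + exact: HB.
  + by rewrite (le_trans n3)// /H; lra.
  + by rewrite (le_trans n4)// /H; lra.
Qed.

End FirstVariation.

(** * First variation of the energy of a curve *)

Section EnergyVariation.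
Variable R : realType.
Implicit Types (g eta : curve R) (lam : R).

Lemma speed_spd g t : speed g t = spd (d1 (cx g) t) (d1 (cy g) t).
Proof. by []. Qed.

Lemma spd_gt0 (a b : R) : (0 < spd a b) = (0 < a ^+ 2 + b ^+ 2).
Proof. by rewrite sqrtr_gt0. Qed.

(** Frees the energy from the derivatives chosen by [epsilon]: by [W22_spec] any representatives may
    be inserted, since the second derivatives differ only on a null set. *)
Lemma Elam_spec lam g (q1 q2 f1 f2 : R -> R) :
  ac q1 f1 -> ac q2 f2 -> L2 f1 -> L2 f2 ->
  (forall t, 0 <= t <= 1 -> cx g t = cx g 0 + Rint 0 t q1) ->
  (forall t, 0 <= t <= 1 -> cy g t = cy g 0 + Rint 0 t q2) ->
  (forall t, 0 <= t <= 1 -> 0 < q1 t ^+ 2 + q2 t ^+ 2) ->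
  Elam lam g = Rint 0 1 (fun t => dens lam (q1 t) (q2 t) (f1 t) (f2 t)).
Proof.
move=> a1 a2 L1 L2' g1 g2 V0.
have [W1 D1 E1] := W22_spec a1 L1 g1.
have [W2 D2 E2] := W22_spec a2 L2' g2.
have [c1 _ _] := a1; have [c2 _ _] := a2.
have spE t : 0 <= t <= 1 -> speed g t = spd (q1 t) (q2 t).
  by move=> t01; rewrite speed_spd D1// D2.
have I1 := intb_dens 0 c1 c2 (d2_L2 W1) (d2_L2 W2) V0.
have I2 := intb_dens 0 c1 c2 L1 L2' V0.
have cs := cont_spd c1 c2.
rewrite /Elam.
have -> : Rint 0 1 (fun t => curv g t ^+ 2 * speed g t) =
    Rint 0 1 (fun t => dens 0 (q1 t) (q2 t) (d2 (cx g) t) (d2 (cy g) t)).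
  by apply: eq_Rint => t t01; rewrite densE mul0r addr0 /curv spE// D1// D2.
have -> : Rint 0 1 (fun t => dens 0 (q1 t) (q2 t) (d2 (cx g) t) (d2 (cy g) t)) =
    Rint 0 1 (fun t => dens 0 (q1 t) (q2 t) (f1 t) (f2 t)).
  apply: ae01_Rint; [by rewrite ler01 lexx|exact: intb_meas I1|exact: intb_meas I2|].
  by apply: ae01_imp (ae01_and E1 E2) => t t01 [-> ->].
have -> : Rint 0 1 (speed g) = Rint 0 1 (fun t => spd (q1 t) (q2 t)) by exact: eq_Rint.
rewrite -RintZ; last exact: intb_cont.
rewrite -RintD//; last by apply: intbZ; exact: intb_cont.
by apply: eq_Rint => t _; rewrite /dens mul0r addr0.
Qed.

(** The derivatives chosen for a perturbed curve are not by construction the sums of those chosen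
    for [g] and [eta]. For small [e], where the speed stays positive, [Elam_spec] replaces them by
    these sums, and [is_derive_energy] applies. *)
Lemma first_variation lam g eta : 0 <= lam ->
  W22c g -> W22c eta -> (forall t, 0 <= t <= 1 -> speed g t != 0) ->
  is_derive (0 : R) (1 : R) (fun e => Elam lam (cvar g eta e))
    (Rint 0 1 (fun t => ddens lam (dc (cx g) t) (dc (cy g) t) (d2 (cx g) t) (d2 (cy g) t)
       (dc (cx eta) t) (dc (cy eta) t) (d2 (cx eta) t) (d2 (cy eta) t))).
Proof.
move=> lam0 [Wx Wy] [Wex Wey] s0.
have V0 t : 0 <= t <= 1 -> 0 < dc (cx g) t ^+ 2 + dc (cy g) t ^+ 2.
  by move=> t01; rewrite !dcE// -spd_gt0 lt_neqAle eq_sym s0//= sqrtr_ge0.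
have [c1 c2] := (dc_cont Wx, dc_cont Wy).
have [ce1 ce2] := (dc_cont Wex, dc_cont Wey).
have [d [m [d0 _ m0 Vlow]]] := perturbed_speed c1 c2 ce1 ce2 V0.
have := is_derive_energy lam0 c1 c2 ce1 ce2 (d2_L2 Wx) (d2_L2 Wy) (d2_L2 Wex) (d2_L2 Wey) V0.
apply: near_eq_is_derive.
near=> e.
have ed : - d < e < d.
  by apply/andP; split; near: e; [apply: lt_nbhsr; rewrite oppr_lt0|exact: lt_nbhsl].
have ae (u n : R -> R) : W22 u -> W22 n -> ac (fun t => dc u t + e * dc n t) (fun t => d2 u t + e * d2 n t).
  by move=> Wu We; apply: acD; [exact: dc_ac|apply: acZ; exact: dc_ac].
have Le (u n : R -> R) : W22 u -> W22 n -> L2 (fun t => d2 u t + e * d2 n t).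
  by move=> Wu We; apply: L2D; [exact: d2_L2|apply: L2Z; exact: d2_L2].
have ie (u n : R -> R) (t : R) : W22 u -> W22 n -> 0 <= t <= 1 ->
    u t + e * n t = u 0 + e * n 0 + Rint 0 t (fun t => dc u t + e * dc n t).
  move=> Wu We t01; have /andP[t0 t1] := t01.
  rewrite RintD; [|exact/intb_cont/dc_cont|apply: intbZ; exact/intb_cont/dc_cont].
  rewrite RintZ; last exact/intb_cont/dc_cont.
  by rewrite (W22_int Wu t01) (W22_int We t01) mulrDr addrACA.
rewrite (@Elam_spec lam (cvar g eta e) _ _ _ _ (ae _ _ Wx Wex) (ae _ _ Wy Wey) (Le _ _ Wx Wex) (Le _ _ Wy Wey))//.
- by move=> t t01; rewrite /cvar/=; exact: (ie (cx g) (cx eta)).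
- by move=> t t01; rewrite /cvar/=; exact: (ie (cy g) (cy eta)).
- by move=> t t01; apply: lt_le_trans (Vlow e t ed t01).
Unshelve. all: by end_near. Qed.

End EnergyVariation.

(** * The du Bois-Reymond lemma, and Gronwall with a square integrable coefficient *)

Section DuBoisReymond.
Variable R : realType.
Implicit Types (A B C D F f g a d : R -> R).

Lemma ac_eqf F f g : (forall t, 0 <= t <= 1 -> f t = g t) -> ac F f -> ac F g.
Proof.
move=> fg [cF fi Ff]; split=> //; first exact: eq_intb fi.
move=> t t01; rewrite (Ff t t01); congr (_ + _); apply: eq_Rint => x /andP[x0 xt].
by apply: fg; rewrite x0 (le_trans xt)//; case/andP: t01.
Qed.

Lemma t0_in : (0 : R) <= 0 <= (1 : R).
Proof. by rewrite lexx ler01. Qed.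

Lemma t1_in : (0 : R) <= 1 <= (1 : R).
Proof. by rewrite lexx ler01. Qed.

Lemma ge0_Rint0_ae f : intb 0 1 f -> (forall t, 0 <= t <= 1 -> 0 <= f t) -> Rint 0 1 f = 0 ->
  ae01 (fun t => f t = 0).
Proof.
move=> fi f0 F0; apply: Rint0_ae0 => // t t01; have /andP[t0 t1] := t01.
have H1 : 0 <= Rint 0 t f.
  by apply: Rint_ge0 => x /andP[x0 xt]; rewrite f0// x0 (le_trans xt).
have H2 : 0 <= Rint t 1 f.
  by apply: Rint_ge0 => x /andP[tx x1]; rewrite f0// x1 (le_trans t0).
by move: F0; rewrite (Rint_split t0 t1 fi) => F0; lra.
Qed.

Lemma ac_Rint F f : ac F f -> Rint 0 1 f = F 1 - F 0.
Proof. by move=> [_ _ ->]; rewrite ?t1_in// addrC addKr. Qed.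

(* The test function with [w' = A - C] and mean zero turns the hypothesis into [int (A - C)^2 = 0]. *)
Lemma du_bois_reymond A B : L2 A -> intb 0 1 B ->
  (forall w k, ac w k -> L2 k -> Rint 0 1 w = 0 -> Rint 0 1 (fun t => B t * w t + A t * k t) = 0) ->
  exists (c : R) C, [/\ ac C (fun t => B t - c), C 0 = 0, C 1 = 0 & ae01 (fun t => A t = C t)].
Proof.
move=> LA iB H.
(* With the mean of [B] as constant, [C] vanishes at both ends; for the elastica this becomes the
   natural condition of zero curvature at the hinges. *)
pose c := Rint 0 1 B.
have iBc : intb 0 1 (fun t => B t - c) by apply: intbB => //; exact: cst_intb.
pose C t := 0 + Rint 0 (clamp t) (fun t => B t - c).
have aC : ac C (fun t => B t - c) by exact: ac_prim.
have C0 : C 0 = 0 by rewrite /C clampE ?t0_in// Rint_point addr0.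
have C1 : C 1 = 0.
  rewrite /C clampE ?t1_in// RintB//; last exact: cst_intb.
  by rewrite Rint_cst// subr0 mulr1 subrr addr0.
have [cC _ _] := aC.
exists c, C; split=> //.
pose k t := A t - C t.
have Lk : L2 k.
  have := L2D LA (L2Z (-1) (L2_cont cC)).
  by congr L2; apply/funext => t; rewrite /k mulN1r.
have ik := L2_intb Lk.
pose K t := 0 + Rint 0 (clamp t) k.
have aK : ac K k by exact: ac_prim.
have [cK _ _] := aK.
pose w t := K t - Rint 0 1 K.
have aw : ac w k.
  by apply: ac_eqf (acB aK (ac_cst (Rint 0 1 K))) => t _; rewrite subr0.
have w0 : Rint 0 1 w = 0.
  by rewrite RintB ?Rint_cst// ?subr0 ?mulr1 ?subrr//; [exact: intb_cont|exact: cst_intb].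
have [cw _ _] := aw.
have Hw := H w k aw Lk w0.
have P := ac_Rint (acM aC aw); rewrite C0 C1 !mul0r subrr in P.
have iBw : intb 0 1 (fun t => B t * w t) by apply: eq_intb (intbM_cont cw iB) => t _; rewrite mulrC.
have icw : intb 0 1 (fun t => c * w t) by apply: intbZ; exact: intb_cont.
have iAk : intb 0 1 (fun t => A t * k t) by exact: L2_mul.
have iCk : intb 0 1 (fun t => C t * k t) by exact: intbM_cont.
(* The three integrals below vanish in turn by the hypothesis, by the product rule for [C w] with
   [C] zero at both ends, and by the zero mean of [w]. *)
have k2 : Rint 0 1 (fun t => k t ^+ 2) = 0.
  have -> : Rint 0 1 (fun t => k t ^+ 2) =
     Rint 0 1 (fun t => (B t * w t + A t * k t) - ((B t - c) * w t + C t * k t) - c * w t).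
    by apply: eq_Rint => t _; rewrite [in LHS]/k /k; ring.
  have iP : intb 0 1 (fun t => (B t - c) * w t + C t * k t).
    by apply: eq_intb (intbD (intbB iBw icw) iCk) => t _; rewrite mulrBl.
  have iH : intb 0 1 (fun t => B t * w t + A t * k t) by exact: intbD.
  rewrite RintB//; last exact: intbB.
  rewrite RintB// Hw P RintZ; last exact: intb_cont.
  by rewrite w0; lra.
have := ge0_Rint0_ae (proj2 Lk) (fun t _ => sqr_ge0 (k t)) k2.
apply: ae01_imp => t _ /eqP; rewrite sqrf_eq0 => /eqP; rewrite /k => /eqP.
by rewrite subr_eq0 => /eqP.
Qed.

Lemma Rint_CS f g t : 0 <= t <= 1 -> L2 f -> L2 g ->
  Rint 0 t (fun x => f x * g x) ^+ 2 <= Rint 0 t (fun x => f x ^+ 2) * Rint 0 t (fun x => g x ^+ 2).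
Proof.
move=> t01 Lf Lg; have /andP[t0 t1] := t01.
have i1 := intb_sub01 t01 (L2_mul Lf Lg).
have i2 := intb_sub01 t01 (proj2 Lf).
have i3 := intb_sub01 t01 (proj2 Lg).
set b := Rint 0 t _; set a := Rint 0 t (fun x => f x ^+ 2); set c := Rint 0 t (fun x => g x ^+ 2).
have Q (s r : R) : 0 <= s ^+ 2 * a + (2 * (s * r) * b + r ^+ 2 * c).
  rewrite /a /b /c -!RintZ//; have i4 := intbZ (2 * (s * r)) i1; have i5 := intbZ (r ^+ 2) i3.
  rewrite -RintD// -RintD//; [|exact: intbZ|exact: intbD].
  apply: Rint_ge0 => x _; have := sqr_ge0 (s * f x + r * g x).
  by congr (_ <= _); ring.
have a0 : 0 <= a by apply: Rint_ge0 => x _; exact: sqr_ge0.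
have c0 : 0 <= c by apply: Rint_ge0 => x _; exact: sqr_ge0.
(* The nonnegative form is evaluated at two well chosen points: [(c + 1, - b)] gives
   [- b^2 (c + 2) >= 0] when [a = 0], and [(b, - a)] gives [a (a c - b^2) >= 0]. *)
have [az|an] := eqVneq a 0.
  have := Q (c + 1) (- b); rewrite az; have := sqr_ge0 b => b2 H.
  nra.
have {}a0 : 0 < a by rewrite lt_neqAle eq_sym an.
have := Q b (- a) => H.
have {}H : 0 <= a * (a * c - b ^+ 2) by rewrite (le_trans H)//; lra.
by move: H; rewrite pmulr_rge0// subr_ge0.
Qed.

(** The coefficient need not be bounded, so [gronwall] does not apply directly. Cauchy-Schwarz gives
    [D^2 <= K U] with [U] the integral of [D^2], and [gronwall] applies to [U]. *)
Lemma gronwall_L2 D d a : ac D d -> D 0 = 0 -> L2 a -> ae01 (fun t => d t = a t * D t) ->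
  forall t, 0 <= t <= 1 -> D t = 0.
Proof.
move=> aD D0 La da.
have [cD id0 _] := aD.
have LD : L2 D by exact: L2_cont.
have c2 : continuous (fun t => D t ^+ 2) by exact: cont_sqr.
pose U t := 0 + Rint 0 (clamp t) (fun t => D t ^+ 2).
have aU : ac U (fun t => D t ^+ 2) by apply: ac_prim; exact: intb_cont.
pose K := Rint 0 1 (fun t => a t ^+ 2).
have DU t : 0 <= t <= 1 -> D t ^+ 2 <= K * U t.
  move=> t01; have /andP[t0 t1] := t01.
  rewrite (ac_0 aD D0 t01) /U clampE// add0r.
  rewrite (@ae01_Rint _ d (fun t => a t * D t) t)//; [|exact: intb_meas id0|exact: intb_meas (L2_mul La LD)].
  apply: le_trans (Rint_CS t01 La LD) _; apply: ler_wpM2r.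
    by apply: Rint_ge0 => x _; exact: sqr_ge0.
  rewrite /K (Rint_split t0 t1 (proj2 La)) lerDl; apply: Rint_ge0 => x _; exact: sqr_ge0.
have U0 : U 0 = 0 by rewrite /U clampE ?t0_in// Rint_point addr0.
have Uge t : 0 <= t <= 1 -> 0 <= U t.
  by move=> t01; rewrite /U add0r; apply: Rint_ge0 => x _; exact: sqr_ge0.
move=> t t01; have := DU t t01.
rewrite (gronwall aU U0 Uge DU t01) mulr0 => H.
by apply/eqP; rewrite -sqrf_eq0 eq_le H sqr_ge0.
Qed.

End DuBoisReymond.
Arguments t0_in {R}.
Arguments t1_in {R}.

(** * Critical curves: conserved force, tangent and energy *)

Section EulerLagrange.
Variable R : realType.
Implicit Types (g eta : curve R) (lam l F : R).

(** Collects the coefficients of the test function. Those of [k1] and [k2] form [2 N / v^5] times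
    the tangent turned by a right angle, which is why [A1 p1 + A2 p2] vanishes later on. *)
Lemma ddens_split lam (p1 p2 h1 h2 w1 w2 k1 k2 : R) : 0 < spd p1 p2 ->
  ddens lam p1 p2 h1 h2 w1 w2 k1 k2 =
  ((2 * nume p1 p2 h1 h2 / spd p1 p2 ^+ 5) * h2 +
   (lam / spd p1 p2 - 5 * nume p1 p2 h1 h2 ^+ 2 / spd p1 p2 ^+ 7) * p1) * w1
  + (- (2 * nume p1 p2 h1 h2 / spd p1 p2 ^+ 5) * p2) * k1
  + (((- (2 * nume p1 p2 h1 h2 / spd p1 p2 ^+ 5)) * h1 +
   (lam / spd p1 p2 - 5 * nume p1 p2 h1 h2 ^+ 2 / spd p1 p2 ^+ 7) * p2) * w2
  + ((2 * nume p1 p2 h1 h2 / spd p1 p2 ^+ 5) * p1) * k2).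
Proof. by move=> v0; rewrite /ddens; field; rewrite gt_eqF. Qed.

Lemma spd_sqr (a b : R) : spd a b ^+ 2 = a ^+ 2 + b ^+ 2.
Proof. by rewrite sqr_sqrtr// addr_ge0// sqr_ge0. Qed.

(** Zero mean is what makes the primitive vanish at both ends, so a test function may be prescribed
    through its derivative. *)
Lemma W22_zero_mean w k : ac w k -> L2 k -> Rint 0 1 w = 0 ->
  exists u : R -> R, [/\ W22 u, u 0 = 0, u 1 = 0,
    forall t, 0 <= t <= 1 -> dc u t = w t & ae01 (fun t => d2 u t = k t)].
Proof.
move=> aw Lk w0; have [cw _ _] := aw.
pose u t := Rint 0 (clamp t) w.
have u0 : u 0 = 0 by rewrite /u clampE ?t0_in// Rint_point.
have up t : 0 <= t <= 1 -> u t = u 0 + Rint 0 t w.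
  by move=> t01; rewrite u0 /u clampE// add0r.
have [Wu D1 D2] := W22_spec aw Lk up.
exists u; split=> //; first by rewrite /u clampE// t1_in.
by move=> t t01; rewrite dcE// D1.
Qed.

Lemma W22_zero : exists u : R -> R, [/\ W22 u, u 0 = 0, u 1 = 0,
    forall t, 0 <= t <= 1 -> dc u t = 0 & ae01 (fun t => d2 u t = 0)].
Proof.
apply: W22_zero_mean (ac_cst 0) _ _; first by apply: L2_cont; exact: cont_cst.
by rewrite Rint_cst// mul0r.
Qed.

Section Fixed.
Variables (lam l : R) (g : curve R).
Hypotheses (lam0 : 0 < lam) (l0 : 0 < l) (ppg : pp_elastica lam l g).
Local Notation p1 := (dc (cx g)).
Local Notation p2 := (dc (cy g)).
Local Notation h1 := (d2 (cx g)).
Local Notation h2 := (d2 (cy g)).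
Definition gv t := spd (p1 t) (p2 t).
Local Notation v := gv.
Local Notation N := (fun t => nume (p1 t) (p2 t) (h1 t) (h2 t)).

Lemma pp_W22 : W22 (cx g) /\ W22 (cy g).
Proof. by case: ppg => [[]]. Qed.

Let Wx : W22 (cx g) := proj1 pp_W22.
Let Wy : W22 (cy g) := proj2 pp_W22.
Let cp1 : continuous p1 := dc_cont Wx.
Let cp2 : continuous p2 := dc_cont Wy.
Let Lh1 : L2 h1 := d2_L2 Wx.
Let Lh2 : L2 h2 := d2_L2 Wy.

Lemma gv_gt0 t : 0 < v t.
Proof.
have [[_ [s0 _]] _] := ppg.
rewrite /gv /dc lt_neqAle sqrtr_ge0 andbT eq_sym -[spd _ _]/(speed g (clamp t)).
by apply: s0; exact: clamp_in.
Qed.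

Lemma gv_cont : continuous v.
Proof. exact: cont_spd. Qed.

Lemma gvX_neq0 t n : v t ^+ n != 0.
Proof. by rewrite expf_neq0// gt_eqF// gv_gt0. Qed.

Lemma gvXV_cont n : continuous (fun t => (v t ^+ n)^-1).
Proof. by apply: cont_inv; [move=> t; exact: gvX_neq0|apply: cont_exp; exact: gv_cont]. Qed.

Lemma gN_L2 : L2 N.
Proof. exact: L2_nume. Qed.

Let S t := 2 * N t / v t ^+ 5.
Let Q t := lam / v t - 5 * N t ^+ 2 / v t ^+ 7.
Let A1 t := - S t * p2 t.
Let A2 t := S t * p1 t.
Let B1 t := S t * h2 t + Q t * p1 t.
Let B2 t := - S t * h1 t + Q t * p2 t.

Let LS : L2 S.
Proof.
have := L2Z 2 (L2M_cont (@gvXV_cont 5) gN_L2).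
by congr L2; apply/funext => t; rewrite /S mulrCA mulrC.
Qed.

Let iQ : intb 0 1 Q.
Proof.
apply: intbB.
  apply: eq_intb (intbZ lam (intb_cont 0 1 (@gvXV_cont 1))) => t _; by rewrite expr1.
have := intbM_cont (@gvXV_cont 7) (intbZ 5 (proj2 gN_L2)).
by apply: eq_intb => t _; rewrite mulrC.
Qed.

Let LA1 : L2 A1.
Proof.
have := L2Z (-1) (L2M_cont cp2 LS); congr L2; apply/funext => t; rewrite /A1; ring.
Qed.

Let LA2 : L2 A2.
Proof. by have := L2M_cont cp1 LS; congr L2; apply/funext => t; rewrite /A2 mulrC. Qed.

Let iB1 : intb 0 1 B1.
Proof.
apply: intbD; first exact: L2_mul.
by apply: eq_intb (intbM_cont cp1 iQ) => t _; rewrite mulrC.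
Qed.

Let iB2 : intb 0 1 B2.
Proof.
apply: intbD; last by apply: eq_intb (intbM_cont cp2 iQ) => t _; rewrite mulrC.
by apply: eq_intb (intbN (L2_mul LS Lh1)) => t _; rewrite mulNr.
Qed.

Lemma pp_stationary eta : test_fun eta ->
  Rint 0 1 (fun t => (B1 t * dc (cx eta) t + A1 t * d2 (cx eta) t) +
                     (B2 t * dc (cy eta) t + A2 t * d2 (cy eta) t)) = 0.
Proof.
move=> te; have [[_ [s0 _]] cr] := ppg; have [We _] := te.
have Z := cr eta te.
have V := first_variation (ltW lam0) (conj Wx Wy) We s0.
apply: etrans (etrans (esym (@derive_val _ _ _ _ _ _ _ V)) (@derive_val _ _ _ _ _ _ _ Z)).
apply: eq_Rint => t _.
by rewrite ddens_split ?gv_gt0.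
Qed.

(** Purely horizontal test functions. The constant obtained is, up to sign, the horizontal component
    of the force; [dB2] provides the vertical one. *)
Let dB1 : exists (c : R) C, [/\ ac C (fun t => B1 t - c), C 0 = 0, C 1 = 0 & ae01 (fun t => A1 t = C t)].
Proof.
apply: du_bois_reymond => // w k aw Lk w0.
have [u [Wu u0 u1 uw uk]] := W22_zero_mean aw Lk w0.
have [z [Wz z0 z1 zw zk]] := W22_zero.
pose eta : curve R := fun t => (u t, z t).
have te : test_fun eta by split; [split|rewrite /eta u0 z0 u1 z1].
apply: etrans (pp_stationary te).
apply: ae01_Rint; first exact: t1_in.
- apply: intb_meas; apply: intbD; last exact: L2_mul.
  by have [cw _ _] := aw; apply: eq_intb (intbM_cont cw iB1) => t _; rewrite mulrC.
- have mm B A u' : intb 0 1 B -> L2 A -> W22 u' ->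
    measurable_fun (`[0, 1]%classic : set R) (fun t => B t * dc u' t + A t * d2 u' t).
    move=> iB [mA _] Wu'; have [mk _] := d2_L2 Wu'.
    apply: measurable_funD; apply: measurable_funM => //; first exact: intb_meas iB.
    by apply: cont_meas; exact: dc_cont.
  by apply: measurable_funD; apply: mm.
apply: ae01_imp (ae01_and uk zk) => t t01 [ek ez].
by rewrite -[d2 (cx eta) t]/(d2 u t) -[d2 (cy eta) t]/(d2 z t) -[dc (cx eta) t]/(dc u t)
  -[dc (cy eta) t]/(dc z t) ek ez uw// zw// !mulr0 !addr0.
Qed.

Let dB2 : exists (c : R) C, [/\ ac C (fun t => B2 t - c), C 0 = 0, C 1 = 0 & ae01 (fun t => A2 t = C t)].
Proof.
apply: du_bois_reymond => // w k aw Lk w0.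
have [u [Wu u0 u1 uw uk]] := W22_zero_mean aw Lk w0.
have [z [Wz z0 z1 zw zk]] := W22_zero.
pose eta : curve R := fun t => (z t, u t).
have te : test_fun eta by split; [split|rewrite /eta u0 z0 u1 z1].
apply: etrans (pp_stationary te).
apply: ae01_Rint; first exact: t1_in.
- apply: intb_meas; apply: intbD; last exact: L2_mul.
  by have [cw _ _] := aw; apply: eq_intb (intbM_cont cw iB2) => t _; rewrite mulrC.
- have mm B A u' : intb 0 1 B -> L2 A -> W22 u' ->
    measurable_fun (`[0, 1]%classic : set R) (fun t => B t * dc u' t + A t * d2 u' t).
    move=> iB [mA _] Wu'; have [mk _] := d2_L2 Wu'.
    apply: measurable_funD; apply: measurable_funM => //; first exact: intb_meas iB.
    by apply: cont_meas; exact: dc_cont.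
  by apply: measurable_funD; apply: mm.
apply: ae01_imp (ae01_and uk zk) => t t01 [ek ez].
by rewrite -[d2 (cx eta) t]/(d2 z t) -[d2 (cy eta) t]/(d2 u t) -[dc (cx eta) t]/(dc z t)
  -[dc (cy eta) t]/(dc u t) ek ez uw// zw// !mulr0 !add0r.
Qed.

Lemma pp_ends : [/\ cx g 0 = 0, cy g 0 = 0, cx g 1 = l & cy g 1 = 0].
Proof. by have [[_ [_ [g0 g1]]] _] := ppg; rewrite /cx /cy g0 g1. Qed.

(* Conservation of the force [F = (F, 0)]: its normal component gives [2 k = - F y],
   its tangential one [F x' = (k^2 - lam) |g'|]. *)
Lemma pp_first_integral : exists F : R,
  (ae01 (fun t => N t = - (F * cy g t / 2) * v t ^+ 3)) /\
  (forall t, 0 <= t <= 1 -> F * p1 t = ((F * cy g t / 2) ^+ 2 - lam) * v t).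
Proof.
have [c1 [C1 [aC1 C10 C11 AC1]]] := dB1.
have [c2 [C2 [aC2 C20 C21 AC2]]] := dB2.
have AC := ae01_and AC1 AC2.
have [x0 y0 x1 y1] := pp_ends.
have a1 := dc_ac Wx; have a2 := dc_ac Wy.
have v2 t : p1 t ^+ 2 + p2 t ^+ 2 = v t ^+ 2 by rewrite spd_sqr.
have Sv t : S t * v t ^+ 2 = 2 * N t / v t ^+ 3.
  by rewrite /S; field; rewrite gt_eqF// gv_gt0.
(* [Z] is a continuous representative of twice the signed curvature. In its derivative all but the
   constants cancels, so [Z = c1 y - c2 x]; at the right end [Z = y = 0] and [x = l], which forces
   [c2 = 0]. *)
pose Z t := C2 t * p1 t - C1 t * p2 t.
have aZ := acB (acM aC2 a1) (acM aC1 a2).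
have Z0 : Z 0 = 0 by rewrite /Z C10 C20 !mul0r subrr.
have Z1 : Z 1 = 0 by rewrite /Z C11 C21 !mul0r subrr.
have {}aZ : ac Z (fun t => c1 * p2 t - c2 * p1 t).
  apply: ac_ae aZ.
    by apply: cont_meas; apply: contB; apply: contM => //; exact: cont_cst.
  apply: ae01_imp AC => t t01 [<- <-].
  by rewrite /A1 /A2 /B1 /B2; ring.
have ZE t : 0 <= t <= 1 -> Z t = c1 * cy g t - c2 * cx g t.
  move=> t01; rewrite (ac_0 aZ Z0 t01).
  have ip1 : intb 0 t p1 by exact: intb_cont.
  have ip2 : intb 0 t p2 by exact: intb_cont.
  rewrite RintB ?RintZ//; [|exact: intbZ|exact: intbZ].
  have -> : cy g t = Rint 0 t p2 by rewrite (W22_int Wy t01) y0 add0r.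
  by have -> : cx g t = Rint 0 t p1 by rewrite (W22_int Wx t01) x0 add0r.
have c20 : c2 = 0.
  move: (ZE 1 t1_in); rewrite Z1 x1 y1 mulr0 sub0r => /esym/eqP.
  by rewrite oppr_eq0 mulf_eq0 (gt_eqF l0) orbF => /eqP.
have {}ZE t : 0 <= t <= 1 -> Z t = c1 * cy g t.
  by move=> t01; rewrite ZE// c20 mul0r subr0.
have [cZ _ _] := aZ.
have NZ : ae01 (fun t => N t = Z t / 2 * v t ^+ 3).
  apply: ae01_imp AC => t t01 [e1 e2].
  have -> : Z t = S t * v t ^+ 2 by rewrite /Z -e1 -e2 -v2 /A1 /A2; ring.
  by rewrite Sv; field; rewrite gt_eqF// gv_gt0.
exists (- c1); split.
  apply: ae01_imp NZ => t t01 ->; rewrite ZE//; ring.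
(* [(C1, C2)] is normal to the curve. The derivative of the identically zero scalar product is the
   tangential part of the force balance. *)
have aP := acD (acM aC1 a1) (acM aC2 a2).
have P0 t : 0 <= t <= 1 -> C1 t * p1 t + C2 t * p2 t = 0.
  move: t; apply: ae01_cont0; first by case: aP.
  by apply: ae01_imp AC => t t01 [<- <-]; rewrite /A1 /A2; ring.
have aP0 : ac (fun t => C1 t * p1 t + C2 t * p2 t) (fun=> 0).
  by apply: ac_eq (ac_cst 0); [by move=> t t01; rewrite P0|case: aP].
have dP := ac_unique aP aP0.
have cv := gv_cont.
have HE : ae01 (fun t => - c1 * p1 t - ((Z t / 2) ^+ 2 - lam) * v t = 0).
  apply: ae01_imp (ae01_and (ae01_and dP AC) NZ) => t t01 [[dPt [e1 e2]] nz].
  have v0 : v t != 0 by rewrite gt_eqF// gv_gt0.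
  move: dPt; rewrite -e1 -e2 c20 subr0 => dPt.
  have E : c1 * p1 t = 2 * S t * N t + Q t * (p1 t ^+ 2 + p2 t ^+ 2).
    apply/eqP; rewrite -subr_eq0 -oppr_eq0 -dPt; apply/eqP.
    by rewrite /A1 /A2 /B1 /B2 /nume; ring.
  rewrite mulNr E v2 /S /Q nz; field.
  by rewrite v0.
have cE : continuous (fun t => - c1 * p1 t - ((Z t / 2) ^+ 2 - lam) * v t).
  apply: contB; first by apply: contM => //; exact: cont_cst.
  apply: contM => //; apply: contB; last exact: cont_cst.
  by apply: cont_sqr; apply: contM => //; exact: cont_cst.
move=> t t01; have /eqP := ae01_cont0 cE HE t01; rewrite subr_eq0 => /eqP ->.
by rewrite ZE//; ring.
Qed.


(* Rotating [g'] by minus the integral of the curvature leaves a curve whose derivative is a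
   scalar multiple of itself, hence which keeps its direction. *)
Lemma pp_tangent F : ae01 (fun t => N t = - (F * cy g t / 2) * v t ^+ 3) ->
  ac (fun t => p2 t / v t) (fun t => - (F * cy g t / 2) * p1 t).
Proof.
move=> NF.
pose K t := - (F * cy g (clamp t) / 2).
have cK : continuous K.
  apply: contN; apply: contM; last exact: cont_cst.
  apply: contM; first exact: cont_cst.
  have -> : (fun t => cy g (clamp t)) = (fun t => cy g 0 + Rint 0 (clamp t) p2).
    by apply/funext => t; rewrite (W22_int Wy (clamp_in t)).
  by apply: contD; [exact: cont_cst|apply: prim_cont; exact: intb_cont].
have cKv : continuous (fun t => K t * v t) by apply: contM => //; exact: gv_cont.
pose Th t := oint 0 t (fun t => K t * v t).
have dTh t : is_derive t (1 : R) Th (K t * v t) by exact: is_derive_oint.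
have cTh := der_cont dTh.
have dcos t : is_derive t (1 : R) (fun t => cos (Th t)) (- sin (Th t) * (K t * v t)).
  by apply: (@der_comp _ cos Th) => //; exact: is_derive_cos.
have dsin t : is_derive t (1 : R) (fun t => sin (Th t)) (cos (Th t) * (K t * v t)).
  by apply: (@der_comp _ sin Th) => //; exact: is_derive_sin.
have [ccos csin] := (der_cont dcos, der_cont dsin).
have acos : ac (fun t => cos (Th t)) (fun t => - sin (Th t) * (K t * v t)).
  by apply: C1_ac => //; apply: contM => //; exact: contN.
have asin : ac (fun t => sin (Th t)) (fun t => cos (Th t) * (K t * v t)).
  by apply: C1_ac => //; apply: contM.
have a1 := dc_ac Wx; have a2 := dc_ac Wy.
pose P1 t := cos (Th t) * p1 t + sin (Th t) * p2 t.
pose P2 t := cos (Th t) * p2 t - sin (Th t) * p1 t.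
have aP1 := acD (acM acos a1) (acM asin a2).
have aP2 := acB (acM acos a2) (acM asin a1).
(* The radial growth rate of [g']. Once the rotation is removed, [(P1, P2)' = a (P1, P2)], so the
   cross product [D] with the initial vector solves [D' = a D] from zero. *)
pose a t := (v t ^+ 2)^-1 * (p1 t * h1 t + p2 t * h2 t).
have La : L2 a.
  by apply: L2M_cont; [exact: gvXV_cont|apply: L2D; exact: L2M_cont].
have v2 t : p1 t ^+ 2 + p2 t ^+ 2 = v t ^+ 2 by rewrite spd_sqr.
have cs t : cos (Th t) ^+ 2 + sin (Th t) ^+ 2 = 1 by exact: cos2Dsin2.
have hE : ae01 (fun t => h1 t = a t * p1 t - K t * v t * p2 t /\ h2 t = a t * p2 t + K t * v t * p1 t).
  apply: ae01_imp NF => t t01 Nt.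
  have v0 : v t != 0 by rewrite gt_eqF// gv_gt0.
  have Nt2 : K t * v t = nume (p1 t) (p2 t) (h1 t) (h2 t) / v t ^+ 2.
    by rewrite Nt /K clampE//; field.
  rewrite Nt2 /a /nume -v2; have : p1 t ^+ 2 + p2 t ^+ 2 != 0 by rewrite v2 expf_neq0.
  by move=> V0; split; field.
pose D t := P1 0 * P2 t - P2 0 * P1 t.
have aD := acB (acZ (P1 0) aP2) (acZ (P2 0) aP1).
have D0 : D 0 = 0 by rewrite /D; ring.
have D00 : forall t, 0 <= t <= 1 -> D t = 0.
  apply: (gronwall_L2 aD D0 La).
  apply: ae01_imp hE => t t01 [-> ->].
  by rewrite /P1 /P2; ring.
have P1sq t : P1 t ^+ 2 + P2 t ^+ 2 = v t ^+ 2.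
  rewrite -v2 -[RHS]mul1r -(cs t) /P1 /P2; ring.
(* [D = 0] still allows two opposite directions. The scalar product [G] with the initial vector has
   modulus [v 0 * v t], never zero, so by the intermediate value theorem it keeps its sign. *)
pose G t := P1 0 * P1 t + P2 0 * P2 t.
have Gsq t : 0 <= t <= 1 -> G t ^+ 2 = (v 0 * v t) ^+ 2.
  move=> t01; rewrite exprMn -!P1sq.
  have := D00 t t01; rewrite /D /G => D0t.
  have -> : (P1 0 ^+ 2 + P2 0 ^+ 2) * (P1 t ^+ 2 + P2 t ^+ 2) =
    (P1 0 * P1 t + P2 0 * P2 t) ^+ 2 + (P1 0 * P2 t - P2 0 * P1 t) ^+ 2 by ring.
  by rewrite D0t expr0n addr0.
have cG : continuous G.
  by apply: contD; apply: contM; [exact: cont_cst|case: aP1|exact: cont_cst|case: aP2].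
have G0 : 0 < G 0 by rewrite /G -!expr2 P1sq exprn_gt0// gv_gt0.
have GE t : 0 <= t <= 1 -> G t = v 0 * v t.
  move=> t01; have /andP[t0 t1] := t01.
  have vv : 0 < v 0 * v t by rewrite mulr_gt0// gv_gt0.
  have := Gsq t t01; move/eqP; rewrite eqf_sqr => /orP[/eqP//|/eqP Gt].
  have Gneg : G t < 0 by rewrite Gt oppr_lt0.
  have [c] : exists2 c, c \in `[0, t]%R & G c = 0.
    apply: IVT => //; first exact: continuous_subspaceT.
    by rewrite ge_min le_max (ltW Gneg) (ltW G0) orbT.
  rewrite in_itv/= => /andP[c0 ct] Gc.
  have c01 : 0 <= c <= 1 by rewrite c0 (le_trans ct).
  have := Gsq c c01; rewrite Gc expr0n/= => /esym/eqP; rewrite sqrf_eq0.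
  by rewrite mulf_eq0 !gt_eqF ?gv_gt0.
have v00 : v 0 != 0 by rewrite gt_eqF// gv_gt0.
have PE t : 0 <= t <= 1 -> P1 t = v t / v 0 * P1 0 /\ P2 t = v t / v 0 * P2 0.
  move=> t01; have Dt := D00 t t01; have Gt := GE t t01; have s0 := P1sq 0.
  have E1 : v 0 ^+ 2 * P1 t = v 0 * v t * P1 0.
    by rewrite -s0 -Gt /G; have := Dt; rewrite /D => /(congr1 (fun x => P2 0 * x)); rewrite mulr0; lra.
  have E2 : v 0 ^+ 2 * P2 t = v 0 * v t * P2 0.
    by rewrite -s0 -Gt /G; have := Dt; rewrite /D => /(congr1 (fun x => P1 0 * x)); rewrite mulr0; lra.
  have v02 : v 0 ^+ 2 != 0 by rewrite expf_neq0.
  by split; apply: (mulfI v02); [rewrite E1|rewrite E2]; field.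
(* The vertical component of the unit tangent, written through the smooth angle [Th] and constants:
   in this form it can be differentiated classically. *)
pose T t := sin (Th t) * (P1 0 / v 0) + cos (Th t) * (P2 0 / v 0).
have dT t : is_derive t (1 : R) T
    (cos (Th t) * (K t * v t) * (P1 0 / v 0) - sin (Th t) * (K t * v t) * (P2 0 / v 0)).
  have := derD (derM (dsin t) (der_cst (P1 0 / v 0) t)) (derM (dcos t) (der_cst (P2 0 / v 0) t)).
  by move=> /der_eq; apply; ring.
have aT : ac T (fun t => cos (Th t) * (K t * v t) * (P1 0 / v 0) - sin (Th t) * (K t * v t) * (P2 0 / v 0)).
  apply: C1_ac dT; apply: contB; apply: contM; by [exact: contM|exact: cont_cst].
have rot1 t : p1 t = cos (Th t) * P1 t - sin (Th t) * P2 t.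
  rewrite /P1 /P2 -[LHS]mul1r -(cs t); ring.
have rot2 t : p2 t = sin (Th t) * P1 t + cos (Th t) * P2 t.
  rewrite /P1 /P2 -[LHS]mul1r -(cs t); ring.
have {}aT : ac (fun t => p2 t / v t) (fun t => cos (Th t) * (K t * v t) * (P1 0 / v 0) - sin (Th t) * (K t * v t) * (P2 0 / v 0)).
  apply: ac_eq aT; last first.
    by apply: contM => //; have := @gvXV_cont 1; under eq_fun do rewrite expr1.
  move=> t t01; have [E1 E2] := PE t t01.
  by rewrite rot2 E1 E2 /T; field; rewrite v00 gt_eqF// gv_gt0.
apply: ac_eqf aT => t t01; have [E1 E2] := PE t t01.
by rewrite rot1 E1 E2 /K clampE//; field.
Qed.

(** The two relations give [k^2 v = F x' + lam v], so the density is [F x' + 2 lam v], and [x']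
    integrates to [l]. *)
Lemma pp_energy F : ae01 (fun t => N t = - (F * cy g t / 2) * v t ^+ 3) ->
  (forall t, 0 <= t <= 1 -> F * p1 t = ((F * cy g t / 2) ^+ 2 - lam) * v t) ->
  Elam lam g = F * l + 2 * lam * Rint 0 1 v.
Proof.
move=> NF Fp; have [x0 _ x1 _] := pp_ends.
have V0 t : 0 <= t <= 1 -> 0 < p1 t ^+ 2 + p2 t ^+ 2 by move=> _; rewrite -spd_gt0 gv_gt0.
have Xi t : 0 <= t <= 1 -> cx g t = cx g 0 + Rint 0 t p1 by exact: W22_int.
have Yi t : 0 <= t <= 1 -> cy g t = cy g 0 + Rint 0 t p2 by exact: W22_int.
rewrite (Elam_spec lam (dc_ac Wx) (dc_ac Wy) Lh1 Lh2 Xi Yi V0).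
rewrite (@ae01_Rint _ _ (fun t => F * p1 t + 2 * lam * v t) 1 t1_in); last first.
- apply: ae01_imp NF => t t01 Nt.
  have v0 : v t != 0 by rewrite gt_eqF// gv_gt0.
  rewrite Fp// /dens Nt -[spd _ _]/(v t); field.
  by rewrite v0.
- apply: cont_meas; apply: contD; apply: contM => //; try exact: cont_cst.
  exact: gv_cont.
- by apply: intb_meas; apply: intb_dens.
rewrite RintD; [|by apply: intbZ; exact: intb_cont|by apply: intbZ; exact/intb_cont/gv_cont].
rewrite RintZ; last exact: intb_cont.
rewrite RintZ; last exact/intb_cont/gv_cont.
by congr (_ * _ + _); have := W22_int Wx t1_in; rewrite x0 x1 add0r.
Qed.

End Fixed.
End EulerLagrange.

(** * Converse: arclength curves in force balance are critical *)

Section ExplicitElastica.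
Variable R : realType.
Variables (lam l F L : R) (sigma : curve R) (T1 T2 : R -> R).
Local Notation X := (cx sigma).
Local Notation Y := (cy sigma).
Hypotheses (lam0 : 0 < lam) (L0 : 0 < L).
Hypothesis dX : forall s, is_derive s (1 : R) X (T1 s).
Hypothesis dY : forall s, is_derive s (1 : R) Y (T2 s).
Hypothesis dT1 : forall s, is_derive s (1 : R) T1 (F * Y s / 2 * T2 s).
Hypothesis dT2 : forall s, is_derive s (1 : R) T2 (- (F * Y s / 2) * T1 s).
Hypothesis T12 : forall s, T1 s ^+ 2 + T2 s ^+ 2 = 1.
Hypothesis FT1 : forall s, F * T1 s = (F * Y s / 2) ^+ 2 - lam.
Hypotheses (X0 : X 0 = 0) (Y0 : Y 0 = 0) (XL : X L = l) (YL : Y L = 0).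

Let g := unitrep sigma L.
Let K s := - (F * Y s / 2).
Let q1 t := L * T1 (L * t).
Let q2 t := L * T2 (L * t).
Let f1 t := L ^+ 2 * (- K (L * t) * T2 (L * t)).
Let f2 t := L ^+ 2 * (K (L * t) * T1 (L * t)).

Let dL (f f' : R -> R) t : (forall s, is_derive s (1 : R) f (f' s)) ->
  is_derive t (1 : R) (fun t => f (L * t)) (L * f' (L * t)).
Proof.
move=> df; have := @der_comp _ f (fun t => L * t) t _ _ (df (L * t)) (derZ L (der_id t)).
by move=> /der_eq; apply; ring.
Qed.

Let cL : continuous (fun t : R => L * t).
Proof. by apply: contM; [exact: cont_cst|exact: cont_id]. Qed.

Let cT1 : continuous (fun t => T1 (L * t)).
Proof. by apply: cont_comp => //; exact: der_cont dT1. Qed.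

Let cT2 : continuous (fun t => T2 (L * t)).
Proof. by apply: cont_comp => //; exact: der_cont dT2. Qed.

Let cK : continuous (fun t => K (L * t)).
Proof.
apply: contN; apply: contM; last exact: cont_cst.
apply: contM; first exact: cont_cst.
by apply: cont_comp => //; exact: der_cont dY.
Qed.

Let cf1 : continuous f1.
Proof. by apply: contM; [exact: cont_cst|apply: contM => //; exact: contN]. Qed.

Let cf2 : continuous f2.
Proof. by apply: contM; [exact: cont_cst|apply: contM]. Qed.

Let cq1 : continuous q1.
Proof. by apply: contM => //; exact: cont_cst. Qed.

Let cq2 : continuous q2.
Proof. by apply: contM => //; exact: cont_cst. Qed.

Let aq1 : ac q1 f1.
Proof.
apply: C1_ac => // t; have := derZ L (dL t dT1).
by move=> /der_eq; apply; rewrite /f1 /K; ring.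
Qed.

Let aq2 : ac q2 f2.
Proof.
apply: C1_ac => // t; have := derZ L (dL t dT2).
by move=> /der_eq; apply; rewrite /f2 /K; ring.
Qed.

Let gx t : 0 <= t <= 1 -> cx g t = cx g 0 + Rint 0 t q1.
Proof.
move=> /andP[t0 t1]; rewrite (FTC2 t0 cq1 (fun t => dL t dX)) /cx /g /unitrep.
by rewrite addrC subrK.
Qed.

Let gy t : 0 <= t <= 1 -> cy g t = cy g 0 + Rint 0 t q2.
Proof.
move=> /andP[t0 t1]; rewrite (FTC2 t0 cq2 (fun t => dL t dY)) /cy /g /unitrep.
by rewrite addrC subrK.
Qed.

Let qsq t : q1 t ^+ 2 + q2 t ^+ 2 = L ^+ 2.
Proof. by rewrite /q1 /q2 !exprMn -mulrDr T12 mulr1. Qed.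

Let spdq t : spd (q1 t) (q2 t) = L.
Proof. by rewrite /spd qsq sqrtr_sqr gtr0_norm. Qed.

Let numeq t : nume (q1 t) (q2 t) (f1 t) (f2 t) = L ^+ 3 * K (L * t).
Proof.
rewrite /nume /q1 /q2 /f1 /f2 -[RHS]mulr1 -(T12 (L * t)); ring.
Qed.

Let V0 t : 0 <= t <= 1 -> 0 < q1 t ^+ 2 + q2 t ^+ 2.
Proof. by move=> _; rewrite qsq exprn_gt0. Qed.

Lemma explicit_energy : Elam lam g = F * l + 2 * lam * L.
Proof.
rewrite (Elam_spec lam aq1 aq2 (L2_cont cf1) (L2_cont cf2) gx gy V0).
have -> : Rint 0 1 (fun t => dens lam (q1 t) (q2 t) (f1 t) (f2 t)) =
    Rint 0 1 (fun t => F * q1 t + 2 * lam * L).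
  apply: eq_Rint => t _; rewrite /dens spdq numeq.
  have -> : F * q1 t = L * (F * T1 (L * t)) by rewrite /q1; ring.
  by rewrite FT1 /K; field; rewrite gt_eqF.
rewrite RintD; [|by apply: intbZ; exact: intb_cont|exact: cst_intb].
rewrite RintZ; last exact: intb_cont.
rewrite Rint_cst// subr0 mulr1; congr (_ * _ + _).
have := gx t1_in; rewrite /cx /g /unitrep mulr0 mulr1 -[(sigma 0).1]/(X 0) X0 -[(sigma L).1]/(X L) XL.
by rewrite add0r.
Qed.

(** With [(w1, w2)] the derivative of the test function, the first variation integrates the
    derivative of [A1 w1 + A2 w2], minus [F w1]. The boundary terms vanish since the curvature is
    zero where [Y] is, and [w1] has mean zero. *)
Lemma explicit_pp : pp_elastica lam l g.
Proof.
have [Wx Dx Ex] := W22_spec aq1 (L2_cont cf1) gx.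
have [Wy Dy Ey] := W22_spec aq2 (L2_cont cf2) gy.
have s0 t : 0 <= t <= 1 -> speed g t != 0.
  by move=> t01; rewrite speed_spd Dx// Dy// spdq gt_eqF.
split.
  split; first by split.
  split=> //; split.
    by rewrite /g /unitrep mulr0 [LHS]surjective_pairing -[(sigma 0).1]/(X 0) -[(sigma 0).2]/(Y 0) X0 Y0.
  by rewrite /g /unitrep mulr1 [LHS]surjective_pairing -[(sigma L).1]/(X L) -[(sigma L).2]/(Y L) XL YL.
move=> eta [[We1 We2] [e0 e1]].
have V := first_variation (ltW lam0) (conj Wx Wy) (conj We1 We2) s0.
apply: der_eq V _.
have [c1 c2] := (dc_cont We1, dc_cont We2).
have [k1 k2] := (d2_L2 We1, d2_L2 We2).
pose A1 t := - (2 * K (L * t) / L) * T2 (L * t).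
pose A2 t := (2 * K (L * t) / L) * T1 (L * t).
pose B1 t := (lam - 3 * K (L * t) ^+ 2) * T1 (L * t) + F.
pose B2 t := (lam - 3 * K (L * t) ^+ 2) * T2 (L * t).
have dK t : is_derive t (1 : R) (fun t => K (L * t)) (L * (- (F * T2 (L * t) / 2))).
  have := derN (derM (derM (der_cst F t) (dL t dY)) (der_cst (2^-1) t)).
  by move=> /der_eq; apply; ring.
have L00 : L != 0 by rewrite gt_eqF.
have cA1 : continuous A1.
  apply: contM => //; apply: contN; apply: contM; last exact: cont_cst.
  by apply: contM => //; exact: cont_cst.
have cA2 : continuous A2.
  apply: contM => //; apply: contM; last exact: cont_cst.
  by apply: contM => //; exact: cont_cst.
have cl : continuous (fun t => lam - 3 * K (L * t) ^+ 2).
  apply: contB; first exact: cont_cst.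
  by apply: contM; [exact: cont_cst|exact: cont_sqr].
have cB1 : continuous B1 by apply: contD; [exact: contM|exact: cont_cst].
have cB2 : continuous B2 by exact: contM.
have aA1 : ac A1 B1.
  apply: C1_ac => // t.
  have := derM (derN (derM (derZ 2 (dK t)) (der_cst (L^-1) t))) (dL t dT2).
  move=> /der_eq; apply.
  have K1 : T2 (L * t) ^+ 2 = 1 - T1 (L * t) ^+ 2 by rewrite -(T12 (L * t)); ring.
  have K2 : lam = K (L * t) ^+ 2 - F * T1 (L * t) by rewrite FT1 /K; ring.
  rewrite /B1 K2 /K.
  apply: (@etrans _ _ (F * T2 (L * t) ^+ 2 - 2 * (F * Y (L * t) / 2) ^+ 2 * T1 (L * t))).
    by field.
  by rewrite K1; field.
have aA2 : ac A2 B2.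
  apply: C1_ac => // t.
  have := derM (derM (derZ 2 (dK t)) (der_cst (L^-1) t)) (dL t dT1).
  move=> /der_eq; apply.
  have K2 : lam = K (L * t) ^+ 2 - F * T1 (L * t) by rewrite FT1 /K; ring.
  by rewrite /B2 K2 /K; field.
have P := ac_Rint (acD (acM aA1 (dc_ac We1)) (acM aA2 (dc_ac We2))).
have A10 : A1 0 = 0 by rewrite /A1 /K mulr0 Y0; ring.
have A11 : A1 1 = 0 by rewrite /A1 /K mulr1 YL; ring.
have A20 : A2 0 = 0 by rewrite /A2 /K mulr0 Y0; ring.
have A21 : A2 1 = 0 by rewrite /A2 /K mulr1 YL; ring.
rewrite A10 A11 A20 A21 !mul0r addr0 subrr in P.
have W1 : Rint 0 1 (dc (cx eta)) = 0.
  by have := W22_int We1 t1_in; rewrite /cx e0 e1/= add0r.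
have i1 : intb 0 1 (fun t => B1 t * dc (cx eta) t + A1 t * d2 (cx eta) t +
    (B2 t * dc (cy eta) t + A2 t * d2 (cy eta) t)).
  apply: intbD; apply: intbD; try (by apply: intb_cont; exact: contM).
    by apply: intbM_cont => //; exact: L2_intb.
  by apply: intbM_cont => //; exact: L2_intb.
have i2 : intb 0 1 (fun t => F * dc (cx eta) t) by apply: intbZ; exact: intb_cont.
have PF := RintB i1 i2; rewrite P RintZ ?W1 ?mulr0 ?subr0 in PF; last exact: intb_cont.
apply: etrans PF; apply: ae01_Rint; first exact: t1_in.
- apply: intb_meas; apply: intb_ddens => //; try exact: dc_cont; try exact: d2_L2.
  by move=> t t01; rewrite !dcE// Dx// Dy// V0.
- by apply: intb_meas; exact: intbB.
apply: ae01_imp (ae01_and Ex Ey) => t t01 [-> ->].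
rewrite !dcE// Dx// Dy// -!dcE// ddens_split ?spdq// numeq /B1 /B2 /A1 /A2 /q1 /q2 /f1 /f2.
by field.
Qed.

End ExplicitElastica.

(** * Monotonicity from derivatives; zeros of the cosine *)

Section Monotonicity.
Variable R : realType.
Implicit Types (f : R -> R) (a b x y : R).

Lemma mean_value f (f' : R -> R) a b : a < b -> (forall x, a <= x <= b -> is_derive x (1 : R) f (f' x)) ->
  exists c, a < c < b /\ f b - f a = f' c * (b - a).
Proof.
move=> ab df.
have [||c] := @MVT R f f' a b ab.
- by move=> x; rewrite in_itv/= => /andP[ax xb]; apply: df; rewrite !ltW.
- apply: continuous_in_subspaceT => x; rewrite inE/= in_itv/= => xab.
  by apply/differentiable_continuous/derivable1_diffP; case: (df x xab).
by rewrite in_itv/= => cab E; exists c.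
Qed.

Lemma incr_of_der f (f' : R -> R) a b : a < b -> (forall x, a <= x <= b -> is_derive x (1 : R) f (f' x)) ->
  (forall x, a < x < b -> 0 < f' x) -> f a < f b.
Proof.
move=> ab df f0; have [c [cab E]] := mean_value ab df.
by rewrite -subr_gt0 E mulr_gt0 ?f0// subr_gt0.
Qed.

Lemma decr_of_der f (f' : R -> R) a b : a < b -> (forall x, a <= x <= b -> is_derive x (1 : R) f (f' x)) ->
  (forall x, a < x < b -> f' x < 0) -> f b < f a.
Proof.
move=> ab df f0; have [c [cab E]] := mean_value ab df.
by rewrite -subr_lt0 E pmulr_llt0 ?f0// subr_gt0.
Qed.

Lemma cst_of_der0 f x y : (forall x, is_derive x (1 : R) f 0) -> f x = f y.
Proof. exact: is_derive_0_is_cst. Qed.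

Lemma cosDnpi0 (n : nat) x : (cos (x + n%:R * pi) == 0 :> R) = (cos x == 0).
Proof.
elim: n => [|n IH]; first by rewrite mul0r addr0.
by rewrite -[n.+1%:R]natr1 mulrDl mul1r addrA cosDpi oppr_eq0.
Qed.

(** Subtracting a multiple of [pi] brings [x] into the half-open interval from [- (pi / 2)] to
    [pi / 2], whose only zero is its left end. The multiple is at least one because [x] exceeds
    [- (pi / 2)]; hence the shift of [n] by one. *)
Lemma cos_eq0 x : - (pi / 2) < x -> cos x = 0 -> exists n : nat, x = pi / 2 + n%:R * pi.
Proof.
move=> xl c0.
have p0 : 0 < pi :> R := pi_gt0 R.
pose z := (x + pi / 2) / pi.
have z0 : 0 <= z by rewrite divr_ge0 ?(ltW p0)//; lra.
pose n := Num.truncn z.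
have /andP[nz zn] : n%:R <= z < n.+1%:R by have := truncn_itv z0.
rewrite ler_pdivlMr// in nz; rewrite ltr_pdivrMr// -[n.+1%:R]natr1 in zn.
pose y := x - n%:R * pi.
have y1 : - (pi / 2) <= y by rewrite /y; lra.
have y2 : y < pi / 2 by rewrite /y; lra.
have cy : cos y = 0.
  by apply/eqP; rewrite -(cosDnpi0 n) /y subrK c0.
have yE : y = - (pi / 2).
  apply/eqP; rewrite eq_le y1 andbT leNgt; apply/negP => y1'.
  have : 0 < cos y by apply: cos_gt0_pihalf; rewrite y1' y2.
  by rewrite cy ltxx.
case: n @y nz zn y1 y2 cy yE => [|n] y nz zn y1 y2 cy yE.
  by move: yE; rewrite /y mul0r; lra.
by exists n; move: yE; rewrite /y -[n.+1%:R]natr1; lra.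
Qed.

End Monotonicity.

(** * Elliptic integrals and the amplitude for a fixed modulus *)

Section EllipticFixedModulus.
Variable R : realType.
Variable q : R.
Hypothesis q01 : 0 <= q < 1.
Implicit Types (x u : R).

Definition Del (p x : R) : R := Num.sqrt (1 - p ^+ 2 * sin x ^+ 2).
Local Notation Dq := (Del q).

Lemma sin2_le1 x : 0 <= sin x ^+ 2 <= 1.
Proof. by rewrite sqr_ge0/=; have := cos2Dsin2 x; have := sqr_ge0 (cos x); lra. Qed.

Lemma Delarg_gt0 x : 0 < 1 - q ^+ 2 * sin x ^+ 2.
Proof.
have /andP[q0 q1] := q01; have /andP[s0 s1] := sin2_le1 x.
have : q ^+ 2 < 1 by rewrite expr_lt1.
have := sqr_ge0 q; nra.
Qed.

Lemma Del_gt0 x : 0 < Dq x.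
Proof. by rewrite sqrtr_gt0 Delarg_gt0. Qed.

Lemma Del_sqr x : Dq x ^+ 2 = 1 - q ^+ 2 * sin x ^+ 2.
Proof. by rewrite sqr_sqrtr// ltW// Delarg_gt0. Qed.

Lemma Del_neq0 x : Dq x != 0.
Proof. by rewrite gt_eqF// Del_gt0. Qed.

Lemma Del_le1 x : Dq x <= 1.
Proof.
rewrite -[leRHS]sqrtr1 /Del ler_wsqrtr// lerBlDr lerDl mulr_ge0 ?sqr_ge0//.
Qed.

Lemma der_Delarg x : is_derive x (1 : R) (fun x => 1 - q ^+ 2 * sin x ^+ 2) (- (2 * q ^+ 2 * sin x * cos x)).
Proof.
have ds : is_derive x (1 : R) (@sin R) (cos x) by exact: is_derive_sin.
have := derB (der_cst 1 x) (derZ (q ^+ 2) (derM ds ds)).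
move=> H; apply: der_ext (der_eq H _); [by move=> y; rewrite expr2|ring].
Qed.

Lemma der_Del x : is_derive x (1 : R) Dq (- (q ^+ 2 * sin x * cos x) / Dq x).
Proof.
apply: (der_eq (@der_sqrt _ (fun x => 1 - q ^+ 2 * sin x ^+ 2) _ _ (Delarg_gt0 x) (der_Delarg x))).
by rewrite -[Num.sqrt _]/(Dq x); field; exact: Del_neq0.
Qed.

Lemma Del_cont : continuous Dq.
Proof. exact: der_cont der_Del. Qed.

Lemma DelV_cont : continuous (fun x => 1 / Dq x).
Proof.
apply: contM; [exact: cont_cst|apply: cont_inv; [exact: Del_neq0|exact: Del_cont]].
Qed.

Lemma der_ellF x : is_derive x (1 : R) (fun x => ellF x q) (1 / Dq x).
Proof. exact: (is_derive_oint x DelV_cont). Qed.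

Lemma der_ellE x : is_derive x (1 : R) (fun x => ellE x q) (Dq x).
Proof. exact: (is_derive_oint x Del_cont). Qed.

Lemma ellF0 : ellF 0 q = 0.
Proof. by rewrite /ellF /oint lexx Rint_point. Qed.

Lemma ellE0 : ellE 0 q = 0.
Proof. by rewrite /ellE /oint lexx Rint_point. Qed.

Lemma ellF_incr x y : x < y -> ellF x q < ellF y q.
Proof.
move=> xy; apply: (@incr_of_der _ (fun x => ellF x q) _ _ _ xy (fun x _ => der_ellF x)) => z _.
by rewrite divr_gt0// Del_gt0.
Qed.

Lemma ellF_inj x y : ellF x q = ellF y q -> x = y.
Proof.
move=> E; case: (ltgtP x y) => // /ellF_incr; by rewrite E ltxx.
Qed.

Lemma ellF_cont : continuous (fun x => ellF x q).
Proof. exact: der_cont der_ellF. Qed.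

Lemma ellF_ge x y : x <= y -> y - x <= ellF y q - ellF x q.
Proof.
rewrite le_eqVlt => /predU1P[->|xy]; first by rewrite !subrr.
have [c [_ E]] := mean_value xy (fun x _ => der_ellF x).
by rewrite E ler_peMl ?subr_ge0 ?(ltW xy)// ler_pdivlMr ?Del_gt0// mul1r Del_le1.
Qed.

(** By [ellF_ge] the function grows at least as fast as the identity, so its values at [-|u|] and
    [|u|] enclose [u]. *)
Lemma ellF_surj u : exists x, ellF x q = u.
Proof.
have [c _ E] : exists2 c, c \in `[- `|u|, `|u|]%R & ellF c q = u.
  apply: (@IVT _ (fun x => ellF x q)); first by have := normr_ge0 u; lra.
    exact: continuous_subspaceT ellF_cont.
  have := @ellF_ge 0 `|u| (normr_ge0 u); rewrite ellF0.
  have := @ellF_ge (- `|u|) 0 ltac:(have := normr_ge0 u; lra); rewrite ellF0.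
  have := ler_norm u; have := ler_norm (- u); rewrite normrN => H1 H2 H3 H4.
  by rewrite ge_min le_max; apply/andP; split; apply/orP; [left|right]; lra.
by exists c.
Qed.

Lemma amK u : ellF (am u q) q = u.
Proof.
have [x Hx] := ellF_surj u.
exact: (@xgetPex _ 0 [set x | ellF x q = u] (ex_intro _ x Hx)).
Qed.

Lemma ellFK x : am (ellF x q) q = x.
Proof. by apply: ellF_inj; rewrite amK. Qed.

Lemma der_am u : is_derive u (1 : R) (fun u => am u q) (Dq (am u q)).
Proof.
have H := @is_derive_inverse R (fun x => ellF x q) (fun u => am u q) (1 / Dq (am u q)) (am u q).
have -> : Dq (am u q) = (1 / Dq (am u q))^-1 by rewrite div1r invrK.
rewrite -[X in is_derive X]amK; apply: H.
- by near=> x; exact: ellFK.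
- by near=> x; exact: ellF_cont.
- exact: der_ellF.
- by rewrite mul1r invr_neq0// Del_neq0.
Unshelve. all: by end_near. Qed.

Lemma ellF_odd x : ellF (- x) q = - ellF x q.
Proof.
have dd (y : R) : is_derive y (1 : R) (fun x => ellF (- x) q + ellF x q) 0.
  have dm := derN (der_id y).
  have := derD (@der_comp _ (fun x => ellF x q) (fun x => - x) y _ _ (der_ellF (- y)) dm) (der_ellF y).
  by move=> /der_eq; apply; rewrite /Del sinN sqrrN; ring.
have := cst_of_der0 x 0 dd; rewrite oppr0 ellF0 addr0 => /eqP.
by rewrite addr_eq0 => /eqP.
Qed.

Lemma ellE_odd x : ellE (- x) q = - ellE x q.
Proof.
have dd (y : R) : is_derive y (1 : R) (fun x => ellE (- x) q + ellE x q) 0.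
  have dm := derN (der_id y).
  have := derD (@der_comp _ (fun x => ellE x q) (fun x => - x) y _ _ (der_ellE (- y)) dm) (der_ellE y).
  by move=> /der_eq; apply; rewrite /Del sinN sqrrN; ring.
have := cst_of_der0 x 0 dd; rewrite oppr0 ellE0 addr0 => /eqP.
by rewrite addr_eq0 => /eqP.
Qed.

Lemma Del_pi x : Dq (x + pi) = Dq x.
Proof. by rewrite /Del sinDpi sqrrN. Qed.

Lemma ellF_pi x : ellF (x + pi) q = ellF x q + 2 * ellK q.
Proof.
have dd (y : R) : is_derive y (1 : R) (fun x => ellF (x + pi) q - ellF x q) 0.
  have dm := derD (der_id y) (der_cst pi y).
  have := derB (@der_comp _ (fun x => ellF x q) (fun x => x + pi) y _ _ (der_ellF (y + pi)) dm) (der_ellF y).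
  by move=> /der_eq; apply; rewrite Del_pi; ring.
have := cst_of_der0 x (- (pi / 2)) dd.
have -> : - (pi / 2) + pi = pi / 2 :> R by lra.
by rewrite ellF_odd /ellK; lra.
Qed.

Lemma ellE_pi x : ellE (x + pi) q = ellE x q + 2 * ellEc q.
Proof.
have dd (y : R) : is_derive y (1 : R) (fun x => ellE (x + pi) q - ellE x q) 0.
  have dm := derD (der_id y) (der_cst pi y).
  have := derB (@der_comp _ (fun x => ellE x q) (fun x => x + pi) y _ _ (der_ellE (y + pi)) dm) (der_ellE y).
  by move=> /der_eq; apply; rewrite Del_pi; ring.
have := cst_of_der0 x (- (pi / 2)) dd.
have -> : - (pi / 2) + pi = pi / 2 :> R by lra.
by rewrite ellE_odd /ellEc; lra.
Qed.

Lemma ellF_halfpi (n : nat) : ellF (pi / 2 + n%:R * pi) q = (2 * n%:R + 1) * ellK q.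
Proof.
elim: n => [|n IH]; first by rewrite mul0r addr0 mulr0 add0r mul1r.
have -> : pi / 2 + n.+1%:R * pi = pi / 2 + n%:R * pi + pi :> R by rewrite -[n.+1%:R]natr1; ring.
by rewrite ellF_pi IH -[n.+1%:R]natr1; ring.
Qed.

Lemma ellE_halfpi (n : nat) : ellE (pi / 2 + n%:R * pi) q = (2 * n%:R + 1) * ellEc q.
Proof.
elim: n => [|n IH]; first by rewrite mul0r addr0 mulr0 add0r mul1r.
have -> : pi / 2 + n.+1%:R * pi = pi / 2 + n%:R * pi + pi :> R by rewrite -[n.+1%:R]natr1; ring.
by rewrite ellE_pi IH -[n.+1%:R]natr1; ring.
Qed.

Lemma am_mK : am (- ellK q) q = - (pi / 2).
Proof. by rewrite /ellK -ellF_odd ellFK. Qed.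

Lemma ellK_gt0 : 0 < ellK q.
Proof. by rewrite -ellF0; apply: ellF_incr; rewrite divr_gt0// pi_gt0. Qed.

End EllipticFixedModulus.

(** * The family of wavelike elasticae *)

Section ReferenceCurve.
Variable R : realType.
Variables (q al sg : R).
Hypotheses (q0 : 0 < q) (q1 : q < 1) (al0 : 0 < al) (sg1 : sg ^+ 2 = 1).

(* The wavelike elastica of modulus [q] and scale [al]; [sg = 1] gives the family of [larc],
   [sg = -1] that of [loop]. *)
Definition wave : curve R := fun s =>
  (sg * (2 * ellE (am (al * s - ellK q) q) q + 2 * ellEc q - al * s) / al,
   2 * q * cn (al * s - ellK q) q / al).

Let q01 : 0 <= q < 1. Proof. by rewrite (ltW q0) q1. Qed.
Let a00 : al != 0. Proof. by rewrite gt_eqF. Qed.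
Let ph s := am (al * s - ellK q) q.
Definition waveT1 s := sg * (1 - 2 * q ^+ 2 * sin (am (al * s - ellK q) q) ^+ 2).
Definition waveT2 s := - 2 * q * sin (am (al * s - ellK q) q) * Del q (am (al * s - ellK q) q).
(** The force carried by the curve. [waveLam] divided by its modulus is [2 q^2 - 1], from which
    [classification] reads off [q]. *)
Definition waveF := sg * (2 * al ^+ 2).
Definition waveLam := 2 * al ^+ 2 * (2 * q ^+ 2 - 1).

Let dph s : is_derive s (1 : R) ph (al * Del q (ph s)).
Proof.
have dl := derB (derZ al (der_id s)) (der_cst (ellK q) s).
have := @der_comp _ (fun u => am u q) (fun s => al * s - ellK q) s _ _ (der_am q01 _) dl.
by move=> /der_eq; apply; rewrite -/(ph s); ring.
Qed.

Let dsin s : is_derive s (1 : R) (fun s => sin (ph s)) (cos (ph s) * (al * Del q (ph s))).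
Proof. by apply: (@der_comp _ (@sin R) ph) => //; exact: is_derive_sin. Qed.

Let dcos s : is_derive s (1 : R) (fun s => cos (ph s)) (- sin (ph s) * (al * Del q (ph s))).
Proof. by apply: (@der_comp _ (@cos R) ph) => //; exact: is_derive_cos. Qed.

Let D2 s : Del q (ph s) ^+ 2 = 1 - q ^+ 2 * sin (ph s) ^+ 2.
Proof. exact: Del_sqr. Qed.

Lemma der_waveX s : is_derive s (1 : R) (cx wave) (waveT1 s).
Proof.
have dE := @der_comp _ (fun x => ellE x q) ph s _ _ (der_ellE q01 _) (dph s).
have dl := derB (derD (derZ 2 dE) (der_cst (2 * ellEc q) s)) (derZ al (der_id s)).
have := derM (derZ sg dl) (der_cst al^-1 s).
move=> /der_eq; apply; rewrite /waveT1 -/(ph s).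
have E : q ^+ 2 * sin (ph s) ^+ 2 = 1 - Del q (ph s) ^+ 2 by rewrite D2; ring.
have -> : 2 * q ^+ 2 * sin (ph s) ^+ 2 = 2 * (q ^+ 2 * sin (ph s) ^+ 2) by ring.
by rewrite E; field.
Qed.

Lemma der_waveY s : is_derive s (1 : R) (cy wave) (waveT2 s).
Proof.
have := derM (derZ (2 * q) (dcos s)) (der_cst al^-1 s).
by move=> /der_eq; apply; rewrite /waveT2 -/(ph s); field.
Qed.

Lemma der_waveT1 s : is_derive s (1 : R) waveT1 (waveF * cy wave s / 2 * waveT2 s).
Proof.
have := derZ sg (derB (der_cst 1 s) (derZ (2 * q ^+ 2) (derM (dsin s) (dsin s)))).
move=> H; apply: der_ext (der_eq H _); first by move=> y; rewrite /waveT1 -/(ph y) expr2.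
rewrite /waveF /waveT2 /cy /wave /= /cn -/(ph s).
by field.
Qed.

Lemma der_waveT2 s : is_derive s (1 : R) waveT2 (- (waveF * cy wave s / 2) * waveT1 s).
Proof.
have dD := @der_comp _ (Del q) ph s _ _ (der_Del q01 _) (dph s).
have := derM (derZ (- 2 * q) (dsin s)) dD.
move=> /der_eq; apply.
rewrite /waveF /waveT1 /cy /wave /= /cn -/(ph s).
have D0 : Del q (ph s) != 0 by exact: Del_neq0.
apply: (@etrans _ _ (- 2 * q * al * cos (ph s) * (Del q (ph s) ^+ 2 - q ^+ 2 * sin (ph s) ^+ 2))).
  by field.
rewrite D2.
apply: (@etrans _ _ (- 2 * q * al * cos (ph s) * (1 - 2 * q ^+ 2 * sin (ph s) ^+ 2) * sg ^+ 2)).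
  by rewrite sg1; ring.
by field.
Qed.

Lemma wave_unit s : waveT1 s ^+ 2 + waveT2 s ^+ 2 = 1.
Proof.
rewrite /waveT1 /waveT2 -/(ph s) !exprMn sg1 D2; ring.
Qed.

Lemma wave_FT1 s : waveF * waveT1 s = (waveF * cy wave s / 2) ^+ 2 - waveLam.
Proof.
rewrite /waveF /waveT1 /waveLam /cy /wave /= /cn -/(ph s).
apply: (@etrans _ _ (sg ^+ 2 * (2 * al ^+ 2 * (1 - 2 * q ^+ 2 * sin (ph s) ^+ 2)))); first by ring.
apply: (@etrans _ _ (sg ^+ 2 * (4 * al ^+ 2 * q ^+ 2 * cos (ph s) ^+ 2) - 2 * al ^+ 2 * (2 * q ^+ 2 - 1))).
  by rewrite sg1 cos2sin2; ring.
by field.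
Qed.

Lemma waveX0 : cx wave 0 = 0.
Proof. by rewrite /cx /wave /= mulr0 sub0r am_mK// ellE_odd// -/(ellEc q); ring. Qed.

Lemma waveY0 : cy wave 0 = 0.
Proof. by rewrite /cy /wave /= /cn mulr0 sub0r am_mK// cosN cos_pihalf; ring. Qed.

Lemma wave_end (n : nat) : let L := 2 * n.+1%:R * ellK q / al in
  cx wave L = sg * 2 * n.+1%:R * (2 * ellEc q - ellK q) / al /\ cy wave L = 0.
Proof.
move=> L; rewrite /cx /cy /wave /= /cn.
have -> : al * L - ellK q = ellF (pi / 2 + n%:R * pi) q.
  by rewrite ellF_halfpi// /L -[n.+1%:R]natr1; field.
rewrite ellFK// ellE_halfpi//; split; last first.
  have /eqP -> : cos (pi / 2 + n%:R * pi) == 0 :> R by rewrite cosDnpi0 cos_pihalf.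
  by rewrite mulr0 mul0r.
by rewrite /L -[n.+1%:R]natr1; field.
Qed.

Lemma wave_T20 : 0 < waveT2 0.
Proof.
rewrite /waveT2 mulr0 sub0r am_mK// sinN sin_pihalf.
have -> : - 2 * q * -1 * Del q (- (pi / 2)) = 2 * q * Del q (- (pi / 2)) by ring.
by rewrite !mulr_gt0// Del_gt0.
Qed.

(** For [L > 0] the amplitude has passed its initial value [- (pi / 2)], so [cos_eq0] leaves
    positive odd multiples of [pi / 2], which [ellF_halfpi] turns into a whole number of
    half-periods. *)
Lemma wave_zero L : 0 < L -> cy wave L = 0 -> exists n : nat, L = 2 * n.+1%:R * ellK q / al.
Proof.
move=> L0; rewrite /cy /wave /= /cn => H.
have c0 : cos (ph L) = 0.
  have : 2 * q / al * cos (ph L) = 0 by rewrite -H -/(ph L); ring.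
  by move/eqP; rewrite mulf_eq0 gt_eqF ?divr_gt0 ?mulr_gt0//= => /eqP.
have pl : - (pi / 2) < ph L.
  rewrite ltNge; apply/negP => H2.
  have : ellF (ph L) q <= ellF (- (pi / 2)) q.
    by move: H2; rewrite le_eqVlt => /predU1P[->//|/(ellF_incr q01)/ltW].
  rewrite amK// ellF_odd// -/(ellK q).
  have : 0 < al * L by rewrite mulr_gt0.
  lra.
have [n E] := cos_eq0 pl c0; exists n.
have := amK q01 (al * L - ellK q); rewrite -/(ph L) E ellF_halfpi// => E2.
have {}E2 : al * L = 2 * n.+1%:R * ellK q by rewrite -[n.+1%:R]natr1; lra.
by rewrite -E2; field.
Qed.

End ReferenceCurve.

(** * Every nontrivial critical curve is a wave *)

Section Classification.
Variable R : realType.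

Lemma W22_ac (u : R -> R) : W22 u -> exists y : R -> R,
  (forall t, 0 <= t <= 1 -> y t = u t) /\ ac y (dc u).
Proof.
move=> Wu; exists (fun t => u 0 + Rint 0 (clamp t) (dc u)); split.
  by move=> t t01; rewrite (clampE t01); apply: esym; apply: W22_int.
by apply: ac_prim; apply: intb_cont; exact: dc_cont.
Qed.

(* Duffing's equation [y'' = lam y / 2 - F^2 y^3 / 8] as a system, after the change of
   parameter of speed [v]. *)
Lemma duffing_unique (lam F : R) (v y1 y2 t1 t2 : R -> R) : continuous v ->
  (forall t, 0 <= t <= 1 -> 0 <= v t) ->
  let Phi (y : R) := - (y / 2) * ((F * y / 2) ^+ 2 - lam) in
  ac y1 (fun t => v t * t1 t) -> ac t1 (fun t => v t * Phi (y1 t)) ->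
  ac y2 (fun t => v t * t2 t) -> ac t2 (fun t => v t * Phi (y2 t)) ->
  y1 0 = y2 0 -> t1 0 = t2 0 ->
  forall t, 0 <= t <= 1 -> y1 t = y2 t.
Proof.
move=> cv v0 Phi ay1 at1 ay2 at2 y0 t0.
have ad := acB ay1 ay2; have ae := acB at1 at2.
have [V [V0 bV]] := cont_bound 0 1 cv.
have [cy1 _ _] := ay1; have [cy2 _ _] := ay2.
(* The difference quotient of the cubic: [Phi y1 - Phi y2 = m (y1 - y2)]. The bounds on [m] and [v]
   give [Z' <= V (1 + M) Z] for the squared distance [Z] of the two solutions. *)
pose m t := lam / 2 - F ^+ 2 / 8 * (y1 t ^+ 2 + y1 t * y2 t + y2 t ^+ 2).
have cm : continuous m.
  apply: contB; first exact: cont_cst.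
  apply: contM; first exact: cont_cst.
  by apply: contD; [apply: contD; [exact: cont_sqr|exact: contM]|exact: cont_sqr].
have [M [M0 bM]] := cont_bound 0 1 cm.
have aZ := acD (acM ad ad) (acM ae ae).
have Z0 : (y1 0 - y2 0) * (y1 0 - y2 0) + (t1 0 - t2 0) * (t1 0 - t2 0) = 0.
  by rewrite y0 t0 !subrr; ring.
have H := gronwall (C := V * (1 + M)) aZ Z0.
move=> t t01; have {}H : (y1 t - y2 t) * (y1 t - y2 t) + (t1 t - t2 t) * (t1 t - t2 t) = 0.
  apply: H => // {t01} x x01.
    by rewrite -!expr2 addr_ge0// sqr_ge0.
  have -> : (v x * t1 x - v x * t2 x) * (y1 x - y2 x) + (y1 x - y2 x) * (v x * t1 x - v x * t2 x) +
    ((v x * Phi (y1 x) - v x * Phi (y2 x)) * (t1 x - t2 x) + (t1 x - t2 x) * (v x * Phi (y1 x) - v x * Phi (y2 x)))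
    = (v x * (1 + m x)) * (2 * ((y1 x - y2 x) * (t1 x - t2 x))).
    by rewrite /Phi /m; field.
  move: (y1 x - y2 x) (t1 x - t2 x) => a b.
  have vx := v0 x x01; have := bV x x01; rewrite ger0_norm// => vV.
  have := bM x x01; rewrite ler_norml => /andP[m1 m2].
  have h1 : v x * (1 + m x) <= V * (1 + M) by nra.
  have h2 : - (V * (1 + M)) <= v x * (1 + m x) by nra.
  move: (v x * (1 + m x)) (V * (1 + M)) h1 h2 => A B h1 h2.
  have := sqr_ge0 (a - b); have := sqr_ge0 (a + b); nra.
move: H; rewrite -!expr2 => /eqP; rewrite paddr_eq0 ?sqr_ge0// !sqrf_eq0 subr_eq0.
by move=> /andP[/eqP].
Qed.

(** [n.+1] counts the half-periods, [sg] distinguishes arcs from loops, [r] is the reflection, and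
    [s] is the arclength as a function of the given parameter. *)
Definition is_wave (lam l : R) (g : curve R) (n : nat) (q al sg r : R) : Prop :=
  [/\ 0 < al, sg = 1 \/ sg = -1, r = 1 \/ r = -1, 0 < q < 1 & 1 < 2 * q ^+ 2] /\
  [/\ lam = 2 * al ^+ 2 * (2 * q ^+ 2 - 1),
      l = sg * 2 * n.+1%:R * (2 * ellEc q - ellK q) / al,
      Elam lam g = sg * (2 * al ^+ 2) * l + 2 * lam * (2 * n.+1%:R * ellK q / al) &
      exists s : R -> R, [/\ s 0 = 0, s 1 = 2 * n.+1%:R * ellK q / al, continuous s,
        forall x y, x < y -> s x < s y &
        forall t, 0 <= t <= 1 ->
          g t = ((wave q al sg (s t)).1, r * (wave q al sg (s t)).2)]].

Lemma classification (lam l : R) (g : curve R) : 0 < lam -> 0 < l -> pp_elastica lam l g ->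
  ~ is_segment g -> exists n q al sg r, is_wave lam l g n q al sg r.
Proof.
move=> lam0 l0 ppg nseg.
have [F [NF Fp]] := pp_first_integral lam0 l0 ppg.
have aT := pp_tangent ppg NF.
have En := pp_energy ppg NF Fp.
have [x0 y0 x1 y1] := pp_ends ppg.
have [Wx Wy] := pp_W22 ppg.
have v0 t : 0 < gv g t by exact: (gv_gt0 ppg).
have cv : continuous (gv g) by exact: (gv_cont ppg).
have vsq t : gv g t ^+ 2 = dc (cx g) t ^+ 2 + dc (cy g) t ^+ 2 by exact: spd_sqr.
have [y [yE ay]] := W22_ac Wy.
have xE t : 0 <= t <= 1 -> cx g t = cx g 0 + Rint 0 t (dc (cx g)) by exact: W22_int.
clear NF Wx Wy.
move: (gv g) (dc (cx g)) (dc (cy g)) aT En Fp v0 cv vsq yE ay xE => v p1 p2 aT En Fp v0 cv vsq yE ay xE.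
have vn t : v t != 0 by rewrite gt_eqF.
have p12 t : (p1 t / v t) ^+ 2 + (p2 t / v t) ^+ 2 = 1.
  by rewrite !expr_div_n -mulrDl -vsq divff// expf_neq0.
have F0 : F != 0.
  apply/eqP => Fz; have := Fp 0 t0_in; rewrite Fz !mul0r expr0n/= sub0r.
  by move/esym/eqP; rewrite mulNr oppr_eq0 mulf_eq0 (gt_eqF lam0) (negbTE (vn 0)).
have T10 : F * (p1 0 / v 0) = - lam.
  by rewrite mulrA (Fp 0 t0_in) y0; field.
pose Phi (y : R) := - (y / 2) * ((F * y / 2) ^+ 2 - lam).
have {}ay : ac y (fun t => v t * (p2 t / v t)).
  by apply: ac_eqf ay => t _; rewrite mulrC divfK.
have {}aT : ac (fun t => p2 t / v t) (fun t => v t * Phi (y t)).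
  apply: ac_eqf aT => t t01; rewrite yE//.
  have -> : - (F * cy g t / 2) * p1 t = - (cy g t / 2) * (F * p1 t) by ring.
  by rewrite Fp// /Phi; ring.
have yy0 : y 0 = 0 by rewrite yE ?t0_in.
have vge t : 0 <= t <= 1 -> 0 <= v t by move=> _; exact: ltW.
(* With a horizontal initial tangent [y] would be the zero solution of the Duffing system, which is
   the segment. *)
have T20 : p2 0 / v 0 != 0.
  apply/eqP => T20; apply: nseg => t t01; rewrite -[(g t).2]/(cy g t) -yE//.
  have az : ac (fun=> 0 : R) (fun t => v t * (0 : R)).
    by apply: ac_eqf (ac_cst 0) => x _; rewrite mulr0.
  have az2 : ac (fun=> 0 : R) (fun t => v t * Phi 0).
    by apply: ac_eqf (ac_cst 0) => x _; rewrite /Phi mul0r oppr0 mul0r mulr0.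
  exact: (duffing_unique cv vge ay aT az az2 yy0 T20).
have [sg [sg1 Fs]] : exists sg : R, (sg = 1 \/ sg = -1) /\ F = sg * `|F|.
  by case: (ltrP F 0) => FF; [exists (-1); split; [right|rewrite ltr0_norm//; ring]|
    exists 1; split; [left|rewrite ger0_norm//; ring]].
have [r [r1 Tr]] : exists r : R, (r = 1 \/ r = -1) /\ p2 0 / v 0 = r * `|p2 0 / v 0|.
  by case: (ltrP (p2 0 / v 0) 0) => FF; [exists (-1); split; [right|rewrite ltr0_norm//; ring]|
    exists 1; split; [left|rewrite ger0_norm//; ring]].
have sg2 : sg ^+ 2 = 1 by case: sg1 => ->; ring.
have r2 : r ^+ 2 = 1 by case: r1 => ->; ring.
have aF0 : 0 < `|F| by rewrite normr_gt0.
(* The initial tangent is a unit vector with horizontal component [- lam / F] and nonzero vertical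
   component. *)
have lF : lam < `|F|.
  have E : (lam / F) ^+ 2 + (p2 0 / v 0) ^+ 2 = 1.
    rewrite -(p12 0); congr (_ + _); rewrite -[lam]opprK -T10; field.
    by rewrite vn F0.
  have : (lam / F) ^+ 2 < 1.
    by rewrite -E ltrDl lt_neqAle sqr_ge0 andbT eq_sym sqrf_eq0.
  have -> : (lam / F) ^+ 2 = (lam / `|F|) ^+ 2 by rewrite !expr_div_n real_normK ?num_real.
  by rewrite expr_lt1 ?divr_ge0 ?(ltW lam0)// ltr_pdivrMr// mul1r.
(* [al] and [q] solve [2 al^2 = |F|] and [2 q^2 - 1 = lam / |F|]; from [0 < lam < |F|] follow
   [1 < 2 q^2] and [q < 1]. *)
pose al := Num.sqrt (`|F| / 2).
pose q := Num.sqrt ((1 + lam / `|F|) / 2).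
have al0 : 0 < al by rewrite sqrtr_gt0 divr_gt0.
have al2 : al ^+ 2 = `|F| / 2 by rewrite sqr_sqrtr// divr_ge0.
have lF0 : 0 < lam / `|F| by rewrite divr_gt0.
have lF1 : lam / `|F| < 1 by rewrite ltr_pdivrMr// mul1r.
have q2E : q ^+ 2 = (1 + lam / `|F|) / 2 by rewrite sqr_sqrtr//; lra.
have q0 : 0 < q by rewrite sqrtr_gt0; lra.
have q1 : q < 1.
  by rewrite -[ltRHS]sqrtr1 ltr_sqrt//; lra.
have lamE : lam = 2 * al ^+ 2 * (2 * q ^+ 2 - 1).
  by rewrite al2 q2E; field; rewrite gt_eqF.
have FE : F = waveF al sg by rewrite /waveF al2 [LHS]Fs; field.
pose s t := oint 0 t v.
have ds t : is_derive t (1 : R) s (v t) by exact: is_derive_oint.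
have s0 : s 0 = 0 by rewrite /s /oint lexx Rint_point.
have sI t : 0 <= t -> s t = Rint 0 t v by move=> t0; rewrite /s /oint t0.
pose W := wave q al sg.
have aY : ac (fun t => r * cy W (s t)) (fun t => v t * (r * waveT2 q al (s t))).
  apply: C1_ac => [|t].
    apply: contM => //; apply: contM; first exact: cont_cst.
    by apply: cont_comp; [exact: der_cont (der_waveT2 q0 q1 al0 sg2)|exact: der_cont ds].
  have := derZ r (der_comp (der_waveY sg q0 q1 al0 (s t)) (ds t)).
  by move=> /der_eq; apply; ring.
have aT2 : ac (fun t => r * waveT2 q al (s t)) (fun t => v t * Phi (r * cy W (s t))).
  apply: C1_ac => [|t].
    have cY : continuous (fun t => cy W (s t)).
      by apply: cont_comp; [exact: der_cont (der_waveY sg q0 q1 al0)|exact: der_cont ds].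
    have crY : continuous (fun t => r * cy W (s t)) by apply: contM => //; exact: cont_cst.
    apply: contM => //; apply: contM.
      by apply: contN; apply: contM => //; exact: cont_cst.
    apply: contB; last exact: cont_cst.
    apply: cont_sqr; apply: contM; last exact: cont_cst.
    by apply: contM => //; exact: cont_cst.
  have := derZ r (der_comp (der_waveT2 q0 q1 al0 sg2 (s t)) (ds t)).
  move=> /der_eq; apply; rewrite /Phi -FE -/W.
  have := wave_FT1 q al0 sg2 (s t); rewrite -FE -/W /waveLam -lamE => E.
  have -> : (F * (r * cy W (s t)) / 2) ^+ 2 - lam = F * waveT1 q al sg (s t).
    rewrite E; congr (_ - _).
    have -> : (F * (r * cy W (s t)) / 2) ^+ 2 = r ^+ 2 * (F * cy W (s t) / 2) ^+ 2 by ring.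
    by rewrite r2 mul1r.
  by ring.
have Y0 : y 0 = r * cy W (s 0) by rewrite s0 yy0 waveY0// mulr0.
(* Both initial tangents are unit vectors with the same horizontal component, so the vertical ones
   agree up to sign, and [r] was chosen to absorb it. *)
have TT0 : p2 0 / v 0 = r * waveT2 q al (s 0).
  rewrite Tr s0; congr (_ * _).
  have W0 := wave_T20 al q0 q1.
  have := wave_unit al q0 q1 sg2 0; have := p12 0.
  have H1 : F * waveT1 q al sg 0 = - lam.
    have := wave_FT1 q al0 sg2 0; rewrite -FE waveY0// /waveLam -lamE => ->; ring.
  have -> : p1 0 / v 0 = waveT1 q al sg 0 by apply: (mulfI F0); rewrite T10 H1.
  move=> E1 E2; have /eqP : (p2 0 / v 0) ^+ 2 = waveT2 q al 0 ^+ 2.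
    by apply: (addrI (waveT1 q al sg 0 ^+ 2)); rewrite E1 E2.
  by rewrite eqf_sqr => /orP[] /eqP ->; rewrite ?normrN gtr0_norm.
have yW := duffing_unique cv vge ay aT aY aT2 Y0 TT0.
(* The abscissa needs no differential equation of its own: [F x'] is determined by [y] and the
   speed, and [F] is nonzero. *)
have xW t : 0 <= t <= 1 -> cx g t = cx W (s t).
  move=> t01; have /andP[t0 t1] := t01.
  rewrite (xE t t01) x0 add0r.
  have cd : continuous (fun t => v t * waveT1 q al sg (s t)).
    apply: contM => //.
    by apply: cont_comp; [exact: der_cont (der_waveT1 sg q0 q1 al0)|exact: der_cont ds].
  have -> : Rint 0 t (p1) = Rint 0 t (fun t => v t * waveT1 q al sg (s t)).
    apply: eq_Rint => z /andP[z0 zt].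
    have z01 : 0 <= z <= 1 by rewrite z0 (le_trans zt).
    apply: (mulfI F0); rewrite Fp// -yE// yW//.
    have := wave_FT1 q al0 sg2 (s z); rewrite -FE -/W /waveLam -lamE => E.
    have -> : F * (v z * waveT1 q al sg (s z)) = v z * (F * waveT1 q al sg (s z)) by ring.
    rewrite E.
    have -> : (F * (r * cy W (s z)) / 2) ^+ 2 = r ^+ 2 * (F * cy W (s z) / 2) ^+ 2 by ring.
    by rewrite r2; ring.
  have dW z : is_derive z (1 : R) (fun t => cx W (s t)) (v z * waveT1 q al sg (s z)).
    have := der_comp (der_waveX sg q0 q1 al0 (s z)) (ds z).
    by move=> /der_eq; apply; ring.
  by rewrite (FTC2 t0 cd dW) s0 waveX0// subr0.
have sincr a b : a < b -> s a < s b.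
  by move=> ab; apply: (incr_of_der ab (fun x _ => ds x)).
have S0 : 0 < s 1 by rewrite -s0; apply: sincr.
have YS : cy W (s 1) = 0.
  have := yW 1 t1_in; rewrite yE ?t1_in// y1 => /esym/eqP.
  rewrite mulf_eq0 => /orP[/eqP rz|/eqP//].
  by move: r2; rewrite rz expr0n/= => /eqP; rewrite eq_sym oner_eq0.
have [n sE] := wave_zero q0 q1 al0 S0 YS.
exists n, q, al, sg, r; split.
  split => //; first by rewrite q0 q1.
  by rewrite q2E; lra.
have [XE _] := wave_end sg q0 q1 al0 n; rewrite /= -sE -/W in XE.
split=> //.
- by rewrite -x1 (xW 1 t1_in) XE.
- by rewrite En -(sI 1 ler01) sE FE.
exists s; split=> //; first exact: der_cont ds.
move=> t t01; rewrite [LHS]surjective_pairing; congr (_, _).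
  exact: xW.
by rewrite -[(g t).2]/(cy g t) -yE// yW.
Qed.

Lemma wave_pp (lam l q al sg : R) : let L := 2 * ellK q / al in
  0 < q -> q < 1 -> 1 < 2 * q ^+ 2 -> 0 < al -> sg ^+ 2 = 1 ->
  lam = 2 * al ^+ 2 * (2 * q ^+ 2 - 1) -> l = sg * 2 * (2 * ellEc q - ellK q) / al ->
  [/\ pp_elastica lam l (unitrep (wave q al sg) L), ~ is_segment (unitrep (wave q al sg) L) &
      Elam lam (unitrep (wave q al sg) L) = sg * (2 * al ^+ 2) * l + 2 * lam * L].
Proof.
move=> L q0 q1 q2 al0 sg2 lamE lE.
have q01 : 0 <= q < 1 by rewrite (ltW q0).
have K0 := ellK_gt0 q01.
have L0 : 0 < L by rewrite divr_gt0// mulr_gt0.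
have lam0 : 0 < lam by rewrite lamE mulr_gt0 ?mulr_gt0 ?exprn_gt0// subr_gt0.
have [XL YL] := wave_end sg q0 q1 al0 0.
rewrite /= !mulr1 -/L -lE in XL YL.
have FT s : waveF al sg * waveT1 q al sg s = (waveF al sg * cy (wave q al sg) s / 2) ^+ 2 - lam.
  by rewrite (wave_FT1 q al0 sg2) /waveLam -lamE.
have dX := der_waveX sg q0 q1 al0; have dY := der_waveY sg q0 q1 al0.
have dT1 := der_waveT1 sg q0 q1 al0; have dT2 := der_waveT2 q0 q1 al0 sg2.
have U := wave_unit al q0 q1 sg2.
have X0 := waveX0 al sg q0 q1; have Y0 := waveY0 al sg q0 q1.
split.
- exact: (explicit_pp lam0 L0 dX dY dT1 dT2 U FT X0 Y0 XL YL).
(* Halfway along the curve the amplitude is zero and the height is [2 q / al]. *)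
- move=> /(_ (1 / 2)) seg; have {seg} : (unitrep (wave q al sg) L (1 / 2)).2 = 0.
    by apply: seg; apply/andP; split; lra.
  rewrite /unitrep /wave /= /cn.
  have -> : al * (L * (1 / 2)) - ellK q = ellF 0 q.
    by rewrite ellF0 /L; field; rewrite gt_eqF.
  rewrite ellFK// cos0 mulr1 => /eqP; rewrite gt_eqF//.
  by rewrite divr_gt0// mulr_gt0.
- by have := explicit_energy L0 dX dY dT1 dT2 U FT X0 XL; rewrite /waveF.
Qed.

End Classification.

(** * Complete elliptic integrals as functions of the modulus *)

Section EllipticModulus.
Variable R : realType.
Implicit Types (p q x : R).
Local Notation hp := (pi / 2 : R).

Lemma sin_le_id x : 0 <= x -> sin x <= x.
Proof.
rewrite le_eqVlt => /predU1P[<-|x0]; first by rewrite sin0.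
have dG y : 0 <= y <= x -> is_derive y (1 : R) (fun y => y - sin y) (1 - cos y).
  by move=> _; apply: derB.
have [c [_ E]] := mean_value x0 dG.
rewrite sin0 !subr0 in E.
by rewrite -subr_ge0 E mulr_ge0 ?subr_ge0 ?cos_le1// ltW.
Qed.

Lemma hp_gt0 : 0 < hp. Proof. by rewrite divr_gt0// pi_gt0. Qed.

Lemma ellKE q : ellK q = Rint 0 hp (fun x => 1 / Del q x).
Proof. by rewrite /ellK /ellF /oint ltW// hp_gt0. Qed.

Lemma ellEcE q : ellEc q = Rint 0 hp (Del q).
Proof. by rewrite /ellEc /ellE /oint ltW// hp_gt0. Qed.

Section Fixed.
Variable q : R.
Hypotheses (q0 : 0 < q) (q1 : q < 1).
Let q01 : 0 <= q < 1. Proof. by rewrite (ltW q0). Qed.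

Lemma DelVn_cont n : continuous (fun x => (Del q x ^+ n)^-1).
Proof.
apply: cont_inv; first by move=> x; rewrite expf_neq0// Del_neq0.
by apply: cont_exp; exact: Del_cont.
Qed.

Lemma sin_cont2 : continuous (fun x : R => sin x ^+ 2).
Proof. by apply: cont_sqr => x; exact: continuous_sin. Qed.

Definition ellJ : R := Rint 0 hp (fun x => (Del q x ^+ 3)^-1).

(** [q^2 sin cos / Del] vanishes at [0] and [pi / 2], and its derivative is
    [Del - (1 - q^2) / Del^3]. *)
Lemma ellJE : ellJ = ellEc q / (1 - q ^+ 2).
Proof.
have k0 : 1 - q ^+ 2 != 0.
  by rewrite gt_eqF// subr_gt0 expr_lt1// ltW.
have dG x : is_derive x (1 : R) (fun x => q ^+ 2 * (sin x * cos x) * (Del q x)^-1)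
    (Del q x - (1 - q ^+ 2) * (Del q x ^+ 3)^-1).
  have ds : is_derive x (1 : R) (@sin R) (cos x) by exact: is_derive_sin.
  have dc : is_derive x (1 : R) (@cos R) (- sin x) by exact: is_derive_cos.
  have D0 := Del_neq0 q01 x.
  have := derM (derZ (q ^+ 2) (derM ds dc)) (der_inv D0 (der_Del q01 x)).
  move=> /der_eq; apply.
  have -> : Del q x - (1 - q ^+ 2) / Del q x ^+ 3 = (Del q x ^+ 2 * Del q x ^+ 2 - (1 - q ^+ 2)) / Del q x ^+ 3.
    by field.
  have -> : q ^+ 2 * (cos x * cos x + sin x * - sin x) / Del q x +
     q ^+ 2 * (sin x * cos x) * (- (- (q ^+ 2 * sin x * cos x) / Del q x) / Del q x ^+ 2) =
     (q ^+ 2 * (cos x ^+ 2 - sin x ^+ 2) * Del q x ^+ 2 + q ^+ 4 * sin x ^+ 2 * cos x ^+ 2) / Del q x ^+ 3.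
    by field.
  congr (_ / _); rewrite Del_sqr// cos2sin2; ring.
have cG : continuous (fun x => Del q x - (1 - q ^+ 2) * (Del q x ^+ 3)^-1).
  apply: contB; first exact: Del_cont.
  by apply: contM; [exact: cont_cst|exact: DelVn_cont].
have := FTC2 (ltW hp_gt0) cG dG.
rewrite cos_pihalf sin0 mulr0 mul0r !(mulr0, mul0r) subrr.
rewrite RintB; [|exact/intb_cont/Del_cont|apply: intbZ; exact/intb_cont/DelVn_cont].
rewrite RintZ; last exact/intb_cont/DelVn_cont.
rewrite -ellEcE -/ellJ => /eqP; rewrite subr_eq0 => /eqP ->.
by field.
Qed.

(** Kept as an integral, like [dK], because the integrand shows the monotonicity in [q]; [dEcE] and
    [dKE] give the closed forms. The exponent 1 is written out so that the same estimates serve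
    both. *)
Definition dEc : R := Rint 0 hp (fun x => - q * (sin x ^+ 2 * (Del q x ^+ 1)^-1)).
Definition dK : R := Rint 0 hp (fun x => q * (sin x ^+ 2 * (Del q x ^+ 3)^-1)).

Let ci n : continuous (fun x => sin x ^+ 2 * (Del q x ^+ n)^-1).
Proof. by apply: contM; [exact: sin_cont2|exact: DelVn_cont]. Qed.

Let D1 : continuous (fun x => 1 / Del q x). Proof. exact: DelV_cont. Qed.

Lemma dEcE : dEc = (ellEc q - ellK q) / q.
Proof.
rewrite ellEcE ellKE -RintB; [|exact/intb_cont/Del_cont|exact: intb_cont].
rewrite /dEc [RHS]mulrC -RintZ; last by apply: intbB; [exact/intb_cont/Del_cont|exact: intb_cont].
apply: eq_Rint => x _; have D0 := Del_neq0 q01 x.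
have -> : q^-1 * (Del q x - 1 / Del q x) = q^-1 * (Del q x ^+ 2 - 1) / Del q x.
  by field; rewrite D0 gt_eqF.
by rewrite Del_sqr//; field; rewrite D0 gt_eqF.
Qed.

Lemma dKE : dK = (ellEc q / (1 - q ^+ 2) - ellK q) / q.
Proof.
rewrite -ellJE ellKE -RintB; [|exact/intb_cont/DelVn_cont|exact: intb_cont].
rewrite /dK [RHS]mulrC -RintZ; last by apply: intbB; [exact/intb_cont/DelVn_cont|exact: intb_cont].
apply: eq_Rint => x _; have D0 := Del_neq0 q01 x.
have -> : q^-1 * ((Del q x ^+ 3)^-1 - 1 / Del q x) = q^-1 * (1 - Del q x ^+ 2) / Del q x ^+ 3.
  by field; rewrite D0 gt_eqF.
by rewrite Del_sqr//; field; rewrite D0 gt_eqF.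
Qed.

Lemma dK_ge0 : 0 <= dK.
Proof.
apply: Rint_ge0 => x _; rewrite mulr_ge0 ?(ltW q0)// mulr_ge0 ?sqr_ge0//.
by rewrite invr_ge0 exprn_ge0// ltW// Del_gt0.
Qed.

Lemma ellEc_lt_ellK : ellEc q < ellK q.
Proof.
have := @decr_of_der R (fun x => ellE x q - ellF x q) (fun x => Del q x - 1 / Del q x) 0 hp hp_gt0.
rewrite ellE0 ellF0 subrr subr_lt0; apply.
  by move=> x _; apply: derB; [exact: der_ellE|exact: der_ellF].
move=> x x0hp; have s0 : 0 < sin x by exact: sin_gt0_pihalf.
have D0 := Del_gt0 q01 x.
rewrite subr_lt0 ltr_pdivlMr// -expr2 Del_sqr// ltrBlDr ltrDl.
by rewrite mulr_gt0// exprn_gt0.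
Qed.

Lemma dEc_lt0 : dEc < 0.
Proof. by rewrite dEcE pmulr_llt0 ?invr_gt0// subr_lt0 ellEc_lt_ellK. Qed.

(* Chebyshev's sum inequality: [2 sin^2 - 1] and [1 / Del] change in the same direction. *)
Lemma ellEc_le : ellEc q <= (1 - q ^+ 2 / 2) * ellK q.
Proof.
(* The value of [Del] where [sin^2 = 1 / 2]: there both factors of the Chebyshev product change
   sign, and the difference of the integrands is [(D0 - Del)^2 (D0 + Del) / (Del D0)]. *)
pose D0 := Num.sqrt (1 - q ^+ 2 / 2).
have q2 : q ^+ 2 < 1 by rewrite expr_lt1// ltW.
have D02 : D0 ^+ 2 = 1 - q ^+ 2 / 2 by rewrite sqr_sqrtr//; lra.
have D00 : 0 < D0 by rewrite sqrtr_gt0; lra.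
have dsc x : is_derive x (1 : R) (fun x => - (sin x * cos x)) (2 * sin x ^+ 2 - 1).
  have ds : is_derive x (1 : R) (@sin R) (cos x) by exact: is_derive_sin.
  have dc : is_derive x (1 : R) (@cos R) (- sin x) by exact: is_derive_cos.
  have := derN (derM ds dc) => /der_eq; apply.
  have := cos2Dsin2 x; lra.
have c2 : continuous (fun x : R => 2 * sin x ^+ 2 - 1).
  by apply: contB; [apply: contM; [exact: cont_cst|exact: sin_cont2]|exact: cont_cst].
have I0 : Rint 0 hp (fun x => 2 * sin x ^+ 2 - 1) = 0.
  by rewrite (FTC2 (ltW hp_gt0) c2 dsc) cos_pihalf sin0 mulr0 mul0r subrr.
have : Rint 0 hp (fun x => q ^+ 2 / 2 / D0 * (2 * sin x ^+ 2 - 1)) <=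
   Rint 0 hp (fun x => (1 - q ^+ 2 / 2) * (1 / Del q x) - Del q x).
  apply: le_Rint.
  - by apply: intbZ; exact: intb_cont.
  - by apply: intbB; [apply: intbZ; exact: intb_cont|exact/intb_cont/Del_cont].
  move=> x _; have Dx := Del_gt0 q01 x.
  have -> : (1 - q ^+ 2 / 2) * (1 / Del q x) - Del q x = (1 - q ^+ 2 / 2 - Del q x ^+ 2) / Del q x.
    by field; rewrite gt_eqF.
  rewrite -D02 -subr_ge0.
  have E : q ^+ 2 / 2 * (2 * sin x ^+ 2 - 1) = D0 ^+ 2 - Del q x ^+ 2.
    by rewrite D02 Del_sqr//; field.
  have -> : q ^+ 2 / 2 / D0 * (2 * sin x ^+ 2 - 1) = (D0 ^+ 2 - Del q x ^+ 2) / D0.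
    by rewrite -E; field; rewrite gt_eqF.
  have -> : (D0 ^+ 2 - Del q x ^+ 2) / Del q x - (D0 ^+ 2 - Del q x ^+ 2) / D0 =
     (D0 - Del q x) ^+ 2 * (D0 + Del q x) / (Del q x * D0).
    by field; rewrite !gt_eqF.
  apply: divr_ge0; last by rewrite mulr_ge0// ltW.
  by apply: mulr_ge0; [exact: sqr_ge0|rewrite addr_ge0// ltW].
rewrite RintZ; last exact: intb_cont.
rewrite I0 mulr0 RintB; [|by apply: intbZ; exact: intb_cont|exact/intb_cont/Del_cont].
by rewrite RintZ -?ellKE -?ellEcE ?subr_ge0//; exact: intb_cont.
Qed.

(* AM-GM applied to [2 E = int Del + (1 - q^2) / Del^3]. *)
Lemma ellEc_ge : Num.sqrt (1 - q ^+ 2) * ellK q <= ellEc q.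
Proof.
pose k := Num.sqrt (1 - q ^+ 2).
have q2 : q ^+ 2 < 1 by rewrite expr_lt1// ltW.
have k2 : k ^+ 2 = 1 - q ^+ 2 by rewrite sqr_sqrtr//; lra.
have JE : k ^+ 2 * ellJ = ellEc q.
  by rewrite ellJE k2; field; rewrite gt_eqF//; lra.
have : Rint 0 hp (fun x => 2 * k * (1 / Del q x)) <=
  Rint 0 hp (fun x => Del q x + k ^+ 2 * (Del q x ^+ 3)^-1).
  apply: le_Rint.
  - by apply: intbZ; exact: intb_cont.
  - by apply: intbD; [exact/intb_cont/Del_cont|apply: intbZ; exact/intb_cont/DelVn_cont].
  move=> x _; have Dx := Del_gt0 q01 x; rewrite -subr_ge0.
  have -> : Del q x + k ^+ 2 / Del q x ^+ 3 - 2 * k * (1 / Del q x) = (Del q x ^+ 2 - k) ^+ 2 / Del q x ^+ 3.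
    by field; rewrite gt_eqF.
  by rewrite divr_ge0 ?sqr_ge0// exprn_ge0// ltW.
rewrite RintZ; last exact: intb_cont.
rewrite -ellKE RintD; [|exact/intb_cont/Del_cont|apply: intbZ; exact/intb_cont/DelVn_cont].
rewrite RintZ; last exact/intb_cont/DelVn_cont.
rewrite -/ellJ JE -ellEcE -/k; lra.
Qed.

Lemma ellEc_gt : (1 - q ^+ 2) * ellK q < ellEc q.
Proof.
apply: lt_le_trans ellEc_ge.
have q2 : q ^+ 2 < 1 by rewrite expr_lt1// ltW.
have q20 : 0 < q ^+ 2 by rewrite exprn_gt0.
rewrite ltr_pM2r ?ellK_gt0//.
set k := Num.sqrt _; have k0 : 0 < k by rewrite sqrtr_gt0; lra.
have k2 : k ^+ 2 = 1 - q ^+ 2 by rewrite sqr_sqrtr//; lra.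
rewrite -k2 expr2 -[ltRHS]mulr1 ltr_pM2l//.
by rewrite -[ltRHS]sqrtr1 ltr_sqrt//; lra.
Qed.

Lemma ellEc_le_hp : ellEc q <= hp.
Proof.
rewrite ellEcE -[leRHS]subr0 -[leRHS]mul1r -Rint_cst ?(ltW hp_gt0)//.
apply: le_Rint; [exact/intb_cont/Del_cont|by apply: intb_cont; exact: cont_cst|].
by move=> x _; exact: Del_le1.
Qed.

(* [Del^2 = cos^2 + k^2 sin^2 <= (pi/2 - x + k)^2], with [k^2 = 1 - q^2]. *)
Lemma ellK_ge_ln : - ln (Num.sqrt (1 - q ^+ 2)) <= ellK q.
Proof.
set k := Num.sqrt _.
have q2 : q ^+ 2 < 1 by rewrite expr_lt1// ltW.
have k0 : 0 < k by rewrite sqrtr_gt0; lra.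
have k2 : k ^+ 2 = 1 - q ^+ 2 by rewrite sqr_sqrtr//; lra.
have hp1 : 1 <= hp := pihalf_ge1 R.
have dG x : 0 <= x <= hp -> is_derive x (1 : R) (fun x => ellF x q + ln (hp - x + k))
    (1 / Del q x + (hp - x + k)^-1 * (0 - 1 + 0)).
  move=> /andP[x0 xh]; apply: derD; first exact: der_ellF.
  have p0 : 0 < hp - x + k by lra.
  have := @der_comp _ (@ln R) (fun x => hp - x + k) x _ _ (is_derive1_ln p0)
    (derD (derB (der_cst hp x) (der_id x)) (der_cst k x)).
  by [].
have [c [/andP[c0 ch] E]] := mean_value hp_gt0 dG.
have D0 := Del_gt0 q01 c.
have : 0 <= 1 / Del q c + (hp - c + k)^-1 * (0 - 1 + 0).
  have p0 : 0 < hp - c + k by lra.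
  have -> : 1 / Del q c + (hp - c + k)^-1 * (0 - 1 + 0) = (Del q c)^-1 - (hp - c + k)^-1 by ring.
  rewrite subr_ge0 lef_pV2 ?posrE//.
  rewrite -[leRHS]gtr0_norm// -sqrtr_sqr ler_wsqrtr//.
  have cs : cos c <= hp - c.
    have -> : cos c = sin (hp - c) by rewrite -[RHS]opprK -sinN opprB sinBpihalf opprK.
    by apply: sin_le_id; lra.
  have cc : 0 <= cos c by apply: cos_ge0_pihalf; apply/andP; split; lra.
  have -> : 1 - q ^+ 2 * sin c ^+ 2 = cos c ^+ 2 + k ^+ 2 * sin c ^+ 2.
    by rewrite k2 cos2sin2; ring.
  have /andP[s0 s1] := sin2_le1 c.
  have : cos c ^+ 2 <= (hp - c) ^+ 2 by rewrite ler_sqr ?nnegrE//; lra.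
  have := sqr_ge0 k; move: (sin c ^+ 2) (cos c ^+ 2) s0 s1 => S C s0 s1 kk H.
  have : k ^+ 2 * S <= k ^+ 2 by rewrite ler_piMr.
  have : 0 <= 2 * ((hp - c) * k) by rewrite !mulr_ge0//; lra.
  nra.
move=> H; have : 0 <= ellF hp q + ln (hp - hp + k) - (ellF 0 q + ln (hp - 0 + k)).
  by rewrite E mulr_ge0// subr0 ltW// hp_gt0.
have : 0 <= ln (hp - 0 + k) by apply: ln_ge0; lra.
rewrite ellF0 subrr -[ellF hp q]/(ellK q) !add0r; lra.
Qed.

Lemma Del_ge (d x : R) : q <= d -> d < 1 -> Num.sqrt (1 - d ^+ 2) <= Del q x.
Proof.
move=> qd d1; rewrite ler_wsqrtr//.
have /andP[s0 s1] := sin2_le1 x.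
have : q ^+ 2 <= d ^+ 2 by rewrite !expr2 ler_pM// ltW.
have := sqr_ge0 q; nra.
Qed.

Lemma sin2_Del_bound n (d x : R) : q <= d -> d < 1 ->
  `|q * (sin x ^+ 2 * (Del q x ^+ n)^-1)| <= 1 / Num.sqrt (1 - d ^+ 2) ^+ n.
Proof.
move=> qd d1; have D0 := Del_gt0 q01 x.
have k0 : 0 < Num.sqrt (1 - d ^+ 2).
  have d0 : 0 <= d by rewrite (le_trans (ltW q0)).
  by rewrite sqrtr_gt0 subr_gt0 expr_lt1.
have /andP[s0 s1] := sin2_le1 x.
rewrite ger0_norm; last by rewrite mulr_ge0 ?(ltW q0)// mulr_ge0// invr_ge0 exprn_ge0// ltW.
rewrite mulrA; apply: ler_pM.
- by apply: mulr_ge0; [exact: ltW|exact: sqr_ge0].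
- by rewrite invr_ge0 exprn_ge0// ltW.
- by rewrite mulr_ile1// ltW.
rewrite lef_pV2 ?posrE ?exprn_gt0//.
by apply: lerXn2r; [rewrite nnegrE ltW|rewrite nnegrE ltW|exact: Del_ge].
Qed.

Lemma der_Del_modulus x : is_derive q (1 : R) (fun p => Del p x) (- q * (sin x ^+ 2 * (Del q x ^+ 1)^-1)).
Proof.
have dg : is_derive q (1 : R) (fun p => 1 - p ^+ 2 * sin x ^+ 2) (- (2 * q * sin x ^+ 2)).
  have := derB (der_cst 1 q) (derM (derM (der_id q) (der_id q)) (der_cst (sin x ^+ 2) q)).
  by move=> H; apply: der_ext (der_eq H _); [move=> y; rewrite expr2|ring].
apply: (der_eq (@der_sqrt _ (fun p => 1 - p ^+ 2 * sin x ^+ 2) _ _ (Delarg_gt0 q01 x) dg)).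
by rewrite -[Num.sqrt _]/(Del q x) expr1; field; exact: Del_neq0.
Qed.

End Fixed.

Lemma der_ellEc q : 0 < q -> q < 1 -> is_derive q (1 : R) (@ellEc R) (dEc q).
Proof.
move=> q0 q1.
have H : is_derive q (1 : R) (fun p => Rint 0 hp (Del p)) (dEc q).
  (* A bound strictly between [q] and [1] keeps [Del] away from zero uniformly for all moduli below
     it. *)
  pose d := (1 + q) / 2.
  have [d1 qd] : d < 1 /\ q < d by rewrite /d; split; lra.
  have d0 : 0 < d by lra.
  pose k := Num.sqrt (1 - d ^+ 2).
  have d2 : d ^+ 2 < 1 by rewrite expr_lt1// ltW.
  have k0 : 0 < k by rewrite sqrtr_gt0; lra.
  apply: (@derive_Rint R (@Del R) (fun q x => - q * (sin x ^+ 2 * (Del q x ^+ 1)^-1)) 0 hp 0 d q (fun=> 1 / k ^+ 1)).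
  - by rewrite q0.
  - move=> e /andP[e0 ed]; apply/intb_cont/Del_cont; rewrite (ltW e0)/=; lra.
  - by move=> e x /andP[e0 ed] _; apply: der_Del_modulus => //; lra.
  - by apply: intb_cont; exact: cont_cst.
  - move=> e x /andP[e0 ed] _; rewrite mulNr normrN.
    by apply: sin2_Del_bound => //; [lra|exact: ltW].
by apply: der_ext H => p; rewrite ellEcE.
Qed.

Lemma der_ellK q : 0 < q -> q < 1 -> is_derive q (1 : R) (@ellK R) (dK q).
Proof.
move=> q0 q1.
have H : is_derive q (1 : R) (fun p => Rint 0 hp (fun x => 1 / Del p x)) (dK q).
  pose d := (1 + q) / 2.
  have [d1 qd] : d < 1 /\ q < d by rewrite /d; split; lra.
  have d0 : 0 < d by lra.
  pose k := Num.sqrt (1 - d ^+ 2).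
  have d2 : d ^+ 2 < 1 by rewrite expr_lt1// ltW.
  have k0 : 0 < k by rewrite sqrtr_gt0; lra.
  apply: (@derive_Rint R (fun p x => 1 / Del p x) (fun q x => q * (sin x ^+ 2 * (Del q x ^+ 3)^-1)) 0 hp 0 d q (fun=> 1 / k ^+ 3)).
  - by rewrite q0.
  - move=> e /andP[e0 ed]; apply/intb_cont/DelV_cont; rewrite (ltW e0)/=; lra.
  - move=> e x /andP[e0 ed] _.
    have e1 : e < 1 by lra.
    have e01 : 0 <= e < 1 by rewrite ltW.
    have D0 := Del_neq0 e01 x.
    have := derM (der_cst 1 e) (@der_inv _ (fun p => Del p x) _ _ D0 (der_Del_modulus e0 e1 x)).
    by move=> /der_eq; apply; field.
  - by apply: intb_cont; exact: cont_cst.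
  - move=> e x /andP[e0 ed] _.
    by apply: sin2_Del_bound => //; [lra|exact: ltW].
by apply: der_ext H => p; rewrite ellKE.
Qed.

End EllipticModulus.

(** * Comparison of moduli: the functions [uu] and [hh] *)

Section ModulusComparison.
Variable R : realType.
Implicit Types (p q c x : R).

Lemma ivt_for (f : R -> R) (a b v : R) : a <= b -> (forall x, a <= x <= b -> {for x, continuous f}) ->
  Num.min (f a) (f b) <= v <= Num.max (f a) (f b) -> exists c, a <= c <= b /\ f c = v.
Proof.
move=> ab cf fv.
have [|c] := @IVT R f a b v ab _ fv.
  apply: continuous_in_subspaceT => x; rewrite inE/= in_itv/=; exact: cf.
by rewrite in_itv/= => cab E; exists c.
Qed.

Definition DD q : R := 2 * ellEc q - ellK q.
Definition dD q : R := 2 * dEc q - dK q.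
Definition WW q : R := 2 * q ^+ 2 - 1.
(* [fq] is [2 q^2 (1 - q^2) psi], and [psi] has the sign of the derivative of
   [uu], where [gq = 8 uu^2]. *)
Definition psi q : R := dD q * (q - (2 * q)^-1) + DD q.
Definition uu q : R := DD q * Num.sqrt (WW q).
Definition hh q : R := DD q / Num.sqrt (WW q) + 2 * ellK q * Num.sqrt (WW q).

Lemma der_DD q : 0 < q -> q < 1 -> is_derive q (1 : R) DD (dD q).
Proof. by move=> q0 q1; apply: derB; [apply: derZ; exact: der_ellEc|exact: der_ellK]. Qed.

Lemma is_derive_cont_at (f : R -> R) (a x : R) : is_derive x (1 : R) f a -> {for x, continuous f}.
Proof. by case=> df _; apply/differentiable_continuous/derivable1_diffP. Qed.

Lemma dD_lt0 q : 0 < q -> q < 1 -> dD q < 0.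
Proof. by move=> q0 q1; have := dEc_lt0 q0 q1; have := dK_ge0 q0 q1; rewrite /dD; lra. Qed.

Lemma modulus_mono n p q x : 0 < p -> p <= q -> q < 1 ->
  p * (sin x ^+ 2 * (Del p x ^+ n)^-1) <= q * (sin x ^+ 2 * (Del q x ^+ n)^-1).
Proof.
move=> p0 pq q1; have q0 := lt_le_trans p0 pq; have p1 := le_lt_trans pq q1.
have p01 : 0 <= p < 1 by rewrite ltW.
have q01 : 0 <= q < 1 by rewrite ltW.
have Dp := Del_gt0 p01 x; have Dq := Del_gt0 q01 x.
have s0 : 0 <= sin x ^+ 2 by exact: sqr_ge0.
have pn : 0 < Del p x ^+ n by rewrite exprn_gt0.
have qn : 0 < Del q x ^+ n by rewrite exprn_gt0.
apply: ler_pM => //; [exact: ltW|by rewrite mulr_ge0// invr_ge0 ltW|].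
apply: ler_wpM2l => //; rewrite lef_pV2 ?posrE//.
apply: lerXn2r; rewrite ?nnegrE; [exact: ltW|exact: ltW|].
rewrite ler_wsqrtr// lerB// ler_wpM2r// !expr2 ler_pM// ltW//.
Qed.

(** Read off pointwise under the integrals: both the factor [q] and the inverse powers of [Del] grow
    with the modulus. *)
Lemma dD_noninc p q : 0 < p -> p <= q -> q < 1 -> dD q <= dD p.
Proof.
move=> p0 pq q1; have q0 := lt_le_trans p0 pq; have p1 := le_lt_trans pq q1.
have ci n r : 0 < r -> r < 1 -> continuous (fun x => r * (sin x ^+ 2 * (Del r x ^+ n)^-1)).
  move=> r0 r1; apply: contM; first exact: cont_cst.
  by apply: contM; [exact: sin_cont2|exact: DelVn_cont].
have E : dEc q <= dEc p.
  apply: le_Rint.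
  - by apply: intb_cont; under eq_fun do rewrite mulNr; apply: contN; exact: ci.
  - by apply: intb_cont; under eq_fun do rewrite mulNr; apply: contN; exact: ci.
  - by move=> x _; rewrite !mulNr lerN2; exact: modulus_mono.
have K : dK p <= dK q.
  apply: le_Rint; [exact/intb_cont/ci|exact/intb_cont/ci|].
  by move=> x _; exact: modulus_mono.
by rewrite /dD; lra.
Qed.

Lemma DD_decr p q : 0 < p -> p < q -> q < 1 -> DD q < DD p.
Proof.
move=> p0 pq q1; apply: (@decr_of_der _ DD dD) => // x /andP[px xq].
  by apply: der_DD; lra.
by apply: dD_lt0; lra.
Qed.

(** [q^2 = 3 / 4] is where [sqrt (1 - q^2) = 1 / 2]; below it [ellEc_ge] yields [2 E > K]. The
    consequence [3 / 4 <= qs ^+ 2] enters the final comparison for loops. *)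
Lemma DD_gt0 q : 0 < q -> q ^+ 2 < 3 / 4 -> 0 < DD q.
Proof.
move=> q0 q2.
have q1 : q < 1 by rewrite -(@expr_lt1 _ 2)// ?ltW//; lra.
have q01 : 0 <= q < 1 by rewrite ltW.
have H := ellEc_ge q0 q1; have K0 := ellK_gt0 q01.
have k2 : (1 / 2 : R) < Num.sqrt (1 - q ^+ 2).
  have -> : (1 / 2 : R) = Num.sqrt ((1 / 2) ^+ 2) by rewrite sqrtr_sqr ger0_norm//; lra.
  by rewrite ltr_sqrt; rewrite expr2; lra.
have : 1 / 2 * ellK q < Num.sqrt (1 - q ^+ 2) * ellK q by rewrite ltr_pM2r.
by rewrite /DD; lra.
Qed.

Lemma ellK_large (M : R) : 0 <= M -> exists q, [/\ 0 < q, q < 1, 3 / 4 < q ^+ 2 & M <= ellK q].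
Proof.
(* The complementary modulus. [ellK_ge_ln] turns it into [K >= M + 2], and the margin 2 makes
   [k < 1 / 2], hence [3 / 4 < q^2]. *)
move=> M0; pose k := expR (- (M + 2)).
have k0 : 0 < k by exact: expR_gt0.
have k1 : k < 1 / 2.
  have H := @expR_ge1Dx R (M + 2).
  by rewrite /k expRN div1r ltf_pV2 ?posrE ?expR_gt0//; lra.
pose q := Num.sqrt (1 - k ^+ 2).
have k2 : k ^+ 2 < 1 / 4 by rewrite expr2; nra.
have q2 : q ^+ 2 = 1 - k ^+ 2 by rewrite sqr_sqrtr//; lra.
have kk : 0 < k ^+ 2 by rewrite exprn_gt0.
have q0 : 0 < q by rewrite sqrtr_gt0; lra.
have q1 : q < 1 by rewrite -[ltRHS]sqrtr1 ltr_sqrt//; lra.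
exists q; split=> //; first by rewrite q2; lra.
apply: le_trans (ellK_ge_ln q0 q1).
have -> : 1 - q ^+ 2 = k ^+ 2 by rewrite q2; ring.
by rewrite sqrtr_sqr gtr0_norm// expRK opprK; lra.
Qed.

Lemma DD_lower (M : R) : 0 <= M -> exists q, [/\ 0 < q, q < 1, 3 / 4 < q ^+ 2 & DD q <= - M].
Proof.
(* The surplus 4 pays for [2 E <= pi < 4]. *)
move=> M0; have [|q [q0 q1 q2 Kq]] := @ellK_large (M + 4); first by lra.
exists q; split=> //; have := ellEc_le_hp q0 q1; have := pihalf_lt2 R.
by rewrite /DD; lra.
Qed.

Lemma qstar_ex : exists q, 0 < q < 1 /\ 2 * ellEc q - ellK q = 0.
Proof.
have [//|q [q0 q1 q2 Dq]] := @DD_lower 1.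
have half : 0 < DD (1 / 2) by apply: DD_gt0; rewrite ?expr2; lra.
have hq : 1 / 2 < q.
  rewrite ltNge; apply/negP => qh.
  have : q ^+ 2 <= (1 / 2) ^+ 2 by rewrite !expr2 ler_pM// ltW.
  by rewrite [X in _ <= X]expr2; lra.
have [||c [/andP[c1 c2] E]] := @ivt_for DD (1 / 2) q 0 (ltW hq).
- move=> x /andP[x1 x2]; apply: is_derive_cont_at (der_DD _ _); lra.
- by rewrite ge_min le_max; apply/andP; split; apply/orP; [right|left]; lra.
exists c; split => //; apply/andP; split; lra.
Qed.

Local Notation qs := (qstar R).

Lemma qstarP : [/\ 0 < qs, qs < 1 & DD qs = 0].
Proof.
by have [/andP[s0 s1] Es] := @xgetPex _ 0 [set q | 0 < q < 1 /\ 2 * ellEc q - ellK q = 0] qstar_ex.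
Qed.

Lemma qstar_sqr : 3 / 4 <= qs ^+ 2.
Proof.
have [q0 _ D0] := qstarP; rewrite leNgt; apply/negP => /(DD_gt0 q0).
by rewrite D0 ltxx.
Qed.

Lemma DD_pos q : 0 < q -> q < qs -> 0 < DD q.
Proof. by move=> q0 qq; have [_ s1 <-] := qstarP; exact: DD_decr. Qed.

Lemma DD_neg q : qs < q -> q < 1 -> DD q < 0.
Proof. by move=> qq q1; have [s0 s1 <-] := qstarP; exact: DD_decr. Qed.

Lemma fq_psi q : 0 < q -> q < 1 -> fq q = 2 * q ^+ 2 * (1 - q ^+ 2) * psi q.
Proof.
move=> q0 q1; rewrite /fq /psi /dD /DD dEcE// dKE//.
have q2 : q ^+ 2 < 1 by rewrite expr_lt1// ltW.
by field; apply/andP; split; rewrite gt_eqF//; lra.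
Qed.

(** On this range [q - 1 / (2 q)] is nonnegative and nondecreasing while [dD] is negative and
    nonincreasing, so their product does not increase; [DD] decreases strictly. *)
Lemma psi_decr p q : 0 < p -> 1 <= 2 * p ^+ 2 -> p < q -> q < 1 -> psi q < psi p.
Proof.
move=> p0 p2 pq q1; have q0 := lt_trans p0 pq; have p1 := lt_trans pq q1.
have D := DD_decr p0 pq q1; have dn := dD_noninc p0 (ltW pq) q1.
have dp := dD_lt0 p0 p1.
have a0 : 0 <= p - (2 * p)^-1.
  have -> : p - (2 * p)^-1 = (2 * p ^+ 2 - 1) / (2 * p) by field; rewrite gt_eqF.
  by rewrite divr_ge0 ?subr_ge0// mulr_ge0// ltW.
have ab : p - (2 * p)^-1 <= q - (2 * q)^-1.
  apply: lerB; first exact: ltW.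
  by rewrite lef_pV2 ?posrE ?mulr_gt0// ler_pM2l// ltW.
rewrite /psi.
have : dD q * (q - (2 * q)^-1) <= dD p * (p - (2 * p)^-1).
  move: (p - _) (q - _) a0 ab => a b a0 ab; nra.
lra.
Qed.

Lemma isqrt2 q : 1 / Num.sqrt 2 <= q -> 0 < q /\ 1 <= 2 * q ^+ 2.
Proof.
have s0 : 0 < Num.sqrt 2 :> R by rewrite sqrtr_gt0.
have s2 : Num.sqrt 2 ^+ 2 = 2 :> R by rewrite sqr_sqrtr.
move=> H; have q0 : 0 < q by apply: lt_le_trans H; rewrite divr_gt0.
split=> //; move: H; rewrite ler_pdivrMr// => H.
have : 1 ^+ 2 <= (q * Num.sqrt 2) ^+ 2 by rewrite expr1n exprn_ege1.
by rewrite exprMn s2 expr1n; lra.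
Qed.

Lemma isqrt2_sqr : (1 / Num.sqrt 2) ^+ 2 = 1 / 2 :> R.
Proof. by rewrite expr_div_n sqr_sqrtr// expr1n. Qed.

Lemma fq_cont q : 0 < q -> q < 1 -> {for q, continuous (@fq R)}.
Proof.
move=> q0 q1.
have cK := is_derive_cont_at (der_ellK q0 q1).
have cE := is_derive_cont_at (der_ellEc q0 q1).
have c1 : continuous (fun q : R => 4 * q ^+ 4 - 5 * q ^+ 2 + 1).
  apply: contD; last exact: cont_cst.
  by apply: contB; apply: contM; try exact: cont_cst; apply: cont_exp; exact: cont_id.
have c2 : continuous (fun q : R => - 8 * q ^+ 4 + 8 * q ^+ 2 - 1).
  apply: contB; last exact: cont_cst.
  by apply: contD; apply: contM; try exact: cont_cst; apply: cont_exp; exact: cont_id.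
by apply: cvgD; apply: cvgM; [exact: c1|exact: cK|exact: c2|exact: cE].
Qed.

(** At [1 / sqrt 2] the factor of [dD] in [psi] is zero, leaving [DD > 0]; at [qs] it is [DD] that
    vanishes, leaving a negative product. *)
Lemma qhat_ex : exists q, 1 / Num.sqrt 2 <= q < 1 /\ fq q = 0 :> R.
Proof.
have [s0 s1 D0] := qstarP; have s2 := qstar_sqr.
set a : R := 1 / Num.sqrt 2.
have a0 : 0 < a by rewrite divr_gt0// sqrtr_gt0.
have a2 : a ^+ 2 = 1 / 2 := isqrt2_sqr.
have as' : a < qs.
  rewrite ltNge; apply/negP => sa.
  have : qs ^+ 2 <= a ^+ 2 by rewrite !expr2 ler_pM// ltW.
  by rewrite a2; lra.
have a1 : a < 1 by lra.
have pa : 0 < fq a.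
  have k0 : 1 - a ^+ 2 = 1 / 2 by rewrite a2; lra.
  have pp : 0 < psi a.
    rewrite /psi.
    have -> : a - (2 * a)^-1 = (2 * a ^+ 2 - 1) / (2 * a) by field; rewrite gt_eqF.
    by rewrite a2 (_ : 2 * (1 / 2) - 1 = 0) ?mul0r ?mulr0 ?add0r ?DD_pos//; lra.
  by rewrite fq_psi// k0 a2; lra.
have ps : fq qs < 0.
  have qq : qs ^+ 2 < 1 by rewrite expr_lt1// ltW.
  rewrite fq_psi// pmulr_rlt0; last by rewrite mulr_gt0//; lra.
  rewrite /psi D0 addr0 nmulr_rlt0 ?dD_lt0//.
  have -> : qs - (2 * qs)^-1 = (2 * qs ^+ 2 - 1) / (2 * qs) by field; rewrite gt_eqF.
  by rewrite divr_gt0 ?mulr_gt0//; lra.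
have [||c [/andP[c1 c2] E]] := @ivt_for (@fq R) a qs 0 (ltW as').
- by move=> x /andP[x1 x2]; apply: fq_cont; lra.
- by rewrite ge_min le_max; apply/andP; split; apply/orP; [right|left]; lra.
by exists c; split => //; apply/andP; split => //; lra.
Qed.

Local Notation qh := (qhat R).

(** The endpoint [1 / sqrt 2] is excluded since [psi = DD > 0] there. Elsewhere a zero of [psi] has
    [DD > 0], because [dD] is negative and its factor positive, so it lies before [qs]. *)
Lemma qhatP : [/\ 0 < qh, 1 < 2 * qh ^+ 2, qh < qs & psi qh = 0].
Proof.
have [s0 s1 D0] := qstarP; have s2 := qstar_sqr.
have [/andP[h0 h1] E] := @xgetPex _ 0 [set q | 1 / Num.sqrt 2 <= q < 1 /\ fq q = 0] qhat_ex.
rewrite -/qh in h0 h1 E.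
have [q0 q2] := isqrt2 h0.
have q21 : qh ^+ 2 < 1 by rewrite expr_lt1// ltW.
have P : psi qh = 0.
  move: E; rewrite fq_psi// => /eqP; rewrite mulf_eq0 => /orP[|/eqP//].
  by rewrite gt_eqF// mulr_gt0//; lra.
have Dh : 0 < DD qh -> qh < qs.
  by move=> D; rewrite ltNge; apply/negP; rewrite le_eqVlt => /predU1P[E2|/DD_neg/(_ h1)]; [move: D; rewrite -E2 D0 ltxx|lra].
have qE : qh - (2 * qh)^-1 = (2 * qh ^+ 2 - 1) / (2 * qh) by field; rewrite gt_eqF.
have dh := dD_lt0 q0 h1.
have [W0|Wn] := eqVneq (2 * qh ^+ 2) 1.
  have /DD_gt0 : qh ^+ 2 < 3 / 4 by lra.
  move=> /(_ q0) D; move: P; rewrite /psi qE W0 subrr mul0r mulr0 add0r => P.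
  by move: D; rewrite P ltxx.
have W1 : 1 < 2 * qh ^+ 2 by rewrite lt_neqAle eq_sym Wn.
split=> //; apply: Dh.
have : 0 < (2 * qh ^+ 2 - 1) / (2 * qh) by rewrite divr_gt0 ?subr_gt0// mulr_gt0.
by move: P; rewrite /psi qE; nra.
Qed.

Lemma qhat_lt1 : qh < 1.
Proof. by have [_ _ H _] := qhatP; have [_ H2 _] := qstarP; exact: lt_trans H H2. Qed.

Lemma psi_pos q : 0 < q -> 1 <= 2 * q ^+ 2 -> q < qh -> 0 < psi q.
Proof. by move=> q0 q2 qq; have [_ _ _ <-] := qhatP; apply: psi_decr => //; exact: qhat_lt1. Qed.

Lemma psi_neg q : qh < q -> q < 1 -> psi q < 0.
Proof. by move=> qq q1; have [h0 h2 _ <-] := qhatP; apply: psi_decr => //; exact: ltW. Qed.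

Definition reg q : Prop := [/\ 0 < q, q < 1 & 1 < 2 * q ^+ 2].

Lemma reg_up p q : reg p -> p <= q -> q < 1 -> reg q.
Proof.
move=> [p0 p1 p2] pq q1; split=> //; first exact: lt_le_trans pq.
have : p ^+ 2 <= q ^+ 2 by rewrite !expr2 ler_pM// ltW.
lra.
Qed.

Lemma reg_qhat : reg qh.
Proof. by have [h0 h2 _ _] := qhatP; split=> //; exact: qhat_lt1. Qed.

Lemma reg_qstar : reg qs.
Proof. by have [s0 s1 _] := qstarP; have := qstar_sqr; split=> //; lra. Qed.

Lemma WW_gt0 q : reg q -> 0 < WW q.
Proof. by move=> [_ _ H]; rewrite /WW subr_gt0. Qed.

Lemma sW_gt0 q : reg q -> 0 < Num.sqrt (WW q).
Proof. by move=> /WW_gt0; rewrite sqrtr_gt0. Qed.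

Lemma sW_sqr q : reg q -> Num.sqrt (WW q) ^+ 2 = WW q.
Proof. by move=> /WW_gt0 H; rewrite sqr_sqrtr// ltW. Qed.

Lemma WW_incr p q : reg p -> p < q -> WW p < WW q.
Proof.
move=> [p0 _ _] pq; have : p ^+ 2 < q ^+ 2 by rewrite ltrXn2r//; rewrite ?nnegrE ltW// (lt_trans p0).
by rewrite /WW; lra.
Qed.

Lemma der_sW q : reg q -> is_derive q (1 : R) (fun q => Num.sqrt (WW q)) (2 * q / Num.sqrt (WW q)).
Proof.
move=> rq; have W0 := WW_gt0 rq; have s0 := sW_gt0 rq.
have dW : is_derive q (1 : R) WW (4 * q).
  have := derB (derZ 2 (derM (der_id q) (der_id q))) (der_cst 1 q).
  by move=> H; apply: der_ext (der_eq H _); [move=> y; rewrite /WW expr2|ring].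
by apply: (der_eq (@der_sqrt _ WW _ _ W0 dW)); field; rewrite gt_eqF.
Qed.

Definition du q : R := 2 * q * psi q / Num.sqrt (WW q).

Lemma der_uu q : reg q -> is_derive q (1 : R) uu (du q).
Proof.
move=> rq; have [q0 q1 _] := rq; have s0 := sW_gt0 rq; have s2 := sW_sqr rq.
apply: (der_eq (derM (der_DD q0 q1) (der_sW rq))).
rewrite /du /psi.
have -> : 2 * q * (dD q * (q - (2 * q)^-1) + DD q) = dD q * WW q + 2 * q * DD q.
  by rewrite /WW; field; rewrite gt_eqF.
by move: (Num.sqrt (WW q)) s0 s2 => r r0 <-; field; rewrite gt_eqF.
Qed.

(** Amounts to [dD + dK W + 2 q K = 0], which follows from the closed forms [dEcE] and [dKE]. *)
Lemma der_hh q : reg q -> is_derive q (1 : R) hh (- du q / WW q).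
Proof.
move=> rq; have [q0 q1 _] := rq; have s0 := sW_gt0 rq; have s2 := sW_sqr rq.
have sn : Num.sqrt (WW q) != 0 by rewrite gt_eqF.
have ds := der_sW rq.
have di := @der_inv _ (fun q => Num.sqrt (WW q)) _ _ sn ds.
apply: (der_eq (derD (derM (der_DD q0 q1) di) (derM (derZ 2 (der_ellK q0 q1)) ds))).
have q2 : q ^+ 2 < 1 by rewrite expr_lt1// ltW.
have -> : du q = (dD q * WW q + 2 * q * DD q) / Num.sqrt (WW q).
  by rewrite /du /psi; congr (_ / _); rewrite /WW; field; rewrite gt_eqF.
have key : dD q + dK q * WW q + 2 * q * ellK q = 0.
  rewrite /dD /WW dEcE// dKE//; field.
  by apply/andP; split; rewrite gt_eqF//; lra.
have {}key : 2 * q * ellK q = - dD q - dK q * WW q by lra.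
move: (Num.sqrt (WW q)) s0 s2 key => r r0 <- key.
have -> : 2 * ellK q * (2 * q / r) = 2 * (2 * q * ellK q) / r by field; rewrite gt_eqF.
by rewrite key; field; rewrite gt_eqF.
Qed.

(** As a function of [uu], [hh] has slope [- 1 / W]; this is [hh] minus its tangent line at [c], up
    to a constant. *)
Definition Phi c q : R := hh q + uu q / WW c.

Lemma der_Phi c q : reg q -> is_derive q (1 : R) (Phi c) (du q * ((WW c)^-1 - (WW q)^-1)).
Proof.
move=> rq; apply: (der_eq (derD (der_hh rq) (derM (der_uu rq) (der_cst (WW c)^-1 q)))).
ring.
Qed.

Lemma du_pos q : reg q -> q < qh -> 0 < du q.
Proof.
move=> rq qq; have [q0 q1 q2] := rq; rewrite divr_gt0 ?sW_gt0//.
by rewrite mulr_gt0 ?mulr_gt0// psi_pos// ltW.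
Qed.

Lemma du_neg q : reg q -> qh < q -> du q < 0.
Proof.
move=> rq qq; have [q0 q1 q2] := rq.
by rewrite pmulr_llt0 ?invr_gt0 ?sW_gt0// pmulr_rlt0 ?mulr_gt0// psi_neg.
Qed.

Lemma WWV_lt p q : reg p -> p < q -> q < 1 -> (WW q)^-1 < (WW p)^-1.
Proof.
move=> rp pq q1; have rq := reg_up rp (ltW pq) q1.
by rewrite ltf_pV2 ?posrE ?WW_gt0// WW_incr.
Qed.

(* [hh' = - uu' / WW]: tangent-line comparison at [c], in the variable [uu]. *)
Lemma Phi_decr c p q : reg c -> qh <= c -> c <= p -> p < q -> q < 1 -> Phi c q < Phi c p.
Proof.
move=> rc hc cp pq q1.
apply: (@decr_of_der _ (Phi c) (fun q => du q * ((WW c)^-1 - (WW q)^-1))) => // x /andP[px xq].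
  by apply: der_Phi; apply: (reg_up rc); [exact: le_trans px|exact: le_lt_trans xq q1].
have x1 : x < 1 by exact: lt_trans xq q1.
have cx := le_lt_trans cp px.
have rx : reg x by apply: (reg_up rc) => //; exact: ltW.
rewrite nmulr_rlt0 ?subr_gt0; first exact: WWV_lt.
by apply: du_neg => //; exact: le_lt_trans cx.
Qed.

(** Across [qh] both [du] and [(WW qh)^-1 - (WW q)^-1] change sign, so [Phi qh] decreases on the
    left as well. This separates two moduli with equal [uu]. *)
Lemma Phi_qhat_left q : reg q -> q < qh -> Phi qh qh < Phi qh q.
Proof.
move=> rq qq.
apply: (@decr_of_der _ (Phi qh) (fun q => du q * ((WW qh)^-1 - (WW q)^-1))) => // x /andP[px xq].
  by apply: der_Phi; apply: (reg_up rq) => //; exact: le_lt_trans xq qhat_lt1.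
have x1 : x < 1 by exact: lt_trans xq qhat_lt1.
have rx : reg x by apply: (reg_up rq) => //; exact: ltW.
by rewrite pmulr_rlt0 ?du_pos// subr_lt0 WWV_lt// qhat_lt1.
Qed.

Lemma uu_incr p q : reg p -> p < q -> q <= qh -> uu p < uu q.
Proof.
move=> rp pq qq.
apply: (@incr_of_der _ uu du) => // x /andP[px xq].
  by apply: der_uu; apply: (reg_up rp) => //; apply: le_lt_trans xq (le_lt_trans qq qhat_lt1).
have xh := lt_le_trans xq qq.
by apply: du_pos => //; apply: (reg_up rp); [exact: ltW|exact: lt_trans xh qhat_lt1].
Qed.

Lemma uu_decr p q : qh <= p -> p < q -> q < 1 -> uu q < uu p.
Proof.
move=> hp pq q1.
apply: (@decr_of_der _ uu du) => // x /andP[px xq].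
  by apply: der_uu; apply: (reg_up reg_qhat); [exact: le_trans px|exact: le_lt_trans xq q1].
have hx := le_lt_trans hp px.
by apply: du_neg => //; apply: (reg_up reg_qhat); [exact: ltW|exact: lt_trans xq q1].
Qed.

Lemma hh_decr p q : reg p -> p < q -> q <= qh -> hh q < hh p.
Proof.
move=> rp pq qq.
apply: (@decr_of_der _ hh (fun q => - du q / WW q)) => // x /andP[px xq].
  by apply: der_hh; apply: (reg_up rp) => //; apply: le_lt_trans xq (le_lt_trans qq qhat_lt1).
have xh := lt_le_trans xq qq.
have rx : reg x by apply: (reg_up rp); [exact: ltW|exact: lt_trans xh qhat_lt1].
by rewrite pmulr_llt0 ?invr_gt0 ?WW_gt0// oppr_lt0 du_pos.
Qed.

Lemma hh_incr p q : qh <= p -> p < q -> q < 1 -> hh p < hh q.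
Proof.
move=> hp pq q1.
apply: (@incr_of_der _ hh (fun q => - du q / WW q)) => // x /andP[px xq].
  by apply: der_hh; apply: (reg_up reg_qhat); [exact: le_trans px|exact: le_lt_trans xq q1].
have hx := le_lt_trans hp px.
have rx : reg x by apply: (reg_up reg_qhat); [exact: ltW|exact: lt_trans xq q1].
by rewrite divr_gt0 ?WW_gt0// oppr_gt0 du_neg.
Qed.

Lemma uu_le_qhat q : reg q -> uu q <= uu qh.
Proof.
move=> rq; have [_ q1 _] := rq; case: (ltgtP q qh) => [qq|qq|->//].
- by apply: ltW; exact: uu_incr.
- by apply: ltW; exact: uu_decr.
Qed.

Lemma hh_ge_qhat q : reg q -> hh qh <= hh q.
Proof.
move=> rq; have [_ q1 _] := rq; case: (ltgtP q qh) => [qq|qq|->//].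
- by apply: ltW; exact: hh_decr.
- by apply: ltW; exact: hh_incr.
Qed.

Lemma hh_sub q : reg q -> hh q - uu q / WW q = 2 * ellK q * Num.sqrt (WW q).
Proof.
move=> rq; have s0 := sW_gt0 rq; have s2 := sW_sqr rq.
rewrite /hh /uu; move: (Num.sqrt (WW q)) s0 s2 => r r0 <-.
by field; rewrite gt_eqF.
Qed.

Lemma hh_sub_gt0 q : reg q -> uu q / WW q < hh q.
Proof.
move=> rq; have [q0 q1 _] := rq; rewrite -subr_gt0 hh_sub// mulr_gt0 ?sW_gt0//.
by rewrite mulr_gt0// ellK_gt0// ltW.
Qed.

(** Reduces to [(1 - q^2) K < E]. Together with [hh_sub_gt0] it says [hh > |uu| / W], which is what
    makes additional half-periods expensive. *)
Lemma hh_add_gt0 q : reg q -> - (uu q / WW q) < hh q.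
Proof.
move=> rq; have [q0 q1 _] := rq; rewrite -subr_gt0 opprK.
have -> : hh q + uu q / WW q = 4 * (ellEc q - (1 - q ^+ 2) * ellK q) / Num.sqrt (WW q).
  have s0 := sW_gt0 rq; have s2 := sW_sqr rq.
  have W : WW q = 2 * q ^+ 2 - 1 by [].
  rewrite /hh /uu /DD; move: (Num.sqrt (WW q)) s0 s2 => r r0 r2.
  have -> : 4 * (ellEc q - (1 - q ^+ 2) * ellK q) = 4 * ellEc q - 2 * ellK q + 2 * WW q * ellK q.
    by rewrite W; ring.
  by rewrite -r2; field; rewrite gt_eqF.
by rewrite divr_gt0 ?sW_gt0// mulr_gt0// subr_gt0 ellEc_gt.
Qed.

Lemma hh_gt0 q : reg q -> 0 < hh q.
Proof. by move=> rq; have := hh_sub_gt0 rq; have := hh_add_gt0 rq; lra. Qed.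

Lemma uu_qstar : uu qs = 0.
Proof. by have [_ _ D0] := qstarP; rewrite /uu D0 mul0r. Qed.

Lemma uu_neg_gt q : reg q -> uu q < 0 -> qs < q.
Proof.
move=> rq un; have [q0 _ _] := rq; rewrite ltNge; apply/negP => qq.
have : 0 <= DD q.
  by move: qq; rewrite le_eqVlt => /predU1P[->|/(DD_pos q0)/ltW//]; have [_ _ ->] := qstarP.
by move: un; rewrite /uu pmulr_llt0 ?sW_gt0//; lra.
Qed.

Lemma uu_qhat_gt0 : 0 < uu qh.
Proof. by have [h0 _ hs _] := qhatP; rewrite /uu mulr_gt0 ?DD_pos// sW_gt0//; exact: reg_qhat. Qed.

Lemma hh_qstar_lt : hh qs < hh qh + uu qh / WW qh.
Proof.
have [_ _ hs _] := qhatP; have [_ s1 _] := qstarP.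
have := Phi_decr reg_qhat (lexx _) (lexx _) hs s1.
by rewrite /Phi uu_qstar mul0r addr0.
Qed.

(** Competing loops lie beyond [qs], where [hh > hh qs > hh Q]. A single arc on the other branch of
    [uu] falls to [Phi_qhat_left]. For two or more arcs, [hh Q < hh qs < hh qh + uu qh / WW qh < 2
    hh qh], and [hh qh] is the least value of [hh]. *)
Lemma larc_compare (Q c0 : R) (n : nat) (q sg : R) : qh <= Q -> Q < qs -> uu Q = c0 -> 0 < c0 ->
  reg q -> sg = 1 \/ sg = -1 -> n.+1%:R * (sg * uu q) = c0 ->
  hh Q <= n.+1%:R * hh q /\ (hh Q = n.+1%:R * hh q -> [/\ n = 0, q = Q & sg = 1]).
Proof.
move=> hQ Qs uQ c00 rq sg1 E.
have [q0 q1 q2] := rq; have [_ s1 _] := qstarP; have Q1 := lt_trans Qs s1.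
suff [[-> -> ->]|H] : [/\ n = 0, q = Q & sg = 1] \/ hh Q < n.+1%:R * hh q.
- by rewrite mul1r.
- by split; [exact: ltW|move=> E2; move: H; rewrite -E2 ltxx].
have h0 := hh_gt0 rq.
have hQs : hh Q < hh qs by exact: hh_incr.
have n1 : (1 : R) <= n.+1%:R by rewrite ler1n.
case: sg1 => sgE; last first.
  right; have un : uu q < 0.
    by move: E; rewrite sgE mulN1r => E; rewrite -oppr_gt0 -(@pmulr_rgt0 _ n.+1%:R)// E.
  have qs_q := uu_neg_gt rq un.
  have [_ _ hs _] := qhatP.
  have : hh qs < hh q by apply: hh_incr => //; exact: ltW.
  have : hh q <= n.+1%:R * hh q by rewrite ler_peMl// ltW.
  lra.
rewrite sgE mul1r in E.
case: n E n1 => [|n] E n1.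
  rewrite mul1r in E *.
  have uE : uu q = uu Q by rewrite E uQ.
  case: (ltP q qh) => qq.
    right; have P1 := Phi_qhat_left rq qq.
    have : Phi qh Q <= Phi qh qh.
      move: hQ; rewrite le_eqVlt => /predU1P[<-//|hQ]; apply: ltW.
      by apply: Phi_decr => //; exact: reg_qhat.
    by move: P1; rewrite /Phi uE; lra.
  left; split=> //; case: (ltgtP q Q) => // H.
    by have := uu_decr qq H Q1; rewrite uE ltxx.
  by have := uu_decr hQ H q1; rewrite uE ltxx.
right; have h1 := hh_ge_qhat rq; have h2 := hh_qstar_lt.
have h3 := hh_sub_gt0 reg_qhat.
have n2 : (2 : R) <= n.+2%:R by rewrite (ler_nat _ 2).
have hh0 := hh_gt0 reg_qhat.
have : 2 * hh qh <= n.+2%:R * hh q.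
  by apply: ler_pM => //; exact: ltW.
lra.
Qed.

(** A single arc cannot reach [c0], as [uu] is at most [uu qh]. Several loops of modulus [q] are
    compared along the tangent line at [q], several arcs along the one at [qs], where [uu] is
    zero. *)
Lemma loop_compare (Q c0 : R) (n : nat) (q sg : R) : qs < Q -> Q < 1 -> - uu Q = c0 -> uu qh < c0 ->
  reg q -> sg = 1 \/ sg = -1 -> n.+1%:R * (sg * uu q) = c0 ->
  hh Q <= n.+1%:R * hh q /\ (hh Q = n.+1%:R * hh q -> [/\ n = 0, q = Q & sg = -1]).
Proof.
move=> sQ Q1 uQ c0h rq sg1 E.
have [q0 q1 q2] := rq; have [s0 s1 _] := qstarP; have [h00 h2 hs _] := qhatP.
have u0 := uu_qhat_gt0.
suff [[-> -> ->]|H] : [/\ n = 0, q = Q & sg = -1] \/ hh Q < n.+1%:R * hh q.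
- by rewrite mul1r.
- by split; [exact: ltW|move=> E2; move: H; rewrite -E2 ltxx].
have h0 := hh_gt0 rq.
have n0 : (0 : R) < n.+1%:R by rewrite ltr0n.
case: sg1 => sgE; last first.
  rewrite sgE mulN1r in E.
  have un : uu q < 0.
    by rewrite -oppr_gt0 -(@pmulr_rgt0 _ n.+1%:R)// E; lra.
  have sq := uu_neg_gt rq un.
  case: n E n0 => [|n] E n0.
    left; rewrite mul1r in E; have uE : uu q = uu Q by lra.
    split=> //; case: (ltgtP q Q) => // H.
      by have := uu_decr (ltW (lt_trans hs sq)) H Q1; rewrite uE ltxx.
    by have := uu_decr (ltW (lt_trans hs sQ)) H q1; rewrite uE ltxx.
  right.
  have n2 : (2 : R) <= n.+2%:R by rewrite (ler_nat _ 2).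
  have uE : uu Q = n.+2%:R * uu q by lra.
  have qQ : q < Q.
    rewrite ltNge; apply/negP => Qq; have : uu q <= uu Q.
      move: Qq; rewrite le_eqVlt => /predU1P[->//|H]; apply: ltW.
      by apply: uu_decr => //; exact: ltW (lt_trans hs sQ).
    by rewrite uE; nra.
  have P := Phi_decr rq (ltW (lt_trans hs sq)) (lexx _) qQ Q1.
  have A := hh_add_gt0 rq.
  move: P; rewrite /Phi uE -mulrA.
  move: (uu q / WW q) A => a A P.
  (* For [N] loops the tangent line gives [hh Q < hh q - (N - 1) a], and [- a < hh q] bounds this by
     [N hh q]. *)
  have : 0 <= (n.+2%:R - 1) * (hh q + a) by rewrite mulr_ge0//; lra.
  lra.
right; rewrite sgE mul1r in E.
have uq := uu_le_qhat rq.
case: n E n0 => [|n] E n0; first by rewrite mul1r in E; lra.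
have n2 : (2 : R) <= n.+2%:R by rewrite (ler_nat _ 2).
have rs := reg_qstar; have rh := reg_qhat.
have P := Phi_decr rs (ltW hs) (lexx _) sQ Q1.
rewrite /Phi uu_qstar mul0r addr0 -[uu Q]opprK uQ mulNr in P.
have Hs := hh_qstar_lt.
have Hq := hh_ge_qhat rq.
have Ws := WW_gt0 rs; have Wh := WW_gt0 rh.
(* The case of two arcs of the inequality [N b <= (N - 1) hh qh - a] below. It reduces to
   [DD qh <= K WW qs] with [K = ellK qh]: the left side is at most [K / 2] by [ellEc_le] and
   [qh^2 > 1 / 2], and [WW qs >= 1 / 2] by [qstar_sqr]. *)
have Ks : 2 * (uu qh / WW qs) <= hh qh - uu qh / WW qh.
  rewrite hh_sub// /uu.
  have sh := sW_gt0 rh.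
  have -> : 2 * (DD qh * Num.sqrt (WW qh) / WW qs) = (2 * Num.sqrt (WW qh)) * (DD qh / WW qs) by ring.
  have -> : 2 * ellK qh * Num.sqrt (WW qh) = (2 * Num.sqrt (WW qh)) * ellK qh by ring.
  rewrite ler_pM2l ?mulr_gt0// ler_pdivrMr//.
  have H1 := ellEc_le h00 qhat_lt1; have H2 := qstar_sqr.
  have K0 : 0 < ellK qh by rewrite ellK_gt0// (ltW h00) qhat_lt1.
  rewrite /DD /WW.
  have : (1 - qh ^+ 2 / 2) * ellK qh <= 3 / 4 * ellK qh by rewrite ler_pM2r//; lra.
  have : ellK qh * (1 / 2) <= ellK qh * (2 * qs ^+ 2 - 1) by rewrite ler_pM2l//; lra.
  lra.
have Ws_ge : uu qh / WW qs <= uu qh / WW qh.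
  by rewrite ler_pM2l// ltW// WWV_lt.
have cE : c0 / WW qs <= n.+2%:R * (uu qh / WW qs).
  by rewrite -E mulrA ler_pM2r ?invr_gt0// ler_pM2l.
have hE : n.+2%:R * hh qh <= n.+2%:R * hh q by rewrite ler_pM2l.
have b0 : 0 < uu qh / WW qs by rewrite divr_gt0.
move: (uu qh / WW qs) (uu qh / WW qh) (c0 / WW qs) Ks Ws_ge cE b0 P Hs => b a c Ks ab cE b0 P Hs.
have : 0 <= (n.+2%:R - 2) * (hh qh - b) by rewrite mulr_ge0//; lra.
move: (n.+2%:R) cE hE n2 {E n0} => N cE hE n2 H.
have : N * b <= (N - 1) * hh qh - a by lra.
lra.
Qed.

End ModulusComparison.

(** * From the scalar comparison to minimality and uniqueness *)

Section Minimality.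
Variable R : realType.
Implicit Types (lam l q al sg c : R) (g : curve R).
Local Notation qh := (qhat R).
Local Notation qs := (qstar R).

Lemma sign_sqr sg : sg = 1 \/ sg = -1 -> sg ^+ 2 = 1.
Proof. by case=> ->; ring. Qed.

(** Allows [al] to be eliminated from the end condition and from the energy, which leaves the
    modulus as the only continuous unknown. *)
Lemma wave_scale lam q al : reg q -> 0 < al -> lam = 2 * al ^+ 2 * (2 * q ^+ 2 - 1) ->
  Num.sqrt (lam / 2) = al * Num.sqrt (WW q).
Proof.
move=> rq al0 ->; have -> : 2 * al ^+ 2 * (2 * q ^+ 2 - 1) / 2 = al ^+ 2 * WW q by rewrite /WW; field.
by rewrite sqrtrM ?sqr_ge0// sqrtr_sqr gtr0_norm.
Qed.

Lemma wave_modulus lam l q al sg (N : R) : reg q -> 0 < al -> 0 < N ->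
  lam = 2 * al ^+ 2 * (2 * q ^+ 2 - 1) -> l = sg * 2 * N * (2 * ellEc q - ellK q) / al ->
  N * (sg * uu q) = Num.sqrt (lam / 2) * l / 2.
Proof.
move=> rq al0 N0 lamE ->; rewrite (wave_scale rq al0 lamE) /uu -/(DD q).
by field; rewrite gt_eqF.
Qed.

Lemma wave_energy lam l q al sg (N : R) : reg q -> 0 < al -> 0 < N -> sg ^+ 2 = 1 ->
  lam = 2 * al ^+ 2 * (2 * q ^+ 2 - 1) -> l = sg * 2 * N * (2 * ellEc q - ellK q) / al ->
  sg * (2 * al ^+ 2) * l + 2 * lam * (2 * N * ellK q / al) =
  4 * Num.sqrt (lam / 2) * (N * hh q).
Proof.
move=> rq al0 N0 sg2 lamE ->; rewrite (wave_scale rq al0 lamE).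
have s0 := sW_gt0 rq; have s2 := sW_sqr rq.
rewrite lamE /hh -/(DD q) -/(WW q); move: (Num.sqrt (WW q)) s0 s2 => r r0 <-.
apply: (@etrans _ _ (sg ^+ 2 * (4 * al * N * DD q) + 8 * al * r ^+ 2 * N * ellK q)).
  by field; rewrite gt_eqF.
by rewrite sg2; field; rewrite gt_eqF.
Qed.

(** After [classification], a competitor enters only through [n], [q'] and [sg'], subject to one
    scalar equation. In the case of equal energies these agree with the data of the wave, and the
    scale is recovered from [l * al]. *)
Lemma unique_min_wave lam l q al sg : 0 < lam -> 0 < l -> reg q -> 0 < al ->
  sg = 1 \/ sg = -1 -> lam = 2 * al ^+ 2 * (2 * q ^+ 2 - 1) ->
  l = sg * 2 * (2 * ellEc q - ellK q) / al ->
  (forall n q' sg', reg q' -> sg' = 1 \/ sg' = -1 -> n.+1%:R * (sg' * uu q') = sg * uu q ->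
    hh q <= n.+1%:R * hh q' /\ (hh q = n.+1%:R * hh q' -> [/\ n = 0, q' = q & sg' = sg])) ->
  unique_min_nontrivial lam l (wave q al sg) (2 * ellK q / al).
Proof.
move=> lam0 l0 rq al0 sg1 lamE lE cmp; have [q0 q1 q2] := rq.
have sg2 := sign_sqr sg1.
have [pp ns En] := wave_pp q0 q1 q2 al0 sg2 lamE lE.
have lE1 : l = sg * 2 * 1 * (2 * ellEc q - ellK q) / al by rewrite mulr1.
have M := wave_modulus rq al0 ltr01 lamE lE1.
have := wave_energy rq al0 ltr01 sg2 lamE lE1; rewrite !mulr1 mul1r => E1.
rewrite E1 in En; rewrite mul1r in M.
have m0 : 0 < 4 * Num.sqrt (lam / 2) by rewrite mulr_gt0// sqrtr_gt0 divr_gt0.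
have C g : pp_elastica lam l g -> ~ is_segment g -> exists n q' al' sg' r,
    [/\ is_wave lam l g n q' al' sg' r, reg q',
        Elam lam g = 4 * Num.sqrt (lam / 2) * (n.+1%:R * hh q') &
        hh q <= n.+1%:R * hh q' /\ (hh q = n.+1%:R * hh q' -> [/\ n = 0, q' = q & sg' = sg])].
  move=> ppg nsg; have [n [q' [al' [sg' [r W]]]]] := classification lam0 l0 ppg nsg.
  exists n, q', al', sg', r.
  have [[al'0 sg'1 r1 /andP[q'0 q'1] q'2] [lamE' lE' En' _]] := W.
  have rq' : reg q' by [].
  have n0 : 0 < n.+1%:R :> R by rewrite ltr0n.
  have M' := wave_modulus rq' al'0 n0 lamE' lE'.
  split; [exact: W|exact: rq'| |].
    by rewrite En' (wave_energy rq' al'0 n0 (sign_sqr sg'1) lamE' lE').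
  by apply: cmp => //; rewrite M' M.
split; [exact: pp|exact: ns| |].
  move=> g ppg nsg; have [n [q' [al' [sg' [r [_ _ -> [H _]]]]]]] := C g ppg nsg.
  by rewrite En ler_pM2l.
move=> g ppg nsg EE; have [n [q' [al' [sg' [r [W _ Eg [_ H]]]]]]] := C g ppg nsg.
move: EE; rewrite Eg En => /(mulfI (lt0r_neq0 m0)) /esym/H[n0 qE sgE]; subst n q' sg'.
have [[al'0 _ r1 _ _] [_ lE' _ [s [s0 s1 cs ms gE]]]] := W.
have alE : al' = al.
  have : l * al' = l * al.
    by rewrite {1}lE' lE; field; rewrite !gt_eqF.
  by apply: mulfI; rewrite gt_eqF.
rewrite alE in s1 gE.
exists r, s; split; first exact: r1.
split; first exact: s0.
split; first by rewrite s1 mulr1.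
split; first exact: continuous_subspaceT.
by split; [move=> x y _ xy _; exact: ms|exact: gE].
Qed.

Lemma gq_uu q : reg q -> gq q = 8 * uu q ^+ 2.
Proof. by move=> rq; rewrite /gq /uu exprMn sW_sqr// /DD /WW; ring. Qed.

Lemma uu_at q : reg q -> {for q, continuous (@uu R)}.
Proof. by move=> rq; exact: is_derive_cont_at (der_uu rq). Qed.

(** [gq = 8 uu^2] forgets the sign of [uu]. The branch restores it, as [DD] is positive before [qs]
    and, for [q3P], negative after it. *)
Lemma q2P c : 0 < c -> 8 * c ^+ 2 <= lamhat R ->
  [/\ qh <= q2 (8 * c ^+ 2), q2 (8 * c ^+ 2) < qs & uu (q2 (8 * c ^+ 2)) = c].
Proof.
move=> c0 ch; have [h0 h2 hs _] := qhatP R; have [s0 s1 D0] := qstarP R.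
have u0 := uu_qhat_gt0 R.
have {}ch : c <= uu qh.
  move: ch; rewrite /lamhat gq_uu; last exact: reg_qhat.
  by rewrite ler_pM2l// ler_sqr ?nnegrE// ltW.
have ex : exists q, qh <= q < qs /\ gq q = 8 * c ^+ 2.
  have [||x [/andP[hx xs] Ex]] := @ivt_for R (@uu R) qh qs c (ltW hs).
  - by move=> x /andP[hx xs]; apply: uu_at; apply: (reg_up (reg_qhat R)) => //; exact: le_lt_trans xs s1.
  - by rewrite uu_qstar ge_min le_max ch (ltW c0) orbT.
  exists x; split; last by rewrite gq_uu ?Ex//; apply: (reg_up (reg_qhat R)) => //; exact: le_lt_trans xs s1.
  by rewrite hx lt_neqAle xs andbT; apply/eqP => xE; move: c0; rewrite -Ex xE uu_qstar ltxx.
have [/andP[hQ Qs] EQ] := @xgetPex _ 0 [set q | qh <= q < qs /\ gq q = 8 * c ^+ 2] ex.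
rewrite -/(q2 (8 * c ^+ 2)) in hQ Qs EQ.
have Q1 := lt_trans Qs s1.
have rQ := reg_up (reg_qhat R) hQ Q1.
split=> //; move: EQ; rewrite gq_uu// => /(mulfI (lt0r_neq0 (ltr0Sn R 7))) /eqP.
rewrite eqf_sqr => /orP[/eqP//|/eqP E].
have [Q0 _ _] := rQ.
have : 0 < uu (q2 (8 * c ^+ 2)) by rewrite mulr_gt0 ?DD_pos// sW_gt0.
by rewrite E; lra.
Qed.

Lemma q3P c : 0 < c ->
  [/\ qs < q3 (8 * c ^+ 2), q3 (8 * c ^+ 2) < 1 & uu (q3 (8 * c ^+ 2)) = - c].
Proof.
move=> c0; have [s0 s1 D0] := qstarP R.
have rs := reg_qstar R.
have ex : exists q, qs < q < 1 /\ gq q = 8 * c ^+ 2.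
  (* Since [p^2 > 3 / 4] gives [sqrt (WW p) >= 1 / 2], the bound [DD p <= - 2 c] suffices for
     [uu p <= - c]. *)
  have [|p [p0 p1 p2 Dp]] := @DD_lower R (2 * c); first by rewrite mulr_ge0// ltW.
  have rp : reg p by split=> //; lra.
  have s12 : 1 / 2 <= Num.sqrt (WW p).
    have -> : (1 / 2 : R) = Num.sqrt ((1 / 2) ^+ 2) by rewrite sqrtr_sqr ger0_norm//; lra.
    by rewrite ler_wsqrtr// /WW expr2; lra.
  have up : uu p <= - c by rewrite /uu; nra.
  have sp : qs < p by apply: uu_neg_gt => //; lra.
  have [||x [/andP[sx xp] Ex]] := @ivt_for R (@uu R) qs p (- c) (ltW sp).
  - by move=> x /andP[hx xs]; apply: uu_at; apply: (reg_up rs) => //; exact: le_lt_trans xs p1.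
  - by rewrite uu_qstar ge_min le_max up oppr_le0 (ltW c0) orbT.
  have x1 : x < 1 by exact: le_lt_trans xp p1.
  exists x; split; last by rewrite gq_uu ?Ex ?sqrrN//; exact: (reg_up rs).
  rewrite x1 andbT lt_neqAle sx andbT; apply/eqP => xE.
  by move: c0; rewrite -oppr_lt0 -Ex -xE uu_qstar ltxx.
have [/andP[sQ Q1] EQ] := @xgetPex _ 0 [set q | qs < q < 1 /\ gq q = 8 * c ^+ 2] ex.
rewrite -/(q3 (8 * c ^+ 2)) in sQ Q1 EQ.
have rQ := reg_up rs (ltW sQ) Q1.
split=> //; move: EQ; rewrite gq_uu// => /(mulfI (lt0r_neq0 (ltr0Sn R 7))) /eqP.
rewrite eqf_sqr => /orP[/eqP E|/eqP//].
have : uu (q3 (8 * c ^+ 2)) < 0 by rewrite pmulr_llt0 ?sW_gt0// DD_neg.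
by rewrite E; lra.
Qed.

End Minimality.

Theorem theorem1p3 (R : realType) (lam l : R) :
  0 < lam -> 0 < l ->
  (lam * l ^+ 2 <= lamhat R ->
     unique_min_nontrivial lam l (larc lam l) (larc_len lam l)) /\
  (lamhat R < lam * l ^+ 2 ->
     unique_min_nontrivial lam l (loop lam l) (loop_len lam l)).
Proof.
move=> lam0 l0.
(* The right-hand side of the end condition [wave_modulus]; since [gq = 8 uu^2], its square matches
   the argument of [q2] and [q3]. *)
pose c := Num.sqrt (lam / 2) * l / 2.
have c0 : 0 < c by rewrite divr_gt0// mulr_gt0// sqrtr_gt0 divr_gt0.
have m2 : Num.sqrt (lam / 2) ^+ 2 = lam / 2 by rewrite sqr_sqrtr// divr_ge0// ltW.
have cE : lam * l ^+ 2 = 8 * c ^+ 2 by rewrite /c !exprMn exprVn m2; field.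
have [s0 s1 D0] := qstarP R; have [h0 h2 hs _] := qhatP R.
(* Inverts the end condition: once the modulus has the right [uu], the scale prescribed by
   [larc_alpha] or [loop_alpha] realizes both [lam] and [l]. *)
have scale q al sg : reg q -> sg ^+ 2 = 1 -> sg * uu q = c -> al = 2 / l * (sg * DD q) ->
    [/\ 0 < al, lam = 2 * al ^+ 2 * (2 * q ^+ 2 - 1) & l = sg * 2 * (2 * ellEc q - ellK q) / al].
  move=> rq sg2 uq alE; have W0 := sW_gt0 rq.
  have D : 0 < sg * DD q by rewrite -(@pmulr_lgt0 _ (Num.sqrt (WW q)))// -mulrA -/(uu q) uq.
  have al0 : 0 < al by rewrite alE mulr_gt0// divr_gt0.
  have [lz alz] : l != 0 /\ al != 0 by rewrite !gt_eqF.
  split=> //.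
    have : lam * l ^+ 2 = 8 * DD q ^+ 2 * WW q.
      by rewrite cE -uq exprMn sg2 mul1r /uu exprMn sW_sqr// mulrA.
    move=> /(canRL (mulfK (expf_neq0 2 lz))) ->.
    rewrite alE -/(WW q) !exprMn sg2; field.
    exact: lz.
  apply: (canRL (mulfK alz)); rewrite alE /DD; field.
  exact: lz.
split=> H.
- rewrite cE in H; have [hQ Qs uQ] := q2P c0 H; rewrite -cE in hQ Qs uQ.
  set Q := q2 (lam * l ^+ 2) in hQ Qs uQ.
  have rQ : reg Q by apply: (reg_up (reg_qhat R)) => //; exact: lt_trans Qs s1.
  have := scale Q (larc_alpha lam l) 1 rQ.
  rewrite expr1n mul1r => /(_ erefl uQ); rewrite mul1r => /(_ erefl)[al0 lamE lE].
  have -> : larc lam l = wave Q (larc_alpha lam l) 1.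
    by apply/funext => s; rewrite /larc /wave -/(larc_q lam l) mul1r.
  apply: unique_min_wave => //; first by left.
  move=> n q sg rq sg1 E; rewrite mul1r uQ in E.
  by apply: (larc_compare hQ Qs uQ).
- have [sQ Q1 uQ] := q3P c0; rewrite -cE in sQ Q1 uQ.
  set Q := q3 (lam * l ^+ 2) in sQ Q1 uQ.
  have rQ : reg Q by apply: (reg_up (reg_qstar R)) => //; exact: ltW.
  have := scale Q (loop_alpha lam l) (-1) rQ.
  rewrite sqrrN expr1n mulN1r uQ opprK => /(_ erefl erefl).
  rewrite mulN1r /loop_alpha -/(loop_q lam l) => /(_ _)[|al0 lamE lE].
    by congr (_ * _); rewrite /DD opprB.
  have -> : loop lam l = wave Q (loop_alpha lam l) (-1).
    apply/funext => s; rewrite /loop /wave -/(loop_q lam l).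
    congr (_ / _, _); ring.
  apply: unique_min_wave => //; first by right.
  move=> n q sg rq sg1 E; rewrite mulN1r uQ opprK in E.
  apply: (loop_compare sQ Q1 (c0 := c)) => //; first by rewrite uQ opprK.
  move: H; rewrite cE /lamhat gq_uu; last exact: reg_qhat.
  by rewrite ltr_pM2l// ltr_sqr ?nnegrE ?(ltW c0)// ltW// uu_qhat_gt0.
Qed.
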